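(* Under the standing setting: (a) If $f_0=0$ and $f_\infty=\infty$, then for every $\lambda\in(0,\infty)$ problem (P$_\lambda$) has a positive solution $u_\lambda$, and these solutions can be chosen so that $\|u_\lambda\|_\infty\to\infty$ as $\lambda\to0^+$ and $\|u_\lambda\|_\infty\to0$ as $\lambda\to\infty$. (b) If $f_0=\infty$ and $f_\infty=0$, then for every $\lambda\in(0,\infty)$ problem (P$_\lambda$) has a positive solution $u_\lambda$, and these can be chosen so that $\|u_\lambda\|_\infty\to0$ as $\lambda\to0^+$ and $\|u_\lambda\|_\infty\to\infty$ as $\lambda\to\infty$.
   Context: Standing setting. $\varphi:\mathbb{R}\to\mathbb{R}$ is an odd, increasing homeomorphism satisfying condition (A): there exist increasing homeomorphisms $\psi_1,\psi_2:[0,\infty)\to[0,\infty)$ such that $\varphi(x)\psi_1(y)\le \varphi(xy)\le \varphi(x)\psi_2(y)$ for all $x,y\ge 0$. Let $c,d\in C([0,1],(0,\infty))$, and $\|\cdot\|_\infty$ the maximum norm on $C[0,1]$. Let $f\in C([0,\infty),[0,\infty))$ with $f(s)>0$ for $s>0$, and write $f_0=\lim_{s\to0^+}f(s)/\varphi(s)$, $f_\infty=\lim_{s\to\infty}f(s)/\varphi(s)$ (assumed to exist in $[0,\infty]$ whenever referred to). Let $h\in C((0,1),[0,\infty))$, $h\not\equiv 0$, with $\int_0^{1/2}\psi_1^{-1}\big(\int_s^{1/2}h(\tau)d\tau\big)ds+\int_{1/2}^1\psi_1^{-1}\big(\int_{1/2}^s h(\tau)d\tau\big)ds<\infty$. Notation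 attached to $h$: $\alpha_h=\sup\{x\in(0,1): h=0 \text{ on }(0,x)\}$ ($0$ if empty); $\beta_h=\inf\{x\in(0,1): h=0\text{ on }(x,1)\}$ ($1$ if empty); $\bar\alpha_h=\sup\{x\in(\alpha_h,1]: h>0 \text{ on }(\alpha_h,x)\}$; $\bar\beta_h=\inf\{x\in[0,\beta_h): h>0\text{ on }(x,\beta_h)\}$; $\gamma_h^1=(3\alpha_h+\bar\alpha_h)/4$, $\gamma_h^2=(\bar\beta_h+3\beta_h)/4$. It is assumed that $0\le\alpha_h<\gamma_h^1<\gamma_h^2<\beta_h\le 1$. For $\lambda\ge0$, problem (P$_\lambda$) is: $(d(t)\varphi(c(t)u'(t)))'+\lambda h(t)f(u(t))=0$ for $t\in(0,1)$, $u(0)=u(1)=0$. A solution is $u\in C[0,1]\cap C^1(0,1)$ such that $t\mapsto d(t)\varphi(c(t)u'(t))$ is continuously differentiable on $(0,1)$ and the equation and boundary conditions hold; it is positive if $u(t)>0$ for all $t\in(0,1)$. *)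

(* Defs.v *)
From Stdlib Require Import Reals Lra ClassicalEpsilon.
Open Scope R_scope.

Definition cont_on (D : R -> Prop) (f : R -> R) : Prop :=
  forall x, D x -> forall eps, eps > 0 -> exists del, del > 0 /\
    forall y, D y -> Rabs (y - x) < del -> Rabs (f y - f x) < eps.

Definition incr_homeo_R (phi : R -> R) : Prop :=
  continuity phi /\ (forall x y, x < y -> phi x < phi y) /\
  exists g : R -> R, continuity g /\ (forall x, g (phi x) = x) /\ (forall y, phi (g y) = y).

Definition nonneg_set (x : R) : Prop := 0 <= x.

Definition incr_homeo_pos (psi : R -> R) : Prop :=
  (forall x, 0 <= x -> 0 <= psi x) /\ cont_on nonneg_set psi /\
  (forall x y, 0 <= x -> x < y -> psi x < psi y) /\
  exists g : R -> R, (forall y, 0 <= y -> 0 <= g y) /\ cont_on nonneg_set g /\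
    (forall x, 0 <= x -> g (psi x) = x) /\ (forall y, 0 <= y -> psi (g y) = y).

Definition condA (phi psi1 psi2 : R -> R) : Prop :=
  incr_homeo_pos psi1 /\ incr_homeo_pos psi2 /\
  forall x y, 0 <= x -> 0 <= y ->
    phi x * psi1 y <= phi (x * y) <= phi x * psi2 y.

Definition is_RInt (f : R -> R) (a b I : R) : Prop :=
  exists pr : Riemann_integrable f a b, RiemannInt pr = I.

Definition RInt (f : R -> R) (a b : R) : R :=
  epsilon (inhabits 0) (fun I => is_RInt f a b I).

(* the integrability condition on h, with g the inverse of psi1 on [0,oo):
   both improper integrals (singular at 0, resp. at 1) are finite *)
Definition h_integrability (h g : R -> R) : Prop :=
  (exists L, forall eps, eps > 0 -> exists del, del > 0 /\
     forall x, 0 < x < del ->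
       Rabs (RInt (fun s => g (RInt h s (1/2))) x (1/2) - L) < eps) /\
  (exists L, forall eps, eps > 0 -> exists del, del > 0 /\
     forall x, 0 < x < del ->
       Rabs (RInt (fun s => g (RInt h (1/2) s)) (1/2) (1 - x) - L) < eps).

Definition is_glb (E : R -> Prop) (m : R) : Prop :=
  (forall x, E x -> m <= x) /\ (forall b, (forall x, E x -> b <= x) -> b <= m).

Definition alpha_set (h : R -> R) (x : R) : Prop :=
  0 < x < 1 /\ forall t, 0 < t < x -> h t = 0.
Definition beta_set (h : R -> R) (x : R) : Prop :=
  0 < x < 1 /\ forall t, x < t < 1 -> h t = 0.

Definition is_alpha_h (h : R -> R) (a : R) : Prop :=
  ((exists x, alpha_set h x) /\ is_lub (alpha_set h) a) \/
  ((~ exists x, alpha_set h x) /\ a = 0).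
Definition is_beta_h (h : R -> R) (b : R) : Prop :=
  ((exists x, beta_set h x) /\ is_glb (beta_set h) b) \/
  ((~ exists x, beta_set h x) /\ b = 1).
Definition is_alphabar_h (h : R -> R) (a abar : R) : Prop :=
  is_lub (fun x => a < x <= 1 /\ forall t, a < t < x -> h t > 0) abar.
Definition is_betabar_h (h : R -> R) (b bbar : R) : Prop :=
  is_glb (fun x => 0 <= x < b /\ forall t, x < t < b -> h t > 0) bbar.

Definition is_solution (phi c d h f : R -> R) (lam : R) (u : R -> R) : Prop :=
  cont_on (fun t => 0 <= t <= 1) u /\
  exists u' : R -> R,
    (forall t, 0 < t < 1 -> derivable_pt_lim u t (u' t)) /\
    cont_on (fun t => 0 < t < 1) u' /\
    exists w' : R -> R,
      (forall t, 0 < t < 1 ->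
         derivable_pt_lim (fun s => d s * phi (c s * u' s)) t (w' t)) /\
      cont_on (fun t => 0 < t < 1) w' /\
      (forall t, 0 < t < 1 -> w' t + lam * h t * f (u t) = 0) /\
      u 0 = 0 /\ u 1 = 0.

Definition is_pos_solution (phi c d h f : R -> R) (lam : R) (u : R -> R) : Prop :=
  is_solution phi c d h f lam u /\ (forall t, 0 < t < 1 -> u t > 0).

Definition norm_inf (u : R -> R) : R :=
  epsilon (inhabits 0)
    (fun M => is_lub (fun y => exists t, 0 <= t <= 1 /\ y = Rabs (u t)) M).

Definition ratio_0_to_0 (f phi : R -> R) : Prop :=
  forall eps, eps > 0 -> exists del, del > 0 /\
    forall s, 0 < s < del -> Rabs (f s / phi s) < eps.
Definition ratio_0_to_inf (f phi : R -> R) : Prop :=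
  forall M, exists del, del > 0 /\ forall s, 0 < s < del -> f s / phi s > M.
Definition ratio_inf_to_0 (f phi : R -> R) : Prop :=
  forall eps, eps > 0 -> exists K, forall s, s > K -> Rabs (f s / phi s) < eps.
Definition ratio_inf_to_inf (f phi : R -> R) : Prop :=
  forall M, exists K, forall s, s > K -> f s / phi s > M.

Definition tends_inf_at_0plus (N : R -> R) : Prop :=
  forall M, exists del, del > 0 /\ forall lam, 0 < lam < del -> N lam > M.
Definition tends_0_at_0plus (N : R -> R) : Prop :=
  forall eps, eps > 0 -> exists del, del > 0 /\
    forall lam, 0 < lam < del -> Rabs (N lam) < eps.
Definition tends_inf_at_inf (N : R -> R) : Prop :=
  forall M, exists K, forall lam, lam > K -> N lam > M.
Definition tends_0_at_inf (N : R -> R) : Prop :=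
  forall eps, eps > 0 -> exists K, forall lam, lam > K -> Rabs (N lam) < eps.

(* Main.v *)
Require Import Defs.
From Stdlib Require Import Reals Lra Lia ZArith ClassicalEpsilon Classical.
From mathcomp Require filter.
From Coquelicot Require Coquelicot.
From Coquelicot Require Import Hierarchy.
Open Scope R_scope.

(** The solution is the limit of difference schemes. On the grid of step [1/N] the pair
    [(u, w)], with [w = d phi(c u')], is computed by a recursion that starts from [u = 0] and a
    slope parameter [p]; it depends continuously on [p], so the condition [u(1) = 0] can be met
    by the intermediate value theorem once [u(1)] has opposite signs for small and for large
    [p]. The signs follow from two estimates for the maximum [m] of [u]. If [u(1) <= 0], the
    mass of [lam h f(u)] has brought [u] back to [0], so [lam f <= a0 phi(m)] cannot hold
    on all of [(0, m]]. If [u(1) >= 0], then [u >= kap m] away from the end points (a Harnack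
    inequality, because [w] is monotone), and [lam f >= b0 phi(m)] cannot hold on [[kap m, m]].
    The same two estimates locate [m] when [lam] tends to [0] or to infinity.
    Limits are taken along a free ultrafilter, so no subsequence is extracted; the differential
    equation passes to the limit because the increments of [w] over [[x, y]] lie between those
    of [H = int h] multiplied by nearby values of [lam f(u)]. *)

(** * Limits along an ultrafilter *)

(** Shooting is done on the discrete problem because the differential equation offers no shooting
    map: [f] is merely continuous, so initial value problems need not be uniquely solvable, and [h]
    may be so singular at 0 that [w] is unbounded there and no initial slope exists. The recursion
    is explicit, hence single valued and continuous in [p]; what must be uniform in [N] are the
    estimates. The singularity of [h] is absorbed by [G], an antiderivative of [g o |H|] with [g]
    the inverse of psi1. Condition (A) yields Phi(y z) <= Phi(y) g(z) for the inverse Phi of phi, so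
    the unbounded part of the slopes sums up to an increment of [G], which the integrability
    condition makes finite. The constants come from the contradictions they must produce for the
    maximum m: [a0] makes the total rise of [u] smaller than m, and [b0] makes the rise at least 2
    m. Both estimates have the form that m cannot be a maximum, so the two growth cases of the
    theorem differ only in which estimate acts near 0 and which near infinity. *)

Section FreeUltrafilter.
Context {W : (nat -> Prop) -> Prop}.
Record free_ultrafilter : Prop := {
  uf_sub : forall P Q : nat -> Prop, (forall n, P n -> Q n) -> W P -> W Q;
  uf_and : forall P Q : nat -> Prop, W P -> W Q -> W (fun n => P n /\ Q n);
  uf_or : forall P : nat -> Prop, W P \/ W (fun n => ~ P n);
  uf_ex : forall P : nat -> Prop, W P -> exists n, P n;
  uf_ge : forall N, W (fun n => (N <= n)%nat) }.
End FreeUltrafilter.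
Arguments free_ultrafilter : clear implicits.

(** The filter [E] of sets containing a tail of the integers is proper, and the ultrafilter lemma
    extends it. Containing [E] is what makes the result free. *)
Lemma free_ultrafilter_exists : exists W, free_ultrafilter W.
Proof.
pose (E := fun P : nat -> Prop => exists N, forall n, (N <= n)%nat -> P n).
assert (HE : filter.ProperFilter E).
{ split.
  - intros [N HN]. exact (HN N (le_n N)).
  - split.
    + exists 0%nat. intros n _. exact I.
    + intros P Q [N HN] [M HM]. exists (max N M). intros n Hn. split.
      * apply HN; lia.
      * apply HM; lia.
    + intros P Q HPQ [N HN]. exists N. intros n Hn. apply HPQ, HN, Hn. }
destruct (filter.ultraFilterLemma HE) as [W [HW HEW]].
pose proof (filter.ultra_proper (F := W)) as [Hne [HT HI HS]].
exists W. split.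
- intros P Q HPQ. apply HS. exact HPQ.
- intros P Q HP HQ. exact (HI P Q HP HQ).
- intros P. exact (filter.in_ultra_setVsetC P HW).
- intros P HP. apply NNPP. intro H. apply Hne.
  apply (HS P); [|exact HP]. intros n Hn. exfalso. apply H. exists n. exact Hn.
- intros N. apply HEW. exists N. auto.
Qed.

Definition ulim (W : (nat -> Prop) -> Prop) (a : nat -> R) (l : R) : Prop :=
  forall eps, eps > 0 -> W (fun n => Rabs (a n - l) < eps).

Section Ulim.
Context {W : (nat -> Prop) -> Prop}.
Hypothesis HW : free_ultrafilter W.

Lemma uf_all (P : nat -> Prop) : (forall n, P n) -> W P.
Proof.
intros H. apply (uf_sub HW (fun n => (0 <= n)%nat)); [auto|apply (uf_ge HW)].
Qed.

Lemma uf_from (P : nat -> Prop) N : (forall n, (N <= n)%nat -> P n) -> W P.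
Proof. intros H. apply (uf_sub HW (fun n => (N <= n)%nat)); [auto|apply (uf_ge HW)]. Qed.

(** The limit is the supremum of the x that lie below [a n] for almost all n. The alternative
    [uf_or] plays the part of compactness: if [a n] were not close to l on one side for almost all
    n, the opposite inequality would hold for almost all n and contradict the supremum. *)
Lemma ulim_ex (a : nat -> R) B : W (fun n => Rabs (a n) <= B) -> exists l, ulim W a l.
Proof.
intros HB.
destruct (completeness (fun x => W (fun n => x <= a n))) as [l [Hub Hlub]].
- exists B. intros x Hx.
  destruct (uf_ex HW _ (uf_and HW _ _ HB Hx)) as [n [H1 H2]].
  pose proof (Rle_abs (a n)). lra.
- exists (- B). apply (uf_sub HW _ _) with (2 := HB). intros n Hn.
  pose proof (Rle_abs (- a n)) as H. rewrite Rabs_Ropp in H. lra.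
- exists l. intros eps Heps.
  assert (H1 : W (fun n => l - eps < a n)).
  { destruct (uf_or HW (fun n => l - eps < a n)) as [H|H]; [exact H|].
    exfalso. assert (l <= l - eps); [|lra]. apply Hlub. intros x Hx.
    destruct (uf_ex HW _ (uf_and HW _ _ H Hx)) as [n [H1 H2]]. lra. }
  assert (H2 : W (fun n => a n < l + eps)).
  { destruct (uf_or HW (fun n => a n < l + eps)) as [H|H]; [exact H|].
    exfalso. assert (l + eps <= l); [|lra]. apply Hub.
    apply (uf_sub HW _ _) with (2 := H). intros n Hn. lra. }
  apply (uf_sub HW _ _) with (2 := uf_and HW _ _ H1 H2).
  intros n [H3 H4]. apply Rabs_def1; lra.
Qed.

Lemma ulim_le a b l m : ulim W a l -> ulim W b m -> W (fun n => a n <= b n) -> l <= m.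
Proof.
intros Ha Hb Hab. apply Rnot_lt_le. intro Hlt.
destruct (uf_ex HW _ (uf_and HW _ _ Hab (uf_and HW _ _
  (Ha ((l - m) / 2) ltac:(lra)) (Hb ((l - m) / 2) ltac:(lra))))) as [n [H1 [H2 H3]]].
apply Rabs_def2 in H2. apply Rabs_def2 in H3. lra.
Qed.

Lemma ulim_const l : ulim W (fun _ => l) l.
Proof.
intros eps Heps. apply uf_all. intros _.
replace (l - l) with 0 by ring. rewrite Rabs_R0. exact Heps.
Qed.

Lemma ulim_comp a l (f : R -> R) :
  (forall eps, eps > 0 -> exists del, del > 0 /\
     forall y, Rabs (y - l) < del -> Rabs (f y - f l) < eps) ->
  ulim W a l -> ulim W (fun n => f (a n)) (f l).
Proof.
intros Hf Ha eps Heps. destruct (Hf eps Heps) as [del [Hdel H]].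
apply (uf_sub HW _ _) with (2 := Ha del Hdel). auto.
Qed.

Lemma ulim_minus a b l m : ulim W a l -> ulim W b m -> ulim W (fun n => a n - b n) (l - m).
Proof.
intros Ha Hb eps Heps.
apply (uf_sub HW _ _) with (2 := uf_and HW _ _ (Ha (eps / 2) ltac:(lra)) (Hb (eps / 2) ltac:(lra))).
intros n [H1 H2]. apply Rabs_def2 in H1. apply Rabs_def2 in H2. apply Rabs_def1; lra.
Qed.

Lemma ulim_abs a l : ulim W a l -> ulim W (fun n => Rabs (a n)) (Rabs l).
Proof.
apply ulim_comp. intros eps Heps. exists eps. split; [exact Heps|].
intros y Hy. eapply Rle_lt_trans; [apply Rabs_triang_inv2|exact Hy].
Qed.

Lemma ulim_scal k a l : ulim W a l -> ulim W (fun n => k * a n) (k * l).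
Proof.
apply (ulim_comp a l (fun x => k * x)). intros eps Heps.
assert (Hk : 0 < Rabs k + 1) by (pose proof (Rabs_pos k); lra).
exists (eps / (Rabs k + 1)). split; [apply Rdiv_lt_0_compat; lra|].
intros y Hy. replace (k * y - k * l) with (k * (y - l)) by ring. rewrite Rabs_mult.
pose proof (Rabs_pos (y - l)).
apply Rle_lt_trans with ((Rabs k + 1) * Rabs (y - l)); [nra|].
apply (Rmult_lt_compat_l (Rabs k + 1)) in Hy; [|exact Hk].
replace ((Rabs k + 1) * (eps / (Rabs k + 1))) with eps in Hy by (field; lra). exact Hy.
Qed.

End Ulim.

(** * One-sided estimates for the difference scheme *)

(** Summation of an inequality between increments. Cellwise bounds become bounds over a range of
    nodes through it, with one sequence typically zero or linear in the position. *)
Lemma telescope_le (a b : nat -> R) i j :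
  (i <= j)%nat ->
  (forall k, (i <= k < j)%nat -> a (S k) - a k <= b (S k) - b k) ->
  a j - a i <= b j - b i.
Proof.
intros Hij. induction Hij as [|j Hij IH]; intros H; [lra|].
assert (H1 := H j ltac:(lia)).
assert (H2 := IH (fun k Hk => H k ltac:(lia))). lra.
Qed.

Section Records.
Context {phi Phi g psi2 : R -> R}.
(** Condition (A) seen through the inverse [Phi] of [phi], where [g] is the inverse of psi1 on the
    half-line. [gd_Phi_mul] is its lower inequality at the points [Phi y] and [g z], and
    [gd_mul_Phi] its upper one. They replace homogeneity. *)
Record growth_data : Prop := {
  gd_phi_lt : forall x y, x < y -> phi x < phi y;
  gd_phi_0 : phi 0 = 0;
  gd_phiK : forall x, Phi (phi x) = x;
  gd_PhiK : forall y, phi (Phi y) = y;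
  gd_Phi_odd : forall y, Phi (- y) = - Phi y;
  gd_Phi_cont : continuity Phi;
  gd_g_pos : forall y, 0 <= y -> 0 <= g y;
  gd_Phi_mul : forall y z, 0 <= y -> 0 <= z -> Phi (y * z) <= Phi y * g z;
  gd_psi2_pos : forall x, 0 <= x -> 0 <= psi2 x;
  gd_mul_Phi : forall m z, 0 <= m -> 0 <= z -> m * z <= Phi (phi m * psi2 z) }.

(* [u i] sits at the node [i/N], while [w], [K], [c], [e] live on the cells [1..N]. *)
Context {F : R -> R} {cmin cmax dmin dmax : R} {N : nat} {c e K u w : nat -> R}.
Record scheme : Prop := {
  sc_N : (0 < N)%nat;
  sc_cmin : 0 < cmin; sc_dmin : 0 < dmin;
  sc_c : forall i, (1 <= i <= N)%nat -> cmin <= c i <= cmax;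
  sc_e : forall i, (1 <= i <= N)%nat -> dmin <= e i <= dmax;
  sc_F : forall s, 0 <= F s;
  sc_u : forall i, (i < N)%nat ->
    u (S i) = u i + / INR N * (/ c (S i) * Phi (w (S i) / e (S i)));
  sc_w : forall i, (1 <= i < N)%nat -> w i - w (S i) = F (u i) * (K (S i) - K i);
  sc_K : forall i, (1 <= i < N)%nat -> K i <= K (S i) }.
End Records.
Arguments growth_data : clear implicits.
Arguments scheme : clear implicits.

Definition max_node (N : nat) (u : nat -> R) (s : nat) : Prop :=
  (s <= N)%nat /\ forall i, (i <= N)%nat -> u i <= u s.

Lemma max_node_ex N u : exists s, max_node N u s.
Proof.
induction N as [|N [s [Hs H]]].
- exists 0%nat. split; [lia|]. intros i Hi. replace i with 0%nat by lia. lra.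
- destruct (Rle_lt_dec (u (S N)) (u s)) as [Hl|Hl].
  + exists s. split; [lia|]. intros i Hi.
    destruct (Nat.eq_dec i (S N)) as [->|Hne]; [lra|apply H; lia].
  + exists (S N). split; [lia|]. intros i Hi.
    destruct (Nat.eq_dec i (S N)) as [->|Hne]; [lra|].
    assert (u i <= u s) by (apply H; lia). lra.
Qed.

Section Phi.
Context {phi Phi g psi2 : R -> R}.
Hypothesis HG : growth_data phi Phi g psi2.

Lemma phi_le x y : x <= y -> phi x <= phi y.
Proof. intros [H| ->]; [left; apply (gd_phi_lt HG), H|lra]. Qed.

Lemma Phi_lt x y : x < y -> Phi x < Phi y.
Proof.
intros H. apply Rnot_le_lt. intro Hle. apply phi_le in Hle.
rewrite !(gd_PhiK HG) in Hle. lra.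
Qed.

Lemma Phi_le x y : x <= y -> Phi x <= Phi y.
Proof. intros [H| ->]; [left; apply Phi_lt, H|lra]. Qed.

Lemma Phi_0 : Phi 0 = 0.
Proof. rewrite <- (gd_phi_0 HG) at 1. apply (gd_phiK HG). Qed.

Lemma Phi_ge0 x : 0 <= x -> 0 <= Phi x.
Proof. intros H. rewrite <- Phi_0. apply Phi_le, H. Qed.

Lemma phi_ge0 x : 0 <= x -> 0 <= phi x.
Proof. intros H. rewrite <- (gd_phi_0 HG). apply phi_le, H. Qed.

Lemma phi_gt0 x : 0 < x -> 0 < phi x.
Proof. intros H. rewrite <- (gd_phi_0 HG). apply (gd_phi_lt HG), H. Qed.

Lemma div_le_div x y a b : 0 <= x -> x <= y -> 0 < a -> a <= b -> x / b <= y / a.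
Proof.
intros Hx Hxy Ha Hab. unfold Rdiv. apply Rmult_le_compat; auto.
- left. apply Rinv_0_lt_compat. lra.
- apply Rinv_le_contravar; lra.
Qed.

Section Scheme.
Context {F : R -> R} {cmin cmax dmin dmax : R} {N : nat} {c e K u w : nat -> R}.
Hypothesis HS : scheme Phi F cmin cmax dmin dmax N c e K u w.

(** The symmetry t -> 1 - t. Nodes i and N - i are exchanged, but cells i and N + 1 - i; the flux
    [w] changes sign, which [Phi] tolerates because it is odd, and [K] changes sign so that its
    increments stay nonnegative. Thanks to it, estimates are proved only to the left of the
    maximum. *)
Lemma scheme_reflect :
  scheme Phi F cmin cmax dmin dmax N (fun i => c (S N - i)%nat) (fun i => e (S N - i)%nat)
    (fun i => - K (S N - i)%nat) (fun i => u (N - i)%nat) (fun i => - w (S N - i)%nat).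
Proof.
destruct HS as [h1 h2 h3 h4 h5 h6 h7 h8 h9]. split; auto.
- intros i Hi. apply h4. lia.
- intros i Hi. apply h5. lia.
- intros i Hi. assert (E := h7 (N - S i)%nat ltac:(lia)).
  replace (S (N - S i)) with (N - i)%nat in E by lia.
  replace (S N - S i)%nat with (N - i)%nat by lia.
  unfold Rdiv in *. rewrite Ropp_mult_distr_l_reverse, (gd_Phi_odd HG). lra.
- intros i Hi. assert (E := h8 (N - i)%nat ltac:(lia)).
  replace (S (N - i)) with (S N - i)%nat in E by lia.
  replace (S N - S i)%nat with (N - i)%nat by lia. lra.
- intros i Hi. assert (E := h9 (N - i)%nat ltac:(lia)).
  replace (S (N - i)) with (S N - i)%nat in E by lia.
  replace (S N - S i)%nat with (N - i)%nat by lia. lra.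
Qed.

Lemma INR_N_pos : 0 < INR N.
Proof. apply lt_0_INR, (sc_N HS). Qed.

(** This is the value of u' obtained by solving w = d phi(c u') for u' on the cell i. *)
Definition slope i := / c i * Phi (w i / e i).

(** Replacing [c i] and [e i] by their lower bounds enlarges the slope only if it is positive; for a
    nonpositive flux the slope is nonpositive and the right side is not. *)
Lemma slope_le i W : (1 <= i <= N)%nat -> 0 <= W -> w i <= W ->
  slope i <= / cmin * Phi (W / dmin).
Proof.
destruct HS as [h1 h2 h3 h4 h5 h6 h7 h8 h9]. intros Hi HW Hw. unfold slope.
specialize (h4 i Hi). specialize (h5 i Hi).
assert (Hc : 0 < / c i <= / cmin).
{ split; [apply Rinv_0_lt_compat; lra|apply Rinv_le_contravar; lra]. }
destruct (Rle_lt_dec (w i) 0) as [Hn|Hp].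
- assert (w i / e i <= 0).
  { unfold Rdiv. assert (0 < / e i) by (apply Rinv_0_lt_compat; lra). nra. }
  assert (Phi (w i / e i) <= 0) by (rewrite <- Phi_0; apply Phi_le; lra).
  assert (0 <= Phi (W / dmin)).
  { apply Phi_ge0. apply Rmult_le_pos; [lra|]. left; apply Rinv_0_lt_compat; lra. }
  nra.
- assert (H1 : Phi (w i / e i) <= Phi (W / dmin)) by (apply Phi_le, div_le_div; lra).
  assert (0 <= Phi (w i / e i)).
  { apply Phi_ge0. apply Rmult_le_pos; [lra|]. left; apply Rinv_0_lt_compat; lra. }
  nra.
Qed.

Lemma slope_ge i W : (1 <= i <= N)%nat -> 0 <= W <= w i ->
  / cmax * Phi (W / dmax) <= slope i.
Proof.
destruct HS as [h1 h2 h3 h4 h5 h6 h7 h8 h9]. intros Hi HW. unfold slope.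
specialize (h4 i Hi). specialize (h5 i Hi).
assert (Hc : 0 < / cmax <= / c i).
{ split; [apply Rinv_0_lt_compat; lra|apply Rinv_le_contravar; lra]. }
assert (H1 : Phi (W / dmax) <= Phi (w i / e i)) by (apply Phi_le, div_le_div; lra).
assert (0 <= Phi (W / dmax)).
{ apply Phi_ge0. apply Rmult_le_pos; [lra|]. left; apply Rinv_0_lt_compat; lra. }
nra.
Qed.

Lemma u_diff_le i j B : (i <= j <= N)%nat ->
  (forall k, (i < k <= j)%nat -> slope k <= B) ->
  u j - u i <= B * ((INR j - INR i) / INR N).
Proof.
intros Hij HB. assert (HN := INR_N_pos).
replace (B * ((INR j - INR i) / INR N)) with (B * (INR j / INR N) - B * (INR i / INR N))
  by (field; lra).
apply (telescope_le u (fun k => B * (INR k / INR N))); [lia|].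
intros k Hk. rewrite (sc_u HS k ltac:(lia)), S_INR.
assert (H := HB (S k) ltac:(lia)). unfold slope in H.
apply Rmult_le_compat_l with (r := / INR N) in H; [|left; apply Rinv_0_lt_compat; lra].
replace (B * ((INR k + 1) / INR N) - B * (INR k / INR N)) with (/ INR N * B) by (field; lra).
lra.
Qed.

Lemma u_diff_ge i j B : (i <= j <= N)%nat ->
  (forall k, (i < k <= j)%nat -> B <= slope k) ->
  B * ((INR j - INR i) / INR N) <= u j - u i.
Proof.
intros Hij HB. assert (HN := INR_N_pos).
replace (B * ((INR j - INR i) / INR N)) with (B * (INR j / INR N) - B * (INR i / INR N))
  by (field; lra).
apply (telescope_le (fun k => B * (INR k / INR N)) u); [lia|].
intros k Hk. rewrite (sc_u HS k ltac:(lia)), S_INR.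
assert (H := HB (S k) ltac:(lia)). unfold slope in H.
apply Rmult_le_compat_l with (r := / INR N) in H; [|left; apply Rinv_0_lt_compat; lra].
replace (B * ((INR k + 1) / INR N) - B * (INR k / INR N)) with (/ INR N * B) by (field; lra).
lra.
Qed.

Lemma K_mono i j : (1 <= i <= j)%nat -> (j <= N)%nat -> K i <= K j.
Proof.
intros Hij Hj.
assert (H := telescope_le (fun _ => 0) K i j ltac:(lia)). simpl in H.
assert (0 - 0 <= K j - K i); [|lra]. apply H. intros k Hk.
assert (Hk2 := sc_K HS k ltac:(lia)). lra.
Qed.

Lemma w_diff_le i j B : (1 <= i <= j)%nat -> (j <= N)%nat ->
  (forall k, (i <= k < j)%nat -> F (u k) <= B) -> w i - w j <= B * (K j - K i).
Proof.
intros Hij Hj HB.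
assert (H : (- w j) - (- w i) <= B * K j - B * K i).
{ apply (telescope_le (fun k => - w k) (fun k => B * K k)); [lia|].
  intros k Hk. assert (H1 := sc_w HS k ltac:(lia)).
  assert (H2 := sc_K HS k ltac:(lia)).
  assert (H3 := HB k Hk). nra. }
lra.
Qed.

Lemma w_diff_ge i j B : (1 <= i <= j)%nat -> (j <= N)%nat ->
  (forall k, (i <= k < j)%nat -> B <= F (u k)) -> B * (K j - K i) <= w i - w j.
Proof.
intros Hij Hj HB.
assert (H : B * K j - B * K i <= (- w j) - (- w i)).
{ apply (telescope_le (fun k => B * K k) (fun k => - w k)); [lia|].
  intros k Hk. assert (H1 := sc_w HS k ltac:(lia)).
  assert (H2 := sc_K HS k ltac:(lia)).
  assert (H3 := HB k Hk). nra. }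
lra.
Qed.

Lemma w_mono i j : (1 <= i <= j)%nat -> (j <= N)%nat -> w j <= w i.
Proof.
intros Hij Hj. assert (H := w_diff_ge i j 0 Hij Hj).
assert (0 * (K j - K i) <= w i - w j); [|lra].
apply H. intros k _. apply (sc_F HS).
Qed.

Lemma slope_pos i : (1 <= i <= N)%nat -> 0 < w i -> 0 < slope i.
Proof.
intros Hi Hw. unfold slope.
assert (h4 := sc_c HS i Hi).
assert (h5 := sc_e HS i Hi).
assert (h2 := sc_cmin HS).
assert (h3 := sc_dmin HS).
apply Rmult_lt_0_compat; [apply Rinv_0_lt_compat; lra|].
rewrite <- Phi_0. apply Phi_lt. apply Rdiv_lt_0_compat; lra.
Qed.

Lemma w_after_max s : max_node N u s -> (s < N)%nat -> w (S s) <= 0.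
Proof.
intros [_ Hs] HsN. apply Rnot_lt_le. intro Hp.
assert (H1 := slope_pos (S s) ltac:(lia) Hp). unfold slope in H1.
assert (H2 := sc_u HS s HsN).
assert (H3 := Hs (S s) ltac:(lia)).
assert (0 < / INR N) by apply Rinv_0_lt_compat, INR_N_pos.
assert (0 < / INR N * (/ c (S s) * Phi (w (S s) / e (S s)))) by (apply Rmult_lt_0_compat; auto).
lra.
Qed.
End Scheme.

Section Estimates.
Context {F : R -> R} {cmin cmax dmin dmax : R} {N : nat} {c e K u w : nat -> R}.
Hypothesis HS : scheme Phi F cmin cmax dmin dmax N c e K u w.

(** On the cell ending at the maximum, a negative flux would mean a descent into the maximum; this
    is [w_after_max] for the reflected scheme. Earlier cells follow since [w] is nonincreasing. *)
Lemma w_before_max s i : max_node N u s -> (1 <= i <= s)%nat -> 0 <= w i.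
Proof.
intros [Hs1 Hs2] Hi.
assert (Hmono := w_mono HS i s Hi Hs1).
assert (H := w_after_max (scheme_reflect HS) (N - s)%nat).
simpl in H. replace (N - (N - s))%nat with s in H by lia.
assert (- w s <= 0); [|lra]. apply H; [|lia]. split; [lia|].
intros j Hj. replace (N - (N - s))%nat with s by lia. apply Hs2. lia.
Qed.

(** The flux is nonpositive after the maximum, so on an earlier cell it is at most [B] times the
    mass up to the maximum, hence at most [B] times the mass up to the middle, which is [- K]. Then
    [gd_Phi_mul] splits off the factor [g (- K)], whose sum is controlled by [G] however large [- K]
    is near 0. *)
Lemma rise_before_max s M B G :
  max_node N u s -> (s <= M < N)%nat ->
  (forall i, (1 <= i <= S M)%nat -> K i <= 0) ->
  (forall i, (1 <= i <= M)%nat -> / INR N * g (- K i) <= G i - G (i - 1)%nat) ->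
  (forall i, (i <= N)%nat -> F (u i) <= B) ->
  u s - u 0%nat <= / cmin * Phi (B / dmin) * (G s - G 0%nat).
Proof.
intros Hs HsM HK HG' HB.
assert (HcB : 0 < cmin) by apply (sc_cmin HS).
assert (HdB : 0 < dmin) by apply (sc_dmin HS).
assert (HB0 : 0 <= B).
{ apply Rle_trans with (F (u 0%nat)); [apply (sc_F HS)|apply HB; lia]. }
assert (Hic : 0 < / cmin) by (apply Rinv_0_lt_compat; lra).
assert (Hid : 0 < / dmin) by (apply Rinv_0_lt_compat; lra).
replace (/ cmin * Phi (B / dmin) * (G s - G 0%nat)) with
  (/ cmin * Phi (B / dmin) * G s - / cmin * Phi (B / dmin) * G 0%nat) by ring.
apply (telescope_le u (fun k => / cmin * Phi (B / dmin) * G k)); [lia|].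
intros k Hk.
assert (HKk : K (S k) <= 0) by (apply HK; lia).
assert (Hw : w (S k) <= B * (- K (S k))).
{ assert (H1 := w_diff_le HS (S k) (S s) B ltac:(lia) ltac:(lia)
    (fun i Hi => HB i ltac:(lia))).
  assert (H2 := w_after_max HS s Hs ltac:(lia)).
  assert (H3 : K (S s) <= 0) by (apply HK; lia). nra. }
assert (H1 := slope_le HS (S k) (B * (- K (S k))) ltac:(lia)
  ltac:(nra) Hw). unfold slope in H1.
rewrite (sc_u HS k ltac:(lia)).
assert (H2 := HG' (S k) ltac:(lia)). replace (S k - 1)%nat with k in H2 by lia.
assert (H3 := gd_Phi_mul HG (B / dmin) (- K (S k))
  ltac:(apply Rmult_le_pos; lra) ltac:(lra)).
replace (B / dmin * - K (S k)) with (B * - K (S k) / dmin) in H3 by (unfold Rdiv; ring).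
assert (H4 : 0 <= Phi (B / dmin)) by (apply Phi_ge0, Rmult_le_pos; lra).
assert (H5 : 0 < / INR N) by apply Rinv_0_lt_compat, (INR_N_pos HS).
apply Rle_trans with (/ INR N * (/ cmin * (Phi (B / dmin) * g (- K (S k))))).
- assert (/ c (S k) * Phi (w (S k) / e (S k)) <= / cmin * (Phi (B / dmin) * g (- K (S k)))).
  { eapply Rle_trans; [exact H1|]. apply Rmult_le_compat_l; lra. }
  apply Rmult_le_compat_l with (r := / INR N) in H; lra.
- assert (0 <= / cmin * Phi (B / dmin)) by (apply Rmult_le_pos; lra).
  apply Rmult_le_compat_l with (1 := H) in H2. lra.
Qed.

(** A flux at least [W] on cell k was at least [W] on all earlier cells, so [u] has been rising at
    the corresponding rate since node 0. *)
Lemma u_ge_slope k W : (k <= N)%nat -> 0 <= u 0%nat -> (1 <= k)%nat -> 0 <= W <= w k ->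
  INR k / INR N * (/ cmax * Phi (W / dmax)) <= u k.
Proof.
intros Hk H0 Hk1 HW.
assert (H := u_diff_ge HS 0 k (/ cmax * Phi (W / dmax)) ltac:(lia)).
replace (INR k - INR 0) with (INR k) in H by (simpl; ring).
assert (/ cmax * Phi (W / dmax) * (INR k / INR N) <= u k - u 0%nat); [|lra].
apply H. intros i Hi. apply (slope_ge HS); [lia|].
assert (w k <= w i) by (apply (w_mono HS); lia). lra.
Qed.

(** The same flux [w k] bounds the slopes before k from below and those between k and the maximum
    from above. The two slope bounds differ only by replacing [cmax], [dmax] by [cmin], [dmin],
    which by [gd_Phi_mul] costs the factor [cmax / cmin * g (dmax / dmin)]. *)
Lemma harnack_before_max s k : max_node N u s -> (1 <= k <= s)%nat -> 0 <= u 0%nat ->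
  u s <= u k * (1 + cmax / cmin * g (dmax / dmin) * (INR N / INR k)).
Proof.
intros Hs Hk H0.
assert (HsN : (s <= N)%nat) by apply Hs.
assert (Hwk := w_before_max s k Hs Hk).
assert (HN := INR_N_pos HS).
assert (Hc := sc_c HS k ltac:(lia)).
assert (Hd := sc_e HS k ltac:(lia)).
assert (Hc0 := sc_cmin HS).
assert (Hd0 := sc_dmin HS).
assert (Hk0 : 0 < INR k) by (apply lt_0_INR; lia).
assert (H1 := u_ge_slope k (w k) ltac:(lia) H0 ltac:(lia) ltac:(lra)).
assert (H2 := u_diff_le HS k s (/ cmin * Phi (w k / dmin)) ltac:(lia)).
assert (H3 : u s - u k <= / cmin * Phi (w k / dmin) * ((INR s - INR k) / INR N)).
{ apply H2. intros i Hi. apply (slope_le HS); [lia|lra|].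
  apply (w_mono HS); lia. }
assert (Hq : 0 <= (INR s - INR k) / INR N <= 1).
{ assert (INR s <= INR N) by (apply le_INR; lia).
  assert (INR k <= INR s) by (apply le_INR; lia).
  split; [apply Rmult_le_pos; [lra|left; apply Rinv_0_lt_compat; lra]|].
  apply Rmult_le_reg_r with (INR N); [lra|].
  unfold Rdiv. rewrite Rmult_assoc, Rinv_l; lra. }
assert (Hdd : 0 <= dmax / dmin) by (apply Rmult_le_pos; [lra|left; apply Rinv_0_lt_compat; lra]).
assert (Hwd : 0 <= w k / dmax) by (apply Rmult_le_pos; [lra|left; apply Rinv_0_lt_compat; lra]).
assert (H4 := gd_Phi_mul HG (w k / dmax) (dmax / dmin) Hwd Hdd).
replace (w k / dmax * (dmax / dmin)) with (w k / dmin) in H4 by (field; lra).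
set (P := Phi (w k / dmax)) in *. set (Q := g (dmax / dmin)) in *.
assert (HP : 0 <= P) by (apply Phi_ge0; exact Hwd).
assert (HQ : 0 <= Q) by (apply (gd_g_pos HG); exact Hdd).
assert (HPk : 0 <= Phi (w k / dmin)).
{ apply Phi_ge0. apply Rmult_le_pos; [lra|left; apply Rinv_0_lt_compat; lra]. }
assert (H5 : u s - u k <= / cmin * (P * Q)).
{ assert (0 < / cmin) by (apply Rinv_0_lt_compat; lra).
  apply Rle_trans with (/ cmin * Phi (w k / dmin) * 1).
  - eapply Rle_trans; [exact H3|]. apply Rmult_le_compat_l; [|lra]. apply Rmult_le_pos; lra.
  - rewrite Rmult_1_r. apply Rmult_le_compat_l; lra. }
assert (H6 : 0 <= cmax / cmin * Q * (INR N / INR k)).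
{ repeat apply Rmult_le_pos; try lra; left; apply Rinv_0_lt_compat; lra. }
apply Rmult_le_compat_l with (1 := H6) in H1.
replace (cmax / cmin * Q * (INR N / INR k) * (INR k / INR N * (/ cmax * P)))
  with (/ cmin * (P * Q)) in H1 by (field; lra).
lra.
Qed.

(** The flux is still nonnegative at j, so at k it was at least what the mass between k and j has
    consumed; [u_ge_slope] turns this flux into height. *)
Lemma rise_ge_mass s k j A : max_node N u s -> (1 <= k <= j)%nat -> (j <= s)%nat ->
  0 <= u 0%nat -> 0 <= A -> (forall i, (k <= i < j)%nat -> A <= F (u i)) ->
  INR k / INR N * (/ cmax * Phi (A * (K j - K k) / dmax)) <= u s.
Proof.
intros Hs Hk Hj H0 HA HF.
assert (HsN : (s <= N)%nat) by apply Hs.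
assert (H1 := w_diff_ge HS k j A Hk ltac:(lia) HF).
assert (H2 := w_before_max s j Hs ltac:(lia)).
assert (H3 := K_mono HS k j Hk ltac:(lia)).
apply Rle_trans with (u k); [|apply Hs; lia].
apply u_ge_slope; try lia; [exact H0|]. split; [apply Rmult_le_pos; lra|lra].
Qed.

(** [u_ge_slope] read backwards: a larger flux would have lifted [u k] above [B]. The matching lower
    bound for the flux is obtained later from the reflected scheme. *)
Lemma w_le k B : (1 <= k <= N)%nat -> 0 <= u 0%nat -> 0 <= B -> u k <= B ->
  w k <= dmax * phi (cmax * B * (INR N / INR k)).
Proof.
intros Hk H0 HB0 HB.
assert (HN := INR_N_pos HS).
assert (Hc := sc_c HS k ltac:(lia)).
assert (Hd := sc_e HS k ltac:(lia)).
assert (Hc0 := sc_cmin HS).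
assert (Hd0 := sc_dmin HS).
assert (Hk0 : 0 < INR k) by (apply lt_0_INR; lia).
apply Rnot_lt_le. intro Hlt.
destruct (Rle_lt_dec 0 (w k)) as [Hw|Hw].
- assert (H1 := u_ge_slope k (w k) ltac:(lia) H0 ltac:(lia) ltac:(lra)).
  assert (H2 : cmax * B * (INR N / INR k) < Phi (w k / dmax)).
  { rewrite <- (gd_phiK HG (cmax * B * (INR N / INR k))). apply Phi_lt.
    apply Rmult_lt_reg_l with dmax; [lra|].
    replace (dmax * (w k / dmax)) with (w k) by (field; lra). exact Hlt. }
  assert (H3 : 0 < INR k / INR N * / cmax).
  { repeat apply Rmult_lt_0_compat; try lra; apply Rinv_0_lt_compat; lra. }
  apply Rmult_lt_compat_l with (1 := H3) in H2.
  replace (INR k / INR N * / cmax * (cmax * B * (INR N / INR k))) with B in H2 by (field; lra).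
  lra.
- assert (0 <= phi (cmax * B * (INR N / INR k))).
  { apply phi_ge0. repeat apply Rmult_le_pos; try lra; left; apply Rinv_0_lt_compat; lra. }
  nra.
Qed.
End Estimates.
End Phi.

(** * Two-sided estimates *)

Section GridRecord.
Context {g : R -> R} {M N : nat} {K G : nat -> R}.
(* [K] and [G] are cellwise values of antiderivatives of [h] and of [g o |int h|],
   both based at the middle node [M] of the grid with [N = 2 M] cells. *)
Record grid : Prop := {
  gr_M : (1 <= M)%nat;
  gr_N : N = (2 * M)%nat;
  gr_Kl : forall i, (1 <= i <= S M)%nat -> K i <= 0;
  gr_Kr : forall i, (M <= i <= N)%nat -> 0 <= K i;
  gr_Gl : forall i, (1 <= i <= M)%nat -> / INR N * g (- K i) <= G i - G (i - 1)%nat;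
  gr_Gr : forall i, (M < i <= N)%nat -> / INR N * g (K i) <= G i - G (i - 1)%nat }.

End GridRecord.
Arguments grid : clear implicits.

(** The ranges of [gr_Kl] and [gr_Kr] overlap in the two middle cells M and M + 1, where [K] is
    therefore zero. With this overlap the two conditions are exchanged exactly by i -> N + 1 - i. *)
Lemma grid_reflect g M N K G : grid g M N K G ->
  grid g M N (fun i => - K (S N - i)%nat) (fun i => - G (N - i)%nat).
Proof.
intros [H0 H1 H2 H3 H4 H5]. split; auto.
- intros i Hi. assert (H := H3 (S N - i)%nat ltac:(lia)). lra.
- intros i Hi. assert (H := H2 (S N - i)%nat ltac:(lia)). lra.
- intros i Hi. assert (H := H5 (S N - i)%nat ltac:(lia)).
  replace (N - (i - 1))%nat with (S N - i)%nat by lia.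
  replace (S N - i - 1)%nat with (N - i)%nat in H by lia.
  rewrite Ropp_involutive. lra.
- intros i Hi. assert (H := H4 (S N - i)%nat ltac:(lia)).
  replace (N - (i - 1))%nat with (S N - i)%nat by lia.
  replace (S N - i - 1)%nat with (N - i)%nat in H by lia. lra.
Qed.

Lemma max_node_reflect N u s : max_node N u s -> max_node N (fun i => u (N - i)%nat) (N - s).
Proof.
intros [H1 H2]. split; [lia|]. intros i Hi.
replace (N - (N - s))%nat with s by lia. apply H2. lia.
Qed.

Section TwoSided.
Context {phi Phi g psi2 : R -> R}.
Hypothesis HG : growth_data phi Phi g psi2.
Context {F : R -> R} {cmin cmax dmin dmax : R} {N : nat} {c e K u w : nat -> R}.
Hypothesis HS : scheme Phi F cmin cmax dmin dmax N c e K u w.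

Lemma cmax_pos : 0 < cmax.
Proof.
assert (H := sc_c HS 1%nat). assert (H1 := sc_N HS). assert (H2 := sc_cmin HS).
assert (cmin <= c 1%nat <= cmax) by (apply H; lia). lra.
Qed.

Lemma dmax_pos : 0 < dmax.
Proof.
assert (H := sc_e HS 1%nat). assert (H1 := sc_N HS). assert (H2 := sc_dmin HS).
assert (dmin <= e 1%nat <= dmax) by (apply H; lia). lra.
Qed.

(** A substitute for subadditivity: the sum is at most twice the larger term. *)
Lemma Phi_add_le x y : 0 <= x -> 0 <= y -> Phi (x + y) <= Phi (2 * x) + Phi (2 * y).
Proof.
intros Hx Hy.
assert (0 <= Phi (2 * x)) by (apply (Phi_ge0 HG); lra).
assert (0 <= Phi (2 * y)) by (apply (Phi_ge0 HG); lra).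
destruct (Rle_lt_dec x y).
- assert (Phi (x + y) <= Phi (2 * y)) by (apply (Phi_le HG); lra). lra.
- assert (Phi (x + y) <= Phi (2 * x)) by (apply (Phi_le HG); lra). lra.
Qed.

Lemma grid_G_mono M G i j : grid g M N K G -> (i <= j <= N)%nat -> G i <= G j.
Proof.
intros Hgr Hij.
assert (0 - 0 <= G j - G i); [|lra].
apply (telescope_le (fun _ => 0) G); [lia|]. intros k Hk.
assert (HN : 0 < / INR N) by apply Rinv_0_lt_compat, (INR_N_pos HS).
destruct (Nat.le_gt_cases (S k) M) as [H|H].
- assert (H1 := gr_Gl Hgr (S k) ltac:(lia)).
  replace (S k - 1)%nat with k in H1 by lia.
  assert (0 <= g (- K (S k))).
  { apply (gd_g_pos HG). assert (H2 := gr_Kl Hgr (S k) ltac:(lia)). lra. }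
  nra.
- assert (H1 := gr_Gr Hgr (S k) ltac:(lia)).
  replace (S k - 1)%nat with k in H1 by lia.
  assert (0 <= g (K (S k))).
  { apply (gd_g_pos HG). apply (gr_Kr Hgr (S k)); lia. }
  nra.
Qed.

(** In contrast to [rise_before_max], the position of the maximum does not matter: the flux on a
    left cell is at most its value [W] at the middle plus [B] times the mass up to the middle. The
    outcome is a modulus of continuity at 0 with constants that do not involve the step. *)
Lemma near_start_le M G k W B : grid g M N K G -> (k <= M)%nat -> (1 <= M)%nat ->
  0 <= W -> w M <= W -> (forall i, (i <= N)%nat -> F (u i) <= B) ->
  u k - u 0%nat <=
    / cmin * (Phi (2 * W / dmin) * (INR k / INR N) + Phi (2 * B / dmin) * (G k - G 0%nat)).
Proof.
intros Hgr Hk HM HW HwM HB.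
assert (HN2 := gr_N Hgr).
assert (HB0 : 0 <= B).
{ apply Rle_trans with (F (u 0%nat)); [apply (sc_F HS)|apply HB; lia]. }
assert (HN := INR_N_pos HS).
assert (Hc0 := sc_cmin HS). assert (Hd0 := sc_dmin HS).
assert (Hic : 0 < / cmin) by (apply Rinv_0_lt_compat; lra).
assert (Hid : 0 < / dmin) by (apply Rinv_0_lt_compat; lra).
set (P := Phi (2 * W / dmin)). set (Q := Phi (2 * B / dmin)).
assert (HQ : 0 <= Q) by (apply (Phi_ge0 HG), Rmult_le_pos; lra).
replace (/ cmin * (P * (INR k / INR N) + Q * (G k - G 0%nat))) with
  (/ cmin * (P * (INR k / INR N) + Q * G k) - / cmin * (P * (INR 0 / INR N) + Q * G 0%nat))
  by (simpl; field; lra).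
apply (telescope_le u (fun k => / cmin * (P * (INR k / INR N) + Q * G k))); [lia|].
intros i Hi.
assert (HKi := gr_Kl Hgr (S i) ltac:(lia)).
assert (HKM := gr_Kl Hgr M ltac:(lia)).
assert (Hw : w (S i) <= W + B * (- K (S i))).
{ assert (H := w_diff_le HS (S i) M B ltac:(lia) ltac:(lia) (fun j Hj => HB j ltac:(lia))).
  nra. }
assert (HBK : 0 <= B * - K (S i)) by (apply Rmult_le_pos; lra).
assert (H1 := slope_le HG HS (S i) (W + B * - K (S i)) ltac:(lia) ltac:(lra) Hw).
assert (H2 : Phi ((W + B * - K (S i)) / dmin) <= P + Q * g (- K (S i))).
{ replace ((W + B * - K (S i)) / dmin) with (W / dmin + B * - K (S i) / dmin) by (field; lra).
  eapply Rle_trans; [apply Phi_add_le; apply Rmult_le_pos; lra|].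
  replace (2 * (W / dmin)) with (2 * W / dmin) by (field; lra).
  replace (2 * (B * - K (S i) / dmin)) with (2 * B / dmin * - K (S i)) by (field; lra).
  apply Rplus_le_compat_l. apply (gd_Phi_mul HG); [apply Rmult_le_pos|]; lra. }
rewrite (sc_u HS i ltac:(lia)), S_INR.
assert (H3 := gr_Gl Hgr (S i) ltac:(lia)).
replace (S i - 1)%nat with i in H3 by lia.
assert (H4 : slope (Phi:=Phi) (c:=c) (e:=e) (w:=w) (S i) <= / cmin * (P + Q * g (- K (S i)))).
{ eapply Rle_trans; [exact H1|]. apply Rmult_le_compat_l; lra. }
unfold slope in H4.
apply Rmult_le_compat_l with (r := / INR N) in H4; [|left; apply Rinv_0_lt_compat; lra].
apply Rmult_le_compat_l with (r := / cmin * Q) in H3; [|apply Rmult_le_pos; lra].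
replace (/ cmin * (P * ((INR i + 1) / INR N) + Q * G (S i)) - / cmin * (P * (INR i / INR N) + Q * G i))
  with (/ cmin * P * / INR N + / cmin * Q * (G (S i) - G i)) by (field; lra).
lra.
Qed.
End TwoSided.

(** The inverse of the factor in [harnack_before_max], with N / k replaced by its bound [/ del] at
    distance [del] from the end points. *)
Definition harnack_const (g : R -> R) cmin cmax dmin dmax del :=
  / (1 + cmax / cmin * g (dmax / dmin) * / del).

Section Full.
Context {phi Phi g psi2 : R -> R}.
Hypothesis HG : growth_data phi Phi g psi2.
Context {F : R -> R} {cmin cmax dmin dmax : R} {N : nat} {c e K u w : nat -> R}.
Hypothesis HS : scheme Phi F cmin cmax dmin dmax N c e K u w.

Lemma max_le_of_mass M G s B : grid g M N K G -> max_node N u s ->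
  u 0%nat <= 0 -> u N <= 0 -> (forall i, (i <= N)%nat -> F (u i) <= B) ->
  u s <= / cmin * Phi (B / dmin) * (G N - G 0%nat).
Proof.
intros Hgr Hs H0 HN HB.
assert (HN2 := gr_N Hgr). assert (HNp := sc_N HS).
assert (HsN : (s <= N)%nat) by apply Hs.
assert (Hc0 := sc_cmin HS). assert (Hd0 := sc_dmin HS).
assert (HB0 : 0 <= B).
{ apply Rle_trans with (F (u 0%nat)); [apply (sc_F HS)|apply HB; lia]. }
assert (HP : 0 <= / cmin * Phi (B / dmin)).
{ apply Rmult_le_pos; [left; apply Rinv_0_lt_compat; lra|].
  apply (Phi_ge0 HG), Rmult_le_pos; [lra|left; apply Rinv_0_lt_compat; lra]. }
destruct (Nat.le_gt_cases s M) as [HsM|HsM].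
- assert (H := rise_before_max HG HS s M B G Hs ltac:(lia) (gr_Kl Hgr)
    (gr_Gl Hgr) HB).
  assert (H1 := grid_G_mono HG HS M G s N Hgr ltac:(lia)). nra.
- assert (Hgr' := grid_reflect _ _ _ _ _ Hgr).
  assert (H := rise_before_max HG (scheme_reflect HG HS) (N - s)%nat M B
    (fun i => - G (N - i)%nat) (max_node_reflect _ _ _ Hs) ltac:(lia) (gr_Kl Hgr')
    (gr_Gl Hgr') (fun i Hi => HB (N - i)%nat ltac:(lia))).
  simpl in H. replace (N - (N - s))%nat with s in H by lia.
  replace (N - 0)%nat with N in H by lia.
  assert (H1 := grid_G_mono HG HS M G 0%nat s Hgr ltac:(lia)). nra.
Qed.

Lemma harnack_const_bounds del : 0 < del -> 0 < harnack_const g cmin cmax dmin dmax del <= 1.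
Proof.
intros Hdel. unfold harnack_const.
assert (0 <= cmax / cmin * g (dmax / dmin) * / del).
{ assert (H1 := cmax_pos HS). assert (H2 := dmax_pos HS).
  assert (H3 := sc_cmin HS). assert (H4 := sc_dmin HS).
  repeat apply Rmult_le_pos; try lra; try (left; apply Rinv_0_lt_compat; lra).
  apply (gd_g_pos HG), Rmult_le_pos; [lra|left; apply Rinv_0_lt_compat; lra]. }
split; [apply Rinv_0_lt_compat; lra|].
rewrite <- Rinv_1 at 2. apply Rinv_le_contravar; lra.
Qed.

Lemma harnack del s k : 0 < del -> max_node N u s -> 0 <= u 0%nat -> 0 <= u N ->
  del <= INR k / INR N <= 1 - del -> harnack_const g cmin cmax dmin dmax del * u s <= u k.
Proof.
intros Hdel Hs H0 HN Hk.
assert (HNp := INR_N_pos HS).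
assert (HkN : INR k = INR k / INR N * INR N) by (field; lra).
assert (Hk1 : (1 <= k)%nat).
{ destruct k as [|k]; [|lia]. simpl in Hk. unfold Rdiv in Hk. lra. }
assert (Hk2 : (k < N)%nat) by (apply INR_lt; nra).
assert (HkR : 0 < INR k) by (apply lt_0_INR; lia).
set (Q := cmax / cmin * g (dmax / dmin)).
assert (HQ : 0 <= Q).
{ assert (H1 := cmax_pos HS). assert (H2 := dmax_pos HS).
  assert (H3 := sc_cmin HS). assert (H4 := sc_dmin HS). unfold Q.
  repeat apply Rmult_le_pos; try lra; try (left; apply Rinv_0_lt_compat; lra).
  apply (gd_g_pos HG), Rmult_le_pos; [lra|left; apply Rinv_0_lt_compat; lra]. }
assert (Hus : 0 <= u s) by (apply Rle_trans with (u 0%nat); [exact H0|apply Hs; lia]).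
assert (Hidel : 0 < / del) by (apply Rinv_0_lt_compat; lra).
(* [x] is the inverse distance of k to the end lying on its side of the maximum. The inequality with
   [x] first shows that [u k] is nonnegative, and only then may [x] be increased to [/ del]. *)
assert (Key : forall x, 0 < x -> x <= / del -> u s <= u k * (1 + Q * x) ->
  harnack_const g cmin cmax dmin dmax del * u s <= u k).
{ intros x Hx Hxd H.
  assert (H1 : 0 < 1 + Q * x) by nra.
  assert (H2 : 0 <= u k).
  { apply Rnot_lt_le. intro Hlt. nra. }
  unfold harnack_const. fold Q.
  assert (H3 : 0 < 1 + Q * / del) by nra.
  apply Rmult_le_reg_l with (1 + Q * / del); [exact H3|].
  rewrite <- Rmult_assoc, Rinv_r, Rmult_1_l by lra.
  eapply Rle_trans; [exact H|]. rewrite Rmult_comm. apply Rmult_le_compat_r; [exact H2|].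
  nra. }
destruct (Nat.le_gt_cases k s) as [Hks|Hks].
- apply (Key (INR N / INR k)).
  + apply Rdiv_lt_0_compat; lra.
  + replace (INR N / INR k) with (/ (INR k / INR N)) by (field; lra).
    apply Rinv_le_contravar; lra.
  + apply (harnack_before_max HG HS s k Hs); [lia|exact H0].
- assert (HR : INR (N - k) = INR N - INR k) by (rewrite minus_INR; [reflexivity|lia]).
  apply (Key (INR N / INR (N - k))).
  + apply Rdiv_lt_0_compat; [lra|]. apply lt_0_INR; lia.
  + replace (INR N / INR (N - k)) with (/ (1 - INR k / INR N)).
    * apply Rinv_le_contravar; lra.
    * rewrite HR. field. assert (INR k < INR N) by (apply lt_INR; lia). lra.
  + assert (H := harnack_before_max HG (scheme_reflect HG HS) (N - s)%nat (N - k)%nat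
      (max_node_reflect _ _ _ Hs) ltac:(lia)).
    simpl in H. replace (N - (N - s))%nat with s in H by (destruct Hs; lia).
    replace (N - (N - k))%nat with k in H by lia.
    apply H. replace (N - 0)%nat with N by lia. exact HN.
Qed.

(** Wherever the maximum is, one of the two masses lies entirely between it and an end point: the
    left one if it is at or beyond k2, otherwise the right one, treated by reflection. The shifted
    indices [S k2] and [S k3] arise because reflection maps node i to N - i but cell i to N + 1 -
    i. *)
Lemma max_ge_of_mass del s k1 k2 k3 mu A : 0 < del -> max_node N u s ->
  0 <= u 0%nat -> 0 <= u N -> (k1 <= k2 <= k3)%nat ->
  del <= INR k1 / INR N -> INR k3 / INR N <= 1 - del -> 0 <= mu ->
  mu <= K k2 - K k1 -> mu <= K (S k3) - K (S k2) -> 0 <= A ->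
  (forall i, (k1 <= i <= k3)%nat -> A <= F (u i)) ->
  del * (/ cmax * Phi (A * mu / dmax)) <= u s.
Proof.
intros Hdel Hs H0 HN Hk Hk1 Hk3 Hmu Hm1 Hm2 HA HF.
assert (HNp := INR_N_pos HS). assert (Hc := cmax_pos HS). assert (Hd := dmax_pos HS).
assert (Hk1' : (1 <= k1)%nat).
{ destruct k1 as [|k1]; [|lia]. simpl in Hk1. unfold Rdiv in Hk1. lra. }
assert (Hk3' : (k3 < N)%nat).
{ apply INR_lt. assert (INR k3 = INR k3 / INR N * INR N) by (field; lra). nra. }
assert (Hic : 0 < / cmax) by (apply Rinv_0_lt_compat; lra).
assert (Hid : 0 < / dmax) by (apply Rinv_0_lt_compat; lra).
assert (Key : forall x D, del <= x -> mu <= D -> x * (/ cmax * Phi (A * D / dmax)) <= u s ->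
  del * (/ cmax * Phi (A * mu / dmax)) <= u s).
{ intros x D Hx HD H. eapply Rle_trans; [|exact H].
  assert (0 <= Phi (A * mu / dmax)).
  { apply (Phi_ge0 HG). repeat apply Rmult_le_pos; lra. }
  apply Rmult_le_compat; [lra|apply Rmult_le_pos; lra|lra|].
  apply Rmult_le_compat_l; [lra|]. apply (Phi_le HG).
  unfold Rdiv. apply Rmult_le_compat_r; [lra|]. apply Rmult_le_compat_l; lra. }
destruct (Nat.le_gt_cases k2 s) as [Hks|Hks].
- apply (Key (INR k1 / INR N) (K k2 - K k1)); [lra|lra|].
  apply (rise_ge_mass HG HS s k1 k2 A Hs); auto; try lia. intros i Hi. apply HF. lia.
- assert (HR : INR (N - k3) = INR N - INR k3) by (rewrite minus_INR; [reflexivity|lia]).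
  apply (Key (INR (N - k3) / INR N) (K (S k3) - K (S k2))); [|lra|].
  + rewrite HR. replace ((INR N - INR k3) / INR N) with (1 - INR k3 / INR N) by (field; lra). lra.
  + assert (H := rise_ge_mass HG (scheme_reflect HG HS) (N - s)%nat (N - k3)%nat (N - k2)%nat A
      (max_node_reflect _ _ _ Hs) ltac:(lia) ltac:(lia)).
    cbv beta in H. replace (N - (N - s))%nat with s in H by lia.
    replace (N - 0)%nat with N in H by lia.
    replace (S N - (N - k2))%nat with (S k2) in H by lia.
    replace (S N - (N - k3))%nat with (S k3) in H by lia.
    replace (- K (S k2) - - K (S k3)) with (K (S k3) - K (S k2)) in H by ring.
    apply H; auto. intros i Hi. apply HF. lia.
Qed.
End Full.

(** * Shooting *)

Section ProblemRecord.
Context {phi Phi g psi2 F h H G c d : R -> R} {cmin cmax dmin dmax : R}.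
(* [H] is the antiderivative of [h] vanishing at 1/2 and [G] one of [g o |H|];
   [F] is the nonlinearity with [lambda] included. *)
Record problem : Prop := {
  pb_growth : growth_data phi Phi g psi2;
  pb_F : forall s, 0 <= F s;
  pb_F_cont : continuity F;
  pb_cmin : 0 < cmin; pb_dmin : 0 < dmin;
  pb_c : forall t, 0 <= t <= 1 -> cmin <= c t <= cmax;
  pb_d : forall t, 0 <= t <= 1 -> dmin <= d t <= dmax;
  pb_c_cont : cont_on (fun t => 0 <= t <= 1) c;
  pb_d_cont : cont_on (fun t => 0 <= t <= 1) d;
  pb_H_mono : forall x y, 0 < x -> x <= y -> y < 1 -> H x <= H y;
  pb_H_half : H (1 / 2) = 0;
  pb_H_der : forall x, 0 < x < 1 -> derivable_pt_lim H x (h x);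
  pb_h_cont : cont_on (fun t => 0 < t < 1) h;
  pb_G_left : forall a b, 0 <= a -> a < b -> b <= 1 / 2 -> (b - a) * g (- H b) <= G b - G a;
  pb_G_right : forall a b, 1 / 2 <= a -> a < b -> b <= 1 -> (b - a) * g (H a) <= G b - G a;
  pb_G_0 : forall eps, eps > 0 -> exists del, del > 0 /\
    forall x, 0 < x < del -> Rabs (G x - G 0) < eps;
  pb_G_1 : forall eps, eps > 0 -> exists del, del > 0 /\
    forall x, 0 < x < del -> Rabs (G (1 - x) - G 1) < eps }.
End ProblemRecord.
Arguments problem : clear implicits.

Definition node (N i : nat) : R := INR i / INR N.

(** The end of cell i closer to 1/2. Thus [H] is never evaluated at 0 or 1, where it may be infinite
    in the limit, and the value taken is the smallest of |H| on the cell, so that [g] of it times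
    the step stays below the increment of [G]. *)
Definition cell_point (M i : nat) : R :=
  if Nat.leb i M then node (2 * M) i else node (2 * M) (i - 1).

Lemma node_bounds N i : (0 < N)%nat -> (i <= N)%nat -> 0 <= node N i <= 1.
Proof.
intros HN Hi. unfold node.
assert (H1 : 0 < INR N) by (apply lt_0_INR; exact HN).
assert (H2 : INR i <= INR N) by (apply le_INR; exact Hi).
assert (H3 := pos_INR i).
split.
- apply Rmult_le_pos; [lra|left; apply Rinv_0_lt_compat; lra].
- apply Rmult_le_reg_r with (INR N); [lra|]. unfold Rdiv. rewrite Rmult_assoc, Rinv_l; lra.
Qed.

Lemma node_le N i j : (0 < N)%nat -> (i <= j)%nat -> node N i <= node N j.
Proof.
intros HN Hij. unfold node, Rdiv. apply Rmult_le_compat_r.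
- left; apply Rinv_0_lt_compat, lt_0_INR, HN.
- apply le_INR, Hij.
Qed.

Lemma node_lt N i j : (0 < N)%nat -> (i < j)%nat -> node N i < node N j.
Proof.
intros HN Hij. unfold node, Rdiv. apply Rmult_lt_compat_r.
- apply Rinv_0_lt_compat, lt_0_INR, HN.
- apply lt_INR, Hij.
Qed.

Lemma node_S N i : (0 < N)%nat -> node N (S i) = node N i + / INR N.
Proof.
intros HN. unfold node. rewrite S_INR. field. apply not_0_INR. lia.
Qed.

Lemma node_0 N : node N 0 = 0.
Proof. unfold node. simpl. unfold Rdiv. ring. Qed.

Lemma node_N N : (0 < N)%nat -> node N N = 1.
Proof. intros HN. unfold node. field. apply not_0_INR. lia. Qed.

Lemma node_half M : (0 < M)%nat -> node (2 * M) M = 1 / 2.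
Proof.
intros HM. unfold node. rewrite mult_INR. simpl. field. apply not_0_INR. lia.
Qed.

Lemma node_interior N i : (0 < i < N)%nat -> 0 < node N i < 1.
Proof.
intros Hi. rewrite <- (node_0 N) at 1. rewrite <- (node_N N) by lia.
split; apply node_lt; lia.
Qed.

Lemma cell_point_bounds M i : (1 <= i <= 2 * M)%nat ->
  0 < cell_point M i < 1 /\ node (2 * M) (i - 1) <= cell_point M i <= node (2 * M) i.
Proof.
intros Hi. unfold cell_point. destruct (Nat.leb_spec i M) as [H|H].
- split; [apply node_interior; lia|]. split; [apply node_le; lia|lra].
- split; [apply node_interior; lia|]. split; [lra|apply node_le; lia].
Qed.

Section Shooting.
Context {phi Phi g psi2 F h H G c d : R -> R} {cmin cmax dmin dmax : R}.
Hypothesis HP : problem phi Phi g psi2 F h H G c d cmin cmax dmin dmax.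
Let HG := pb_growth HP.
Variable M : nat.
Hypothesis HM : (0 < M)%nat.
Let N := (2 * M)%nat.

Definition cell_mass (i : nat) : R := H (cell_point M i).

(** At index i the pair holds [u] at node i and the flux on the following cell i + 1, whence the
    shift in [shoot_w]. The second component at i = N involves [H 1], which carries no information;
    it would belong to cell N + 1 and is outside the range of [scheme]. *)
Fixpoint shoot (p : R) (i : nat) : R * R :=
  match i with
  | O => (0, p)
  | S j =>
      let (u, w) := shoot p j in
      let u' := u + / INR (2 * M) *
        (/ c (node (2 * M) (S j)) * Phi (w / d (node (2 * M) (S j)))) in
      (u', w - F u' * (cell_mass (S (S j)) - cell_mass (S j)))
  end.

Definition shoot_u p i := fst (shoot p i).
Definition shoot_w p i := snd (shoot p (i - 1)).

Lemma shoot_scheme p :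
  scheme Phi F cmin cmax dmin dmax N (fun i => c (node N i)) (fun i => d (node N i))
    cell_mass (shoot_u p) (shoot_w p).
Proof.
assert (HN : (0 < N)%nat) by (unfold N; lia).
split; try exact HN; try apply HP.
- intros i Hi. apply (pb_c HP), node_bounds; lia.
- intros i Hi. apply (pb_d HP), node_bounds; lia.
- intros i Hi. unfold shoot_u, shoot_w. replace (S i - 1)%nat with i by lia.
  simpl. destruct (shoot p i) as [u w]. reflexivity.
- intros [|i] Hi; [lia|]. unfold shoot_u, shoot_w.
  replace (S (S i) - 1)%nat with (S i) by lia. replace (S i - 1)%nat with i by lia.
  simpl. destruct (shoot p i) as [u w]. simpl. ring.
- intros i Hi. unfold cell_mass.
  destruct (cell_point_bounds M i ltac:(unfold N in *; lia)) as [H1 H2].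
  destruct (cell_point_bounds M (S i) ltac:(unfold N in *; lia)) as [H3 H4].
  replace (S i - 1)%nat with i in H4 by lia.
  apply (pb_H_mono HP); lra.
Qed.

Lemma shoot_grid : grid g M N cell_mass (fun i => G (node N i)).
Proof.
assert (Hh := node_half M HM).
assert (HN : (0 < N)%nat) by (unfold N; lia).
assert (Hi0 : forall i, (1 <= i)%nat -> node N i - node N (i - 1) = / INR N).
{ intros [|i] Hi; [lia|]. replace (S i - 1)%nat with i by lia.
  rewrite node_S by exact HN. ring. }
split; auto.
- intros i Hi. destruct (cell_point_bounds M i ltac:(lia)) as [H1 _].
  rewrite <- (pb_H_half HP). apply (pb_H_mono HP); [lra| |lra].
  rewrite <- Hh. unfold cell_point. destruct (Nat.leb_spec i M); apply node_le; lia.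
- intros i Hi. destruct (cell_point_bounds M i ltac:(unfold N in *; lia)) as [H1 _].
  rewrite <- (pb_H_half HP). apply (pb_H_mono HP); [lra| |lra].
  rewrite <- Hh. unfold cell_point. destruct (Nat.leb_spec i M); apply node_le; lia.
- intros i Hi. rewrite <- (Hi0 i) by lia.
  replace (cell_mass i) with (H (node N i)).
  + apply (pb_G_left HP).
    * apply node_bounds; unfold N; lia.
    * apply node_lt; lia.
    * rewrite <- Hh. apply node_le; unfold N in *; lia.
  + unfold cell_mass, cell_point. destruct (Nat.leb_spec i M); [reflexivity|lia].
- intros i Hi. rewrite <- (Hi0 i) by lia.
  replace (cell_mass i) with (H (node N (i - 1))).
  + apply (pb_G_right HP).
    * rewrite <- Hh. apply node_le; unfold N in *; lia.
    * apply node_lt; lia.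
    * apply node_bounds; unfold N in *; lia.
  + unfold cell_mass, cell_point. destruct (Nat.leb_spec i M); [lia|reflexivity].
Qed.

Lemma shoot_cont i : continuity (fun p => fst (shoot p i)) /\ continuity (fun p => snd (shoot p i)).
Proof.
induction i as [|i [IH1 IH2]].
- split; simpl; intros p; [apply continuity_pt_const; intros ? ?; reflexivity|].
  apply derivable_continuous_pt, derivable_pt_id.
- set (a := / INR (2 * M)). set (b := / c (node (2 * M) (S i))).
  set (e := / d (node (2 * M) (S i))).
  assert (H1 : continuity (fun p => fst (shoot p (S i)))).
  { assert (E : forall p, fst (shoot p (S i)) =
      fst (shoot p i) + a * (b * Phi (e * snd (shoot p i)))).
    { intros p. simpl shoot. destruct (shoot p i) as [u w]. simpl fst. simpl snd.
      unfold a, b, e, Rdiv. rewrite (Rmult_comm (/ d _)). reflexivity. }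
    intros p. apply Coquelicot.Continuity.continuity_pt_ext with (1 := fun p => eq_sym (E p)).
    apply continuity_pt_plus; [apply IH1|].
    apply (continuity_pt_scal (fun p => b * Phi (e * snd (shoot p i))) a).
    apply (continuity_pt_scal (fun p => Phi (e * snd (shoot p i))) b).
    apply (continuity_pt_comp (fun p => e * snd (shoot p i)) Phi).
    - apply (continuity_pt_scal (fun p => snd (shoot p i)) e). apply IH2.
    - apply (gd_Phi_cont HG). }
  split; [exact H1|].
  set (k := cell_mass (S (S i)) - cell_mass (S i)).
  assert (E : forall p, snd (shoot p (S i)) = snd (shoot p i) - k * F (fst (shoot p (S i)))).
  { intros p. simpl shoot. destruct (shoot p i) as [u w]. simpl fst. simpl snd.
    unfold k. rewrite (Rmult_comm (F _)). reflexivity. }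
  intros p. apply Coquelicot.Continuity.continuity_pt_ext with (1 := fun p => eq_sym (E p)).
  apply continuity_pt_minus; [apply IH2|].
  apply (continuity_pt_scal (fun p => F (fst (shoot p (S i)))) k).
  apply (continuity_pt_comp (fun p => fst (shoot p (S i))) F); [apply H1|apply (pb_F_cont HP)].
Qed.

Lemma shoot_small r : 0 < r -> exists p, 0 < p /\ forall i, (i <= N)%nat -> shoot_u p i < r.
Proof.
intros Hr. assert (Hc := pb_cmin HP). assert (Hd := pb_dmin HP).
(* For this [p] the bound [/ cmin * Phi (p / dmin)] on all slopes equals r / 2, and the flux never
   exceeds its initial value [p]. *)
assert (Hp : 0 < dmin * phi (cmin * r / 2)) by
  (apply Rmult_lt_0_compat; [lra|apply (phi_gt0 HG); nra]).
exists (dmin * phi (cmin * r / 2)). split; [exact Hp|].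
set (p := dmin * phi (cmin * r / 2)) in *.
assert (HS := shoot_scheme p).
intros i Hi.
assert (H1 := u_diff_le HS 0 i (/ cmin * Phi (p / dmin)) ltac:(lia)).
assert (H2 : shoot_u p i - shoot_u p 0 <= / cmin * Phi (p / dmin) * ((INR i - INR 0) / INR N)).
{ apply H1. intros k Hk. apply (slope_le HG HS); [lia|lra|].
  change p with (shoot_w p 1) at 2. apply (w_mono HS); lia. }
replace (p / dmin) with (phi (cmin * r / 2)) in H2 by (unfold p; field; lra).
rewrite (gd_phiK HG) in H2.
replace (/ cmin * (cmin * r / 2)) with (r / 2) in H2 by (field; lra).
change (shoot_u p 0) with 0 in H2. change (INR 0) with 0 in H2.
assert (H3 := node_bounds N i ltac:(unfold N; lia) Hi). unfold node in H3.
rewrite Rminus_0_r in H2. nra.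
Qed.

Lemma shoot_large B : 0 <= B -> exists p, 0 < p /\ B < shoot_u p 1.
Proof.
intros HB.
assert (HN : 0 < INR N) by (apply lt_0_INR; unfold N; lia).
assert (Hc : 0 < cmax) by apply (cmax_pos (shoot_scheme 0)).
assert (Hd : 0 < dmax) by apply (dmax_pos (shoot_scheme 0)).
(* Here [p] is so large that the first step alone lifts [u] to at least B + 1. Its dependence on N
   is harmless, because only the sign of [u] at the last node is wanted. *)
assert (Hp : 0 < dmax * phi (cmax * INR N * (B + 1))).
{ apply Rmult_lt_0_compat; [lra|]. apply (phi_gt0 HG).
  repeat apply Rmult_lt_0_compat; lra. }
exists (dmax * phi (cmax * INR N * (B + 1))). split; [exact Hp|].
set (p := dmax * phi (cmax * INR N * (B + 1))) in *.
assert (HS := shoot_scheme p).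
assert (H1 := u_ge_slope HG HS 1 p ltac:(unfold N; lia) ltac:(unfold shoot_u; simpl; lra)
  ltac:(lia) ltac:(unfold shoot_w; simpl; lra)).
replace (p / dmax) with (phi (cmax * INR N * (B + 1))) in H1 by (unfold p; field; lra).
rewrite (gd_phiK HG) in H1.
replace (INR 1 / INR N * (/ cmax * (cmax * INR N * (B + 1)))) with (B + 1) in H1
  by (simpl; field; lra).
lra.
Qed.

Lemma shoot_u1_pos p : 0 < p -> 0 < shoot_u p 1.
Proof.
intros Hp. assert (HS := shoot_scheme p).
assert (H1 := slope_pos HG HS 1 ltac:(unfold N; lia) Hp).
assert (H2 := sc_u HS 0 ltac:(unfold N; lia)). unfold slope in H1.
assert (0 < / INR N) by (apply Rinv_0_lt_compat, lt_0_INR; unfold N; lia).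
change (shoot_u p 0) with 0 in H2. rewrite H2, Rplus_0_l. apply Rmult_lt_0_compat; auto.
Qed.

(** For a small [p] the maximum is below [r], for a large one it exceeds [B]. Each of these rules
    out one sign of [u] at the last node, and in either alternative the two excluded signs are
    opposite. The alternatives correspond to parts (a) and (b) of the theorem. *)
Lemma shooting r B : 0 < r -> 0 <= B ->
  ((forall p s, 0 < p -> max_node N (shoot_u p) s ->
      (shoot_u p N <= 0 -> r <= shoot_u p s) /\ (0 <= shoot_u p N -> shoot_u p s <= B)) \/
   (forall p s, 0 < p -> max_node N (shoot_u p) s ->
      (shoot_u p N <= 0 -> shoot_u p s <= B) /\ (0 <= shoot_u p N -> r <= shoot_u p s))) ->
  exists p, 0 < p /\ shoot_u p N = 0.
Proof.
intros Hr HB Hcase.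
destruct (shoot_small r Hr) as [p1 [Hp1 H1]].
destruct (shoot_large B HB) as [p2 [Hp2 H2]].
assert (Hsign : shoot_u p1 N * shoot_u p2 N <= 0).
{ destruct (max_node_ex N (shoot_u p1)) as [s1 Hs1].
  destruct (max_node_ex N (shoot_u p2)) as [s2 Hs2].
  assert (H3 : shoot_u p1 s1 < r) by (apply H1, Hs1).
  assert (H4 : B < shoot_u p2 s2).
  { apply Rlt_le_trans with (1 := H2). apply Hs2. unfold N. lia. }
  destruct Hcase as [Hc|Hc].
  - destruct (Hc p1 s1 Hp1 Hs1) as [Ha _]. destruct (Hc p2 s2 Hp2 Hs2) as [_ Hb].
    assert (0 < shoot_u p1 N) by (apply Rnot_le_lt; intro; specialize (Ha ltac:(assumption)); lra).
    assert (shoot_u p2 N < 0) by (apply Rnot_le_lt; intro; specialize (Hb ltac:(assumption)); lra).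
    nra.
  - destruct (Hc p1 s1 Hp1 Hs1) as [_ Ha]. destruct (Hc p2 s2 Hp2 Hs2) as [Hb _].
    assert (shoot_u p1 N < 0) by (apply Rnot_le_lt; intro; specialize (Ha ltac:(assumption)); lra).
    assert (0 < shoot_u p2 N) by (apply Rnot_le_lt; intro; specialize (Hb ltac:(assumption)); lra).
    nra. }
destruct (Rle_lt_dec p1 p2) as [Hle|Hlt].
- destruct (IVT_cor (fun p => shoot_u p N) p1 p2 (proj1 (shoot_cont N)) Hle Hsign) as [z [Hz1 Hz2]].
  exists z. split; [lra|exact Hz2].
- rewrite Rmult_comm in Hsign.
  destruct (IVT_cor (fun p => shoot_u p N) p2 p1 (proj1 (shoot_cont N)) ltac:(lra) Hsign) as [z [Hz1 Hz2]].
  exists z. split; [lra|exact Hz2].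
Qed.
End Shooting.

(** * A priori bounds for the maximum *)

Definition idx (N : nat) (t : R) : nat := Z.to_nat (Int_part (INR N * t)).

Lemma idx_spec N t : (0 < N)%nat -> 0 <= t ->
  node N (idx N t) <= t < node N (idx N t) + / INR N.
Proof.
intros HN Ht. unfold node, idx.
assert (HNR : 0 < INR N) by (apply lt_0_INR; exact HN).
destruct (base_Int_part (INR N * t)) as [H1 H2].
assert (H0 : (0 <= Int_part (INR N * t))%Z).
{ assert (IZR (-1) < IZR (Int_part (INR N * t))) by nra. apply lt_IZR in H. lia. }
rewrite INR_IZR_INZ, Z2Nat.id by exact H0.
set (z := IZR (Int_part (INR N * t))) in *.
split.
- apply Rmult_le_reg_r with (INR N); [lra|]. unfold Rdiv. rewrite Rmult_assoc, Rinv_l by lra. lra.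
- apply Rmult_lt_reg_r with (INR N); [lra|].
  replace ((z / INR N + / INR N) * INR N) with (z + 1) by (field; lra). lra.
Qed.

Lemma node_lt_inv N i j : (0 < N)%nat -> node N i < node N j -> (i < j)%nat.
Proof.
intros HN H. destruct (Nat.le_gt_cases j i) as [Hji|Hij]; [|exact Hij].
apply (node_le N) in Hji; [lra|exact HN].
Qed.

Lemma idx_le N s t : (0 < N)%nat -> 0 <= s -> s <= t -> (idx N s <= idx N t)%nat.
Proof.
intros HN Hs Hst. apply Nat.lt_succ_r. apply (node_lt_inv N); [exact HN|].
rewrite node_S by exact HN.
assert (H1 := idx_spec N s HN Hs). assert (H2 := idx_spec N t HN ltac:(lra)). lra.
Qed.

Lemma idx_le_N N t : (0 < N)%nat -> 0 <= t <= 1 -> (idx N t <= N)%nat.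
Proof.
intros HN Ht. apply Nat.lt_succ_r. apply (node_lt_inv N); [exact HN|].
assert (H1 := idx_spec N t HN ltac:(lra)).
rewrite node_S, node_N by exact HN.
assert (0 < / INR N) by (apply Rinv_0_lt_compat, lt_0_INR, HN). lra.
Qed.

Section MassPoints.
Context {H : R -> R} {a x b x1 x2 b1 e del mu : R}.
(* [h] has mass at least [mu] on both sides of the middle zone around [x], with room [e]
   for discretization errors. *)
Record mass_points : Prop := {
  mp_e : 0 < e; mp_del : 0 < del; mp_mu : 0 < mu;
  mp_a : del + e <= a; mp_1 : a <= x1; mp_x1 : x1 + 2 * e <= x; mp_x2 : x + e <= x2;
  mp_2 : x2 <= b1; mp_b1 : b1 + e <= b; mp_b : b + del <= 1;
  mp_l : mu <= H x1 - H a; mp_r : mu <= H b1 - H x2 }.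
End MassPoints.
Arguments mass_points : clear implicits.

(** Negative s are included because a trajectory that misses its target may be negative at some
    nodes. In [suplevel] the range starts at [kap * m], the level that the Harnack inequality
    guarantees away from the ends. *)
Definition sublevel (F phi : R -> R) a0 m := forall s, s <= m -> F s <= a0 * phi m.
Definition suplevel (F phi : R -> R) kap b0 m :=
  forall s, kap * m <= s <= m -> b0 * phi m <= F s.

Section Apriori.
Context {phi Phi g psi2 F h H G c d : R -> R} {cmin cmax dmin dmax : R}.
Hypothesis HP : problem phi Phi g psi2 F h H G c d cmin cmax dmin dmax.
Let HG := pb_growth HP.
Context {a x b x1 x2 b1 e del mu : R}.
Hypothesis Hmp : mass_points H a x b x1 x2 b1 e del mu.

Variable M : nat.
Hypothesis HM : (0 < M)%nat.
Let N := (2 * M)%nat.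
Variable p : R.
Hypothesis Hp : 0 < p.
Let u := shoot_u (Phi:=Phi) (F:=F) (H:=H) (c:=c) (d:=d) M p.
Let HS := shoot_scheme HP M HM p.
Variable s : nat.
Hypothesis Hs : max_node N u s.

Lemma shoot_max_pos : 0 < u s.
Proof.
apply Rlt_le_trans with (u 1%nat); [apply (shoot_u1_pos HP M HM p Hp)|].
apply Hs. unfold N. lia.
Qed.

(** With m the maximum, the rise is at most Phi(a0 phi(m) / dmin) (G 1 - G 0) / cmin, and
    [gd_Phi_mul] pulls m = Phi(phi m) out of Phi. The remaining factor is less than 1 by the choice
    of [a0]. *)
Lemma not_sublevel a0 : 0 <= a0 -> g (a0 / dmin) * (G 1 - G 0) < cmin ->
  u N <= 0 -> ~ sublevel F phi a0 (u s).
Proof.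
intros Ha0 Ha HuN Hsub.
assert (Hm := shoot_max_pos).
assert (Hc := pb_cmin HP). assert (Hd := pb_dmin HP).
assert (Hphi := phi_ge0 HG (u s) ltac:(lra)).
assert (H1 := max_le_of_mass HG HS M _ s (a0 * phi (u s)) (shoot_grid HP M HM) Hs
  ltac:(unfold shoot_u; simpl; lra) HuN (fun i Hi => Hsub _ (proj2 Hs i Hi))).
assert (HN : (0 < N)%nat) by (unfold N; lia).
cbv beta in H1. fold N u in H1. rewrite (node_N N HN), node_0 in H1.
assert (Had : 0 <= a0 / dmin) by (apply Rmult_le_pos; [lra|left; apply Rinv_0_lt_compat; lra]).
assert (H2 := gd_Phi_mul HG (phi (u s)) (a0 / dmin) Hphi Had).
rewrite (gd_phiK HG) in H2.
replace (phi (u s) * (a0 / dmin)) with (a0 * phi (u s) / dmin) in H2 by (field; lra).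
assert (HGm : 0 <= G 1 - G 0).
{ assert (H3 := grid_G_mono HG HS M _ 0 N (shoot_grid HP M HM) ltac:(lia)).
  cbv beta in H3. fold N in H3. rewrite (node_N N HN), node_0 in H3. lra. }
assert (Hic : 0 < / cmin) by (apply Rinv_0_lt_compat; lra).
assert (H3 : u s <= / cmin * (u s * (g (a0 / dmin) * (G 1 - G 0)))).
{ eapply Rle_trans; [exact H1|].
  replace (/ cmin * (u s * (g (a0 / dmin) * (G 1 - G 0))))
    with (/ cmin * (u s * g (a0 / dmin)) * (G 1 - G 0)) by ring.
  apply Rmult_le_compat_r; [exact HGm|]. apply Rmult_le_compat_l; lra. }
assert (H4 : / cmin * (u s * (g (a0 / dmin) * (G 1 - G 0))) < / cmin * (u s * cmin)).
{ apply Rmult_lt_compat_l; [lra|]. apply Rmult_lt_compat_l; lra. }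
replace (/ cmin * (u s * cmin)) with (u s) in H4 by (field; lra). lra.
Qed.

Lemma not_suplevel : / INR N <= e -> 0 <= u N ->
  ~ suplevel F phi (harnack_const g cmin cmax dmin dmax del) (dmax * psi2 (2 * cmax / del) / mu) (u s).
Proof.
intros HNe HuN Hsup.
assert (Hm := shoot_max_pos).
assert (Hc := cmax_pos HS). assert (Hd := dmax_pos HS).
assert (Hphi := phi_ge0 HG (u s) ltac:(lra)).
assert (HN : (0 < N)%nat) by (unfold N; lia).
assert (HiN : 0 < / INR N) by (apply Rinv_0_lt_compat, lt_0_INR, HN).
destruct Hmp as [he hdel hmu ha h1 hx1 hx2 h2 hb1 hb hl hr].
assert (Hz : 0 <= 2 * cmax / del).
{ apply Rmult_le_pos; [lra|left; apply Rinv_0_lt_compat; lra]. }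
assert (Hpsi := gd_psi2_pos HG _ Hz).
set (b0 := dmax * psi2 (2 * cmax / del) / mu) in *.
assert (Hb0 : 0 <= b0).
{ unfold b0. repeat apply Rmult_le_pos; try lra. left; apply Rinv_0_lt_compat; lra. }
assert (Ia := idx_spec N a HN ltac:(lra)).
assert (Ix := idx_spec N x HN ltac:(lra)).
assert (Ib := idx_spec N b HN ltac:(lra)).
assert (Lax := idx_le N a x HN ltac:(lra) ltac:(lra)).
assert (Lxb := idx_le N x b HN ltac:(lra) ltac:(lra)).
assert (Pa : (0 < idx N a)%nat) by (apply (node_lt_inv N); [exact HN|rewrite node_0; lra]).
assert (Pb : (idx N b < N)%nat) by (apply (node_lt_inv N); [exact HN|rewrite node_N by exact HN; lra]).
assert (A := max_ge_of_mass HG HS del s (idx N a) (idx N x) (idx N b) mu (b0 * phi (u s))).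
assert (B : del * (/ cmax * Phi (b0 * phi (u s) * mu / dmax)) <= u s).
{ apply A; auto; try lia; try lra.
  - unfold shoot_u; simpl; lra.
  - change (del <= node N (idx N a)). lra.
  - change (node N (idx N b) <= 1 - del). lra.
  (* The cell point of [idx N a] is at most a, and that of [idx N x] is at most two steps to the
     left of x; this is why [mp_x1] reserves [2 * e]. *)
  - unfold cell_mass.
    destruct (cell_point_bounds M (idx N a) ltac:(fold N; lia)) as [C1 C2].
    destruct (cell_point_bounds M (idx N x) ltac:(fold N; lia)) as [C3 C4].
    fold N in C2, C4.
    assert (E : node N (idx N x) = node N (idx N x - 1) + / INR N).
    { rewrite <- node_S by exact HN. f_equal. lia. }
    assert (H (cell_point M (idx N a)) <= H a) by (apply (pb_H_mono HP); lra).
    assert (H x1 <= H (cell_point M (idx N x))) by (apply (pb_H_mono HP); lra).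
    lra.
  - unfold cell_mass.
    destruct (cell_point_bounds M (S (idx N x)) ltac:(fold N; lia)) as [C1 C2].
    destruct (cell_point_bounds M (S (idx N b)) ltac:(fold N; lia)) as [C3 C4].
    fold N in C2, C4. rewrite node_S in C2, C4 by exact HN.
    replace (S (idx N b) - 1)%nat with (idx N b) in C4 by lia.
    assert (H (cell_point M (S (idx N x))) <= H x2) by (apply (pb_H_mono HP); lra).
    assert (H b1 <= H (cell_point M (S (idx N b)))) by (apply (pb_H_mono HP); lra).
    lra.
  - apply Rmult_le_pos; lra.
  - intros i Hi. apply Hsup. split; [|apply Hs; lia].
    apply (harnack HG HS); auto.
    + unfold u, shoot_u; simpl; lra.
    + change (del <= node N i <= 1 - del).
      assert (node N (idx N a) <= node N i) by (apply node_le; lia).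
      assert (node N i <= node N (idx N b)) by (apply node_le; lia). lra. }
(* The value of [b0] is tuned to this identity: [gd_mul_Phi] at [2 * cmax / del] then gives that the
   maximum is at least twice itself. *)
replace (b0 * phi (u s) * mu / dmax) with (phi (u s) * psi2 (2 * cmax / del)) in B
  by (unfold b0; field; lra).
assert (C := gd_mul_Phi HG (u s) (2 * cmax / del) ltac:(lra) Hz).
assert (Hdc : 0 < del * / cmax) by (apply Rmult_lt_0_compat; [lra|apply Rinv_0_lt_compat; lra]).
apply Rmult_le_compat_l with (r := del * / cmax) in C; [|lra].
replace (del * / cmax * (u s * (2 * cmax / del))) with (2 * u s) in C by (field; lra).
lra.
Qed.
End Apriori.

(** * Continuous convergence *)

Section Limit.
Context {W : (nat -> Prop) -> Prop}.
Hypothesis HW : free_ultrafilter W.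
Variable N : nat -> nat.
Hypothesis HN : forall n, (n < N n)%nat.

Lemma inv_N_small eps : 0 < eps -> W (fun n => / INR (N n) < eps).
Proof.
intros Heps. destruct (archimed_cor1 eps Heps) as [k [Hk1 Hk2]].
apply (uf_from HW _ k). intros n Hn. apply Rle_lt_trans with (/ INR k); [|exact Hk1].
apply Rinv_le_contravar; [apply lt_0_INR; exact Hk2|]. apply le_INR. specialize (HN n). lia.
Qed.

(** Convergence at all nodes near x simultaneously. A limit along the single nodes [idx (N n) x]
    would say nothing about the nodes between two such points, over which increments are summed. The
    index starts at 1 since [w] and [K] live on cells. *)
Definition cconv (v : nat -> nat -> R) (x l : R) : Prop :=
  forall eps, eps > 0 -> exists del, del > 0 /\
    W (fun n => forall j, (1 <= j <= N n)%nat -> Rabs (node (N n) j - x) < del ->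
         Rabs (v n j - l) < eps).

Lemma idx_near n t : 0 <= t -> Rabs (node (N n) (idx (N n) t) - t) <= / INR (N n).
Proof.
intros Ht. assert (H := idx_spec (N n) t ltac:(specialize (HN n); lia) Ht).
apply Rabs_le. lra.
Qed.

Lemma idx_interior t : 0 < t < 1 -> W (fun n => (1 <= idx (N n) t <= N n)%nat).
Proof.
intros Ht. apply (uf_sub HW) with (2 := inv_N_small t ltac:(lra)).
intros n Hn. assert (HNn := HN n).
assert (H := idx_spec (N n) t ltac:(lia) ltac:(lra)).
split; [|apply idx_le_N; [lia|lra]].
apply (node_lt_inv (N n)); [lia|]. rewrite node_0. lra.
Qed.

Lemma cconv_near v x l eps : cconv v x l -> 0 < x < 1 -> eps > 0 ->
  exists del, del > 0 /\ forall y, 0 < y < 1 -> Rabs (y - x) < del ->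
    W (fun n => Rabs (v n (idx (N n) y) - l) < eps).
Proof.
intros Hv Hx Heps. destruct (Hv eps Heps) as [del [Hdel H]].
exists (del / 2). split; [lra|]. intros y Hy Hyx.
apply (uf_sub HW) with (2 := uf_and HW _ _ H (uf_and HW _ _ (idx_interior y Hy)
  (inv_N_small (del / 2) ltac:(lra)))).
intros n [H1 [H2 H3]]. apply H1; [exact H2|].
assert (H4 := idx_near n y ltac:(lra)).
replace (node (N n) (idx (N n) y) - x) with ((node (N n) (idx (N n) y) - y) + (y - x)) by ring.
eapply Rle_lt_trans; [apply Rabs_triang|]. lra.
Qed.

Lemma cconv_ulim v x l : cconv v x l -> 0 < x < 1 -> ulim W (fun n => v n (idx (N n) x)) l.
Proof.
intros Hv Hx eps Heps. destruct (cconv_near v x l eps Hv Hx Heps) as [del [Hdel H]].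
apply H; [exact Hx|]. rewrite Rminus_diag, Rabs_R0. lra.
Qed.

Lemma cconv_comp v x l (f : R -> R -> R) :
  (forall eps, eps > 0 -> exists del, del > 0 /\ forall t y, 0 <= t <= 1 -> Rabs (t - x) < del ->
     Rabs (y - l) < del -> Rabs (f t y - f x l) < eps) ->
  cconv v x l -> cconv (fun n j => f (node (N n) j) (v n j)) x (f x l).
Proof.
intros Hf Hv eps Heps. destruct (Hf eps Heps) as [del1 [Hdel1 H1]].
destruct (Hv del1 Hdel1) as [del2 [Hdel2 H2]].
exists (Rmin del1 del2). split; [apply Rmin_glb_lt; lra|].
apply (uf_sub HW) with (2 := H2). intros n Hn j Hj Hjx.
apply H1.
- apply node_bounds; [specialize (HN n); lia|lia].
- eapply Rlt_le_trans; [exact Hjx|apply Rmin_l].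
- apply Hn; [exact Hj|]. eapply Rlt_le_trans; [exact Hjx|apply Rmin_r].
Qed.

(* The limits satisfy [dAl/dBl = l] at [x]. *)
Lemma limit_increment (A B s : nat -> nat -> R) (Al Bl : R -> R) x l :
  (forall y, 0 < y < 1 -> ulim W (fun n => A n (idx (N n) y)) (Al y)) ->
  (forall y, 0 < y < 1 -> ulim W (fun n => B n (idx (N n) y)) (Bl y)) ->
  (forall n i j, (1 <= i <= j)%nat -> (j <= N n)%nat -> B n i <= B n j) ->
  (forall n i j lo hi, (1 <= i <= j)%nat -> (j <= N n)%nat ->
     (forall k, (i <= k <= j)%nat -> lo <= s n k <= hi) ->
     lo * (B n j - B n i) <= A n j - A n i <= hi * (B n j - B n i)) ->
  cconv s x l -> 0 < x < 1 ->
  forall eps, eps > 0 -> exists del, del > 0 /\ forall y, Rabs (y - x) < del ->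
    Rabs (Al y - Al x - l * (Bl y - Bl x)) <= eps * Rabs (Bl y - Bl x).
Proof.
intros HA HB HBm HAB Hs Hx eps Heps.
destruct (Hs eps Heps) as [del [Hdel H]].
exists (Rmin (del / 2) (Rmin x (1 - x))). split; [repeat apply Rmin_glb_lt; lra|].
intros y Hyd.
assert (Hy1 : Rabs (y - x) < del / 2) by (eapply Rlt_le_trans; [exact Hyd|apply Rmin_l]).
assert (Hy : 0 < y < 1).
{ assert (H0 : Rabs (y - x) < x).
  { eapply Rlt_le_trans; [exact Hyd|]. eapply Rle_trans; [apply Rmin_r|apply Rmin_l]. }
  assert (H1 : Rabs (y - x) < 1 - x).
  { eapply Rlt_le_trans; [exact Hyd|]. eapply Rle_trans; [apply Rmin_r|apply Rmin_r]. }
  apply Rabs_def2 in H0. apply Rabs_def2 in H1. lra. }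
set (i := fun n => idx (N n) x). set (j := fun n => idx (N n) y).
apply (ulim_le HW
  (fun n => Rabs (A n (j n) - A n (i n) - l * (B n (j n) - B n (i n))))
  (fun n => eps * Rabs (B n (j n) - B n (i n)))).
- apply (ulim_abs HW), (ulim_minus HW); [|apply (ulim_scal HW)];
    apply (ulim_minus HW); unfold i, j; auto.
- apply (ulim_scal HW), (ulim_abs HW), (ulim_minus HW); unfold i, j; auto.
- apply (uf_sub HW) with (2 := uf_and HW _ _ H (uf_and HW _ _ (inv_N_small (del / 2) ltac:(lra))
    (uf_and HW _ _ (idx_interior x Hx) (idx_interior y Hy)))).
  intros n [H1 [H2 [H3 H4]]]. fold (i n) in H3. fold (j n) in H4.
  assert (HNn := HN n).
  assert (Ix := idx_spec (N n) x ltac:(lia) ltac:(lra)).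
  assert (Iy := idx_spec (N n) y ltac:(lia) ltac:(lra)).
  fold (i n) in Ix. fold (j n) in Iy.
  apply Rabs_def2 in Hy1.
  assert (Hk : forall k, (1 <= k <= N n)%nat ->
    ((i n <= k <= j n)%nat \/ (j n <= k <= i n)%nat) -> l - eps <= s n k <= l + eps).
  { intros k Hk1 Hk2. assert (Hkx : Rabs (node (N n) k - x) < del).
    { destruct Hk2 as [Hk2|Hk2].
      - assert (node (N n) (i n) <= node (N n) k) by (apply node_le; lia).
        assert (node (N n) k <= node (N n) (j n)) by (apply node_le; lia).
        apply Rabs_def1; lra.
      - assert (node (N n) (j n) <= node (N n) k) by (apply node_le; lia).
        assert (node (N n) k <= node (N n) (i n)) by (apply node_le; lia).
        apply Rabs_def1; lra. }
    assert (H5 := H1 k Hk1 Hkx). apply Rabs_def2 in H5. lra. }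
  destruct (Nat.le_gt_cases (i n) (j n)) as [Hij|Hij].
  + assert (H5 := HAB n (i n) (j n) (l - eps) (l + eps) ltac:(lia) ltac:(lia)
      (fun k Hk1 => Hk k ltac:(lia) (or_introl Hk1))).
    assert (H6 := HBm n (i n) (j n) ltac:(lia) ltac:(lia)).
    rewrite (Rabs_right (B n (j n) - B n (i n))) by lra.
    apply Rabs_le. lra.
  + assert (H5 := HAB n (j n) (i n) (l - eps) (l + eps) ltac:(lia) ltac:(lia)
      (fun k Hk1 => Hk k ltac:(lia) (or_intror Hk1))).
    assert (H6 := HBm n (j n) (i n) ltac:(lia) ltac:(lia)).
    rewrite (Rabs_left1 (B n (j n) - B n (i n))) by lra.
    apply Rabs_le. lra.
Qed.
End Limit.

(** The hypothesis says dA/dB = l at x, with an error relative to the increment of B. As the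
    difference quotient of B is bounded near x, that error is also small relative to the increment
    of the variable. *)
Lemma derivable_of_increment (A B : R -> R) x l b :
  derivable_pt_lim B x b ->
  (forall eps, eps > 0 -> exists del, del > 0 /\ forall y, Rabs (y - x) < del ->
    Rabs (A y - A x - l * (B y - B x)) <= eps * Rabs (B y - B x)) ->
  derivable_pt_lim A x (l * b).
Proof.
intros HB HA eps Heps.
assert (Hb := Rabs_pos b). assert (Hl := Rabs_pos l).
set (e1 := Rmin 1 (eps / (2 * (Rabs l + 1)))).
assert (He1 : 0 < e1) by (apply Rmin_glb_lt; [lra|apply Rdiv_lt_0_compat; lra]).
assert (He1a : e1 <= 1) by apply Rmin_l.
assert (He1b : Rabs l * e1 < eps / 2 + 0).
{ apply Rlt_le_trans with ((Rabs l + 1) * e1); [nra|].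
  assert (H : e1 <= eps / (2 * (Rabs l + 1))) by apply Rmin_r.
  apply Rmult_le_compat_l with (r := Rabs l + 1) in H; [|lra].
  replace ((Rabs l + 1) * (eps / (2 * (Rabs l + 1)))) with (eps / 2) in H by (field; lra). lra. }
destruct (HB e1 He1) as [d1 H1].
set (e2 := eps / (2 * (Rabs b + 1))).
assert (He2 : 0 < e2) by (apply Rdiv_lt_0_compat; lra).
assert (He2b : e2 * (Rabs b + 1) = eps / 2) by (unfold e2; field; lra).
destruct (HA e2 He2) as [d2 [Hd2 H2]].
assert (Hd : 0 < Rmin d1 d2) by (apply Rmin_glb_lt; [apply cond_pos|lra]).
exists (mkposreal _ Hd). simpl. intros h Hh Hhd.
assert (G1 := H1 h Hh ltac:(eapply Rlt_le_trans; [exact Hhd|apply Rmin_l])).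
assert (G2 := H2 (x + h) ltac:(replace (x + h - x) with h by ring;
  eapply Rlt_le_trans; [exact Hhd|apply Rmin_r])).
set (q := (B (x + h) - B x) / h) in *.
assert (Hq : B (x + h) - B x = q * h) by (unfold q; field; exact Hh).
rewrite Hq in G2.
replace ((A (x + h) - A x) / h - l * b) with
  ((A (x + h) - A x - l * (q * h)) / h + l * (q - b)) by (field; exact Hh).
assert (Hh0 : 0 < Rabs h) by (apply Rabs_pos_lt; exact Hh).
assert (G3 : Rabs ((A (x + h) - A x - l * (q * h)) / h) <= e2 * Rabs q).
{ unfold Rdiv. rewrite Rabs_mult, Rabs_inv.
  apply Rmult_le_reg_r with (Rabs h); [exact Hh0|].
  rewrite Rmult_assoc, Rinv_l by lra. rewrite Rabs_mult in G2. lra. }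
assert (G4 : Rabs q <= Rabs b + 1).
{ replace q with ((q - b) + b) by ring. eapply Rle_trans; [apply Rabs_triang|]. lra. }
assert (G5 : Rabs (l * (q - b)) <= Rabs l * e1).
{ rewrite Rabs_mult. apply Rmult_le_compat_l; lra. }
eapply Rle_lt_trans; [apply Rabs_triang|].
assert (e2 * Rabs q <= e2 * (Rabs b + 1)) by (apply Rmult_le_compat_l; lra).
lra.
Qed.

(** * The limit of the difference schemes *)

Lemma bounded_on_segment (F : R -> R) a b : a <= b -> continuity F ->
  exists B, forall s, a <= s <= b -> F s <= B.
Proof.
intros Hab HF. destruct (continuity_ab_maj F a b Hab (fun x _ => HF x)) as [m [Hm _]].
exists (F m). exact Hm.
Qed.

Lemma slope_continuous Phi (c d : R -> R) (D : R -> Prop) x l :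
  continuity Phi -> cont_on D c -> cont_on D d -> D x -> 0 < c x -> 0 < d x ->
  forall eps, eps > 0 -> exists del, del > 0 /\ forall t y, D t -> Rabs (t - x) < del ->
    Rabs (y - l) < del -> Rabs (/ c t * Phi (y / d t) - / c x * Phi (l / d x)) < eps.
Proof.
intros HPhi Hc Hd Dx Hcx Hdx eps Heps.
assert (HP : forall z e, e > 0 -> exists del, del > 0 /\
  forall y, Rabs (y - z) < del -> Rabs (Phi y - Phi z) < e).
{ intros z e He. destruct (HPhi z e He) as [del [Hdel H]]. exists del. split; [lra|].
  intros y Hy. destruct (Req_dec z y) as [<-|Hne].
  - rewrite Rminus_diag, Rabs_R0. lra.
  - apply (H y). split; [split; [exact I|exact Hne]|exact Hy]. }
assert (Hinv : forall (q : R -> R), cont_on D q -> 0 < q x -> forall e, e > 0 ->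
  exists del, del > 0 /\ forall t, D t -> Rabs (t - x) < del -> Rabs (/ q t - / q x) < e).
{ intros q Hq Hqx e He.
  set (e1 := Rmin (q x / 2) (e * (q x * q x / 2))).
  assert (Hqq : 0 < q x * q x) by nra.
  assert (He1 : 0 < e1) by (apply Rmin_glb_lt; [lra|apply Rmult_lt_0_compat; lra]).
  destruct (Hq x Dx e1 He1) as [del [Hdel H]]. exists del. split; [exact Hdel|].
  intros t Dt Ht. specialize (H t Dt Ht).
  assert (Ha : Rabs (q t - q x) < q x / 2) by (eapply Rlt_le_trans; [exact H|apply Rmin_l]).
  assert (Hb : Rabs (q t - q x) < e * (q x * q x / 2)) by (eapply Rlt_le_trans; [exact H|apply Rmin_r]).
  apply Rabs_def2 in Ha.
  replace (/ q t - / q x) with (- (q t - q x) * / (q t * q x)) by (field; lra).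
  assert (Hqt : q x * q x / 2 < q t * q x) by nra.
  rewrite Rabs_mult, Rabs_Ropp, (Rabs_right (/ (q t * q x)))
    by (left; apply Rinv_0_lt_compat; nra).
  apply Rmult_lt_reg_r with (q t * q x); [nra|].
  rewrite Rmult_assoc, Rinv_l by nra. nra. }
set (P := Phi (l / d x)). set (C := / c x).
assert (HC : 0 < C) by (apply Rinv_0_lt_compat; exact Hcx).
assert (HPa := Rabs_pos P).
set (e1 := Rmin 1 (eps / (4 * C))).
assert (He1 : 0 < e1) by (apply Rmin_glb_lt; [lra|apply Rdiv_lt_0_compat; lra]).
assert (He1C : C * e1 <= eps / 4).
{ assert (H : e1 <= eps / (4 * C)) by apply Rmin_r.
  apply Rmult_le_compat_l with (r := C) in H; [|lra].
  replace (C * (eps / (4 * C))) with (eps / 4) in H by (field; lra). exact H. }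
assert (He11 : e1 <= 1) by apply Rmin_l.
destruct (HP (l / d x) e1 He1) as [d1 [Hd1 H1]].
set (e2 := eps / (4 * (Rabs P + 1))).
assert (He2 : 0 < e2) by (apply Rdiv_lt_0_compat; lra).
assert (He2P : e2 * (Rabs P + 1) = eps / 4) by (unfold e2; field; lra).
destruct (Hinv c Hc Hcx e2 He2) as [d2 [Hd2 H2]].
set (D' := / d x). assert (HD : 0 < D') by (apply Rinv_0_lt_compat; exact Hdx).
assert (Hla := Rabs_pos l).
set (e3 := Rmin D' (d1 / (2 * (Rabs l + 1)))).
assert (He3 : 0 < e3) by (apply Rmin_glb_lt; [lra|apply Rdiv_lt_0_compat; lra]).
assert (He3l : (Rabs l + 1) * e3 <= d1 / 2).
{ assert (H : e3 <= d1 / (2 * (Rabs l + 1))) by apply Rmin_r.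
  apply Rmult_le_compat_l with (r := Rabs l + 1) in H; [|lra].
  replace ((Rabs l + 1) * (d1 / (2 * (Rabs l + 1)))) with (d1 / 2) in H by (field; lra). exact H. }
assert (He3D : e3 <= D') by apply Rmin_l.
destruct (Hinv d Hd Hdx e3 He3) as [d3 [Hd3 H3]].
set (d4 := d1 / (4 * D')).
assert (Hd4 : 0 < d4) by (apply Rdiv_lt_0_compat; lra).
assert (Hd4D : d4 * (2 * D') = d1 / 2) by (unfold d4; field; lra).
exists (Rmin d2 (Rmin d3 d4)). split; [repeat apply Rmin_glb_lt; lra|].
intros t y Dt Ht Hy.
assert (Ht2 : Rabs (t - x) < d2) by (eapply Rlt_le_trans; [exact Ht|apply Rmin_l]).
assert (Ht3 : Rabs (t - x) < d3).
{ eapply Rlt_le_trans; [exact Ht|]. eapply Rle_trans; [apply Rmin_r|apply Rmin_l]. }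
assert (Hy4 : Rabs (y - l) < d4).
{ eapply Rlt_le_trans; [exact Hy|]. eapply Rle_trans; [apply Rmin_r|apply Rmin_r]. }
assert (G2 := H2 t Dt Ht2). assert (G3 := H3 t Dt Ht3).
fold C in G2. fold D' in G3.
assert (Hdt : Rabs (/ d t) <= 2 * D').
{ apply Rabs_def2 in G3. apply Rabs_le. lra. }
assert (G1 : Rabs (Phi (y / d t) - P) < e1).
{ apply H1. unfold Rdiv. fold D'.
  replace (y * / d t - l * D') with ((y - l) * / d t + l * (/ d t - D')) by ring.
  eapply Rle_lt_trans; [apply Rabs_triang|]. rewrite !Rabs_mult.
  assert (Rabs (y - l) * Rabs (/ d t) <= Rabs (y - l) * (2 * D')).
  { apply Rmult_le_compat_l; [apply Rabs_pos|exact Hdt]. }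
  assert (Rabs (y - l) * (2 * D') < d4 * (2 * D')) by (apply Rmult_lt_compat_r; lra).
  assert (Rabs l * Rabs (/ d t - D') <= (Rabs l + 1) * e3).
  { apply Rmult_le_compat; try apply Rabs_pos; lra. }
  lra. }
set (Q := Phi (y / d t)) in *.
replace (/ c t * Q - C * P) with ((/ c t - C) * Q + C * (Q - P)) by ring.
eapply Rle_lt_trans; [apply Rabs_triang|]. rewrite !Rabs_mult, (Rabs_right C) by lra.
assert (HQ : Rabs Q <= Rabs P + 1).
{ replace Q with ((Q - P) + P) by ring. eapply Rle_trans; [apply Rabs_triang|]. lra. }
assert (Rabs (/ c t - C) * Rabs Q <= e2 * (Rabs P + 1)).
{ apply Rmult_le_compat; try apply Rabs_pos; lra. }
assert (C * Rabs (Q - P) <= C * e1) by (apply Rmult_le_compat_l; lra).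
lra.
Qed.

Section LimitSolution.
Context {phi Phi g psi2 F h H G c d : R -> R} {cmin cmax dmin dmax : R}.
Hypothesis HP : problem phi Phi g psi2 F h H G c d cmin cmax dmin dmax.
Let HG := pb_growth HP.
Context {W : (nat -> Prop) -> Prop}.
Hypothesis HW : free_ultrafilter W.
Variable M : nat -> nat.
Hypothesis HM : forall n, (n < M n)%nat.
Let N n := (2 * M n)%nat.
Variable p : nat -> R.
Hypothesis Hp : forall n, 0 < p n.
Let u n := shoot_u (Phi:=Phi) (F:=F) (H:=H) (c:=c) (d:=d) (M n) (p n).
Let w n := shoot_w (Phi:=Phi) (F:=F) (H:=H) (c:=c) (d:=d) (M n) (p n).
Let K n := cell_mass (H:=H) (M n).
Hypothesis HuN : forall n, u n (N n) = 0.
Variable Rb : R.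
Hypothesis HRb : forall n i, (i <= N n)%nat -> u n i <= Rb.

Let HM0 n : (0 < M n)%nat.
Proof. specialize (HM n). lia. Qed.

Let HN n : (n < N n)%nat.
Proof. specialize (HM n). unfold N. lia. Qed.

Let HN0 n : (0 < N n)%nat.
Proof. specialize (HM n). unfold N. lia. Qed.

Let HS n := shoot_scheme HP (M n) (HM0 n) (p n).

Lemma lim_Rb_nonneg : 0 <= Rb.
Proof. rewrite <- (HuN 0%nat). apply HRb. lia. Qed.

(** The Harnack inequality at distance one step from the ends. Its constant degenerates with n, but
    only the sign is used. *)
Lemma lim_u_nonneg n i : (i <= N n)%nat -> 0 <= u n i.
Proof.
intros Hi. destruct (Nat.eq_dec i 0) as [->|Hi0]; [unfold u, shoot_u; simpl; lra|].
destruct (Nat.eq_dec i (N n)) as [->|HiN]; [rewrite HuN; lra|].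
destruct (max_node_ex (N n) (u n)) as [s Hs].
assert (Hd : 0 < / INR (N n)) by apply Rinv_0_lt_compat, lt_0_INR, HN0.
assert (H1 := harnack HG (HS n) (/ INR (N n)) s i Hd Hs
  ltac:(unfold shoot_u; simpl; lra) ltac:(change (0 <= u n (N n)); rewrite HuN; lra)).
assert (H2 := harnack_const_bounds HG (HS n) _ Hd).
assert (H3 := shoot_max_pos HP (M n) (HM0 n) (p n) (Hp n) s Hs). fold (u n) in H3.
change (/ INR (N n) <= node (N n) i <= 1 - / INR (N n) ->
  harnack_const g cmin cmax dmin dmax (/ INR (N n)) * u n s <= u n i) in H1.
eapply Rle_trans; [|apply H1].
- apply Rmult_le_pos; lra.
- assert (EN := node_N (N n) (HN0 n)).
  assert (node (N n) 1 <= node (N n) i) by (apply node_le; [apply HN0|lia]).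
  assert (node (N n) (S i) <= node (N n) (N n)) by (apply node_le; [apply HN0|lia]).
  rewrite node_S in H0, H4 by apply HN0. rewrite node_0 in H0. lra.
Qed.

Lemma lim_F_bound : exists B, 0 <= B /\ forall n i, (i <= N n)%nat -> F (u n i) <= B.
Proof.
destruct (bounded_on_segment F 0 Rb lim_Rb_nonneg (pb_F_cont HP)) as [B HB].
exists B. split.
- apply Rle_trans with (F 0); [apply (pb_F HP)|apply HB]. assert (HR := lim_Rb_nonneg). lra.
- intros n i Hi. apply HB. split; [apply lim_u_nonneg, Hi|apply HRb, Hi].
Qed.

(** The bound of [w_le] at distance [a] from the ends. It does not depend on n and grows as [a]
    tends to 0, in accordance with a flux that may be unbounded at the end points. *)
Definition w_bound a := dmax * phi (cmax * Rb * / a).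

Lemma w_bound_nonneg a : 0 < a -> 0 <= w_bound a.
Proof.
intros Ha. unfold w_bound. assert (H1 := dmax_pos (HS 0%nat)). assert (H2 := cmax_pos (HS 0%nat)).
assert (HR := lim_Rb_nonneg).
apply Rmult_le_pos; [lra|]. apply (phi_ge0 HG). repeat apply Rmult_le_pos; try lra.
left; apply Rinv_0_lt_compat; lra.
Qed.

Lemma w_bound_mono a b : 0 < a -> a <= b -> w_bound b <= w_bound a.
Proof.
intros Ha Hab. unfold w_bound. assert (H1 := dmax_pos (HS 0%nat)). assert (H2 := cmax_pos (HS 0%nat)).
assert (HR := lim_Rb_nonneg).
apply Rmult_le_compat_l; [lra|]. apply (phi_le HG). apply Rmult_le_compat_l; [nra|].
apply Rinv_le_contravar; lra.
Qed.

Lemma lim_w_bound a n i : 0 < a -> (1 <= i <= N n)%nat -> a <= node (N n) i ->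
  node (N n) i <= 1 - a -> Rabs (w n i) <= w_bound a.
Proof.
intros Ha Hi Hi1 Hi2. assert (HR := lim_Rb_nonneg).
assert (HNR : 0 < INR (N n)) by apply lt_0_INR, HN0.
assert (Hi0 : 0 < INR i) by (apply lt_0_INR; lia).
assert (U : w n i <= w_bound a).
{ assert (H1 := w_le HG (HS n) i Rb ltac:(unfold N in Hi; lia) ltac:(unfold shoot_u; simpl; lra) HR
    (HRb n i ltac:(lia))).
  eapply Rle_trans; [exact H1|].
  replace (INR (2 * M n) / INR i) with (/ node (N n) i) by (unfold node, N in *; field; lra).
  apply w_bound_mono; lra. }
assert (L : - w n i <= w_bound a).
{ assert (H1 := w_le HG (scheme_reflect HG (HS n)) (S (N n) - i)%nat Rb).
  cbv beta in H1. fold (N n) in H1.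
  replace (S (N n) - (S (N n) - i))%nat with i in H1 by lia.
  replace (N n - (S (N n) - i))%nat with (i - 1)%nat in H1 by lia.
  replace (N n - 0)%nat with (N n) in H1 by lia.
  fold (u n) (w n) in H1.
  eapply Rle_trans; [apply H1|].
  - lia.
  - rewrite HuN. lra.
  - exact HR.
  - apply HRb. lia.
  - replace (INR (N n) / INR (S (N n) - i)) with (/ (1 - node (N n) (i - 1))).
    + assert (node (N n) (i - 1) < node (N n) i) by (apply node_lt; [apply HN0|lia]).
      apply w_bound_mono; lra.
    + replace (S (N n) - i)%nat with (N n - (i - 1))%nat by lia.
      unfold node. rewrite (minus_INR (N n)) by lia.
      assert (INR (i - 1) < INR (N n)) by (apply lt_INR; lia).
      field. lra. }
apply Rabs_le. lra.
Qed.

Lemma lim_u_lipschitz a n i j : 0 < a -> (1 <= i <= j)%nat -> (j <= N n)%nat ->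
  a <= node (N n) i -> node (N n) j <= 1 - a ->
  Rabs (u n j - u n i) <= / cmin * Phi (w_bound a / dmin) * (node (N n) j - node (N n) i).
Proof.
intros Ha Hij Hj Hi1 Hj1.
assert (HNR : 0 < INR (N n)) by apply lt_0_INR, HN0.
assert (Hb : forall k, (i <= k <= j)%nat -> Rabs (w n k) <= w_bound a).
{ intros k Hk. apply lim_w_bound; [exact Ha|lia| |].
  - apply Rle_trans with (1 := Hi1). apply node_le; [apply HN0|lia].
  - apply Rle_trans with (2 := Hj1). apply node_le; [apply HN0|lia]. }
assert (E : node (N n) j - node (N n) i = (INR j - INR i) / INR (N n))
  by (unfold node; field; lra).
rewrite E. apply Rabs_le. split.
- assert (H1 := u_diff_le (scheme_reflect HG (HS n)) (N n - j) (N n - i)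
    (/ cmin * Phi (w_bound a / dmin)) ltac:(fold (N n); lia)).
  cbv beta in H1. fold (N n) in H1.
  replace (N n - (N n - j))%nat with j in H1 by lia.
  replace (N n - (N n - i))%nat with i in H1 by lia.
  rewrite !minus_INR in H1 by lia.
  replace (INR (N n) - INR i - (INR (N n) - INR j)) with (INR j - INR i) in H1 by ring.
  fold (u n) in H1.
  assert (u n i - u n j <= / cmin * Phi (w_bound a / dmin) * ((INR j - INR i) / INR (N n))); [|lra].
  apply H1. intros k Hk.
  apply (slope_le HG (scheme_reflect HG (HS n))); [fold (N n); lia|apply w_bound_nonneg, Ha|].
  fold (N n) (w n). assert (H2 := Hb (S (N n) - k)%nat ltac:(lia)).
  assert (H3 := Rle_abs (- w n (S (N n) - k)%nat)). rewrite Rabs_Ropp in H3. lra.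
- apply (u_diff_le (HS n)); [fold (N n); lia|]. intros k Hk.
  apply (slope_le HG (HS n)); [fold (N n); lia|apply w_bound_nonneg, Ha|].
  fold (w n). assert (H2 := Hb k ltac:(lia)). assert (H3 := Rle_abs (w n k)). lra.
Qed.

(** Limits along [W] of the values at the nodes just left of t. For [u] they exist on the closed
    interval, for the flux only in its interior, where [w_bound] applies. *)
Definition lim_u t := epsilon (inhabits 0) (ulim W (fun n => u n (idx (N n) t))).
Definition lim_w t := epsilon (inhabits 0) (ulim W (fun n => w n (idx (N n) t))).

Lemma lim_u_spec t : 0 <= t <= 1 -> ulim W (fun n => u n (idx (N n) t)) (lim_u t).
Proof.
intros Ht. unfold lim_u. apply epsilon_spec. apply (ulim_ex HW _ Rb).
apply (uf_all HW). intros n.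
assert (Hi := idx_le_N (N n) t (HN0 n) Ht).
rewrite Rabs_right; [apply HRb, Hi|]. apply Rle_ge, lim_u_nonneg, Hi.
Qed.

Lemma idx_inner x : 0 < x < 1 ->
  W (fun n => (1 <= idx (N n) x <= N n)%nat /\
    Rmin x (1 - x) / 2 <= node (N n) (idx (N n) x) <= 1 - Rmin x (1 - x) / 2).
Proof.
intros Hx. set (a := Rmin x (1 - x)).
assert (Ha1 : a <= x) by apply Rmin_l. assert (Ha2 : a <= 1 - x) by apply Rmin_r.
assert (Ha : 0 < a) by (apply Rmin_glb_lt; lra).
apply (uf_sub HW) with (2 := uf_and HW _ _ (idx_interior HW N HN x Hx)
  (inv_N_small HW N HN (a / 2) ltac:(lra))).
intros n [H1 H2]. split; [exact H1|].
assert (H3 := idx_spec (N n) x (HN0 n) ltac:(lra)). lra.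
Qed.

Lemma lim_w_spec t : 0 < t < 1 -> ulim W (fun n => w n (idx (N n) t)) (lim_w t).
Proof.
intros Ht. unfold lim_w. apply epsilon_spec. apply (ulim_ex HW _ (w_bound (Rmin t (1 - t) / 2))).
apply (uf_sub HW) with (2 := idx_inner t Ht). intros n [H1 H2].
assert (0 < Rmin t (1 - t)) by (apply Rmin_glb_lt; lra).
apply lim_w_bound; [lra|exact H1|lra|lra].
Qed.

(** Equicontinuity at x upgrades the limit along the nodes of x to all nearby nodes, as in the
    theorem of Ascoli. *)
Lemma cconv_of_modulus (v : nat -> nat -> R) (vl : R) x : 0 < x < 1 ->
  ulim W (fun n => v n (idx (N n) x)) vl ->
  (forall eps, eps > 0 -> exists del, del > 0 /\ W (fun n => forall i j, (1 <= i <= j)%nat ->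
     (j <= N n)%nat -> Rabs (node (N n) i - x) < del -> Rabs (node (N n) j - x) < del ->
     Rabs (v n j - v n i) < eps)) ->
  cconv (W:=W) N v x vl.
Proof.
intros Hx Hv Hmod eps Heps. destruct (Hmod (eps / 2) ltac:(lra)) as [del [Hdel H1]].
exists del. split; [exact Hdel|].
apply (uf_sub HW) with (2 := uf_and HW _ _ H1 (uf_and HW _ _ (Hv (eps / 2) ltac:(lra))
  (uf_and HW _ _ (inv_N_small HW N HN del Hdel) (idx_interior HW N HN x Hx)))).
intros n [H2 [H3 [H4 H5]]] j Hj Hjx.
assert (H6 := idx_near N HN n x ltac:(lra)).
assert (H7 : Rabs (v n j - v n (idx (N n) x)) < eps / 2).
{ destruct (Nat.le_gt_cases (idx (N n) x) j) as [Hc|Hc].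
  - apply H2; try lia; lra.
  - rewrite Rabs_minus_sym. apply H2; try lia; lra. }
replace (v n j - vl) with ((v n j - v n (idx (N n) x)) + (v n (idx (N n) x) - vl)) by ring.
eapply Rle_lt_trans; [apply Rabs_triang|]. lra.
Qed.

Lemma cconv_u x : 0 < x < 1 -> cconv (W:=W) N u x (lim_u x).
Proof.
intros Hx. apply cconv_of_modulus; [exact Hx|apply lim_u_spec; lra|].
intros eps Heps. set (a := Rmin x (1 - x) / 2).
assert (Ha1 : Rmin x (1 - x) <= x) by apply Rmin_l.
assert (Ha2 : Rmin x (1 - x) <= 1 - x) by apply Rmin_r.
assert (Ha : 0 < Rmin x (1 - x)) by (apply Rmin_glb_lt; lra).
set (L := / cmin * Phi (w_bound a / dmin)).
assert (HL : 0 <= L).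
{ assert (H1 := pb_cmin HP). assert (H2 := pb_dmin HP).
  apply Rmult_le_pos; [left; apply Rinv_0_lt_compat; lra|]. apply (Phi_ge0 HG), Rmult_le_pos.
  - apply w_bound_nonneg. unfold a. lra.
  - left; apply Rinv_0_lt_compat; lra. }
set (del := Rmin a (eps / (2 * (L + 1)))).
assert (Hdel : 0 < del) by (apply Rmin_glb_lt; [unfold a; lra|apply Rdiv_lt_0_compat; lra]).
assert (Hd1 : del <= a) by apply Rmin_l.
assert (Hd2 : 2 * (L + 1) * del <= eps).
{ assert (H1 : del <= eps / (2 * (L + 1))) by apply Rmin_r.
  apply Rmult_le_compat_l with (r := 2 * (L + 1)) in H1; [|lra].
  replace (2 * (L + 1) * (eps / (2 * (L + 1)))) with eps in H1 by (field; lra). exact H1. }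
exists del. split; [exact Hdel|]. apply (uf_all HW). intros n i j Hij Hj Hi1 Hj1.
apply Rabs_def2 in Hi1. apply Rabs_def2 in Hj1.
eapply Rle_lt_trans; [apply (lim_u_lipschitz a); unfold a in *; auto; lra|].
fold L. assert (L * (node (N n) j - node (N n) i) <= L * (2 * del)) by (apply Rmult_le_compat_l; lra).
nra.
Qed.

Lemma cell_point_near n j : (1 <= j <= N n)%nat ->
  Rabs (cell_point (M n) j - node (N n) j) <= / INR (N n) /\ 0 < cell_point (M n) j < 1.
Proof.
intros Hj. destruct (cell_point_bounds (M n) j Hj) as [H1 H2]. fold (N n) in H2.
assert (E : node (N n) j = node (N n) (j - 1) + / INR (N n)).
{ rewrite <- node_S by apply HN0. f_equal. lia. }
split; [apply Rabs_le; lra|exact H1].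
Qed.

Lemma cconv_K x : 0 < x < 1 -> cconv (W:=W) N K x (H x).
Proof.
intros Hx eps Heps.
assert (HcH : continuity_pt H x).
{ apply derivable_continuous_pt. exists (h x). apply (pb_H_der HP), Hx. }
destruct (HcH eps Heps) as [del [Hdel H1]]. simpl in H1. unfold Rdist in H1.
exists (del / 2). split; [lra|].
apply (uf_sub HW) with (2 := inv_N_small HW N HN (del / 2) ltac:(lra)).
intros n Hn j Hj Hjx. unfold K, cell_mass.
destruct (cell_point_near n j Hj) as [H2 _].
destruct (Req_dec x (cell_point (M n) j)) as [<-|Hne].
- rewrite Rminus_diag, Rabs_R0. lra.
- apply H1. split; [split; [exact I|exact Hne]|].
  replace (cell_point (M n) j - x) with
    ((cell_point (M n) j - node (N n) j) + (node (N n) j - x)) by ring.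
  eapply Rle_lt_trans; [apply Rabs_triang|]. lra.
Qed.

(** Increments of the flux are at most [B] times those of [K], and [K] converges continuously to the
    continuous function [H]; so the flux inherits its equicontinuity from [H]. *)
Lemma cconv_w x : 0 < x < 1 -> cconv (W:=W) N w x (lim_w x).
Proof.
intros Hx. apply cconv_of_modulus; [exact Hx|apply lim_w_spec; lra|].
intros eps Heps. destruct lim_F_bound as [B [HB0 HB]].
destruct (cconv_K x Hx (eps / (2 * (B + 1))) ltac:(apply Rdiv_lt_0_compat; lra)) as [del [Hdel H1]].
exists del. split; [exact Hdel|]. apply (uf_sub HW) with (2 := H1).
intros n H2 i j Hij Hj Hi1 Hj1.
assert (Ki := H2 i ltac:(lia) Hi1). assert (Kj := H2 j ltac:(lia) Hj1).
apply Rabs_def2 in Ki. apply Rabs_def2 in Kj.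
assert (H3 := w_diff_le (HS n) i j B Hij Hj (fun k Hk => HB n k ltac:(unfold N in *; lia))).
assert (H4 := w_mono (HS n) i j Hij Hj). fold (w n) (K n) in H3, H4.
assert (H5 : (B + 1) * (K n j - K n i) < eps).
{ set (q := eps / (2 * (B + 1))) in *.
  assert (Hq : (B + 1) * (2 * q) = eps) by (unfold q; field; lra).
  rewrite <- Hq. apply Rmult_lt_compat_l; lra. }
assert (H6 := K_mono (HS n) i j Hij Hj). fold (K n) in H6.
apply Rabs_def1; nra.
Qed.

Lemma lim_w_der x : 0 < x < 1 -> derivable_pt_lim lim_w x (- F (lim_u x) * h x).
Proof.
intros Hx. apply derivable_of_increment with H; [apply (pb_H_der HP), Hx|].
apply (limit_increment HW N HN w K (fun n k => - F (u n k))); auto.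
- intros y Hy. apply lim_w_spec, Hy.
- intros y Hy. apply (cconv_ulim HW N HN); [apply cconv_K, Hy|exact Hy].
- intros n i j Hij Hj. apply (K_mono (HS n)); auto.
- intros n i j lo hi Hij Hj Hk.
  assert (H1 := w_diff_le (HS n) i j (- lo) Hij Hj
    (fun k Hk1 => ltac:(destruct (Hk k ltac:(lia)) as [E _]; fold (u n); lra))).
  assert (H2 := w_diff_ge (HS n) i j (- hi) Hij Hj
    (fun k Hk1 => ltac:(destruct (Hk k ltac:(lia)) as [_ E]; fold (u n); lra))).
  fold (w n) (K n) in H1, H2. lra.
- apply (cconv_comp HW N HN u x (lim_u x) (fun _ y => - F y)); [|apply cconv_u, Hx].
  intros eps Heps. destruct (pb_F_cont HP (lim_u x) eps Heps) as [del [Hdel H1]].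
  exists del. split; [exact Hdel|]. intros t y _ _ Hy.
  destruct (Req_dec (lim_u x) y) as [<-|Hne].
  + rewrite Rminus_diag, Rabs_R0. lra.
  + replace (- F y - - F (lim_u x)) with (- (F y - F (lim_u x))) by ring. rewrite Rabs_Ropp.
    apply (H1 y). split; [split; [exact I|exact Hne]|exact Hy].
Qed.

Lemma lim_u_der x : 0 < x < 1 ->
  derivable_pt_lim lim_u x (/ c x * Phi (lim_w x / d x)).
Proof.
intros Hx. assert (Hc := pb_c HP x ltac:(lra)). assert (Hd := pb_d HP x ltac:(lra)).
assert (Hc0 := pb_cmin HP). assert (Hd0 := pb_dmin HP).
rewrite <- (Rmult_1_r (/ c x * _)).
(* For [u] the comparison function is the position itself, with derivative 1, in place of [H]. *)
apply derivable_of_increment with (fun y => y); [apply derivable_pt_lim_id|].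
apply (limit_increment HW N HN u (fun n => node (N n))
  (fun n k => / c (node (N n) k) * Phi (w n k / d (node (N n) k)))); auto.
- intros y Hy. apply lim_u_spec. lra.
- intros y Hy eps Heps. apply (uf_sub HW) with (2 := inv_N_small HW N HN eps Heps).
  intros n Hn. assert (H1 := idx_near N HN n y ltac:(lra)). lra.
- intros n i j Hij Hj. apply node_le; [apply HN0|lia].
- intros n i j lo hi Hij Hj Hk.
  assert (HNR : 0 < INR (N n)) by apply lt_0_INR, HN0.
  assert (E : node (N n) j - node (N n) i = (INR j - INR i) / INR (N n))
    by (unfold node; field; lra).
  rewrite E. split.
  + apply (u_diff_ge (HS n)); [fold (N n); lia|]. intros k Hk1. apply (Hk k). lia.
  + apply (u_diff_le (HS n)); [fold (N n); lia|]. intros k Hk1. apply (Hk k). lia.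
- apply (cconv_comp HW N HN w x (lim_w x) (fun t y => / c t * Phi (y / d t)));
    [|apply cconv_w, Hx].
  apply (slope_continuous Phi c d (fun t => 0 <= t <= 1)); try lra.
  + apply (gd_Phi_cont HG).
  + apply (pb_c_cont HP).
  + apply (pb_d_cont HP).
Qed.

Lemma lim_u_bounds t : 0 <= t <= 1 -> 0 <= lim_u t <= Rb.
Proof.
intros Ht. split.
- apply (ulim_le HW _ _ _ _ (ulim_const HW 0) (lim_u_spec t Ht)).
  apply (uf_all HW). intros n. apply lim_u_nonneg, idx_le_N; [apply HN0|exact Ht].
- apply (ulim_le HW _ _ _ _ (lim_u_spec t Ht) (ulim_const HW Rb)).
  apply (uf_all HW). intros n. apply HRb, idx_le_N; [apply HN0|exact Ht].
Qed.

Lemma lim_u_0 : lim_u 0 = 0.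
Proof.
assert (E : forall n, u n (idx (N n) 0) = 0).
{ intros n. unfold idx. rewrite Rmult_0_r. replace (Int_part 0) with 0%Z; [reflexivity|].
  apply Int_part_spec. lra. }
apply Rle_antisym.
- apply (ulim_le HW _ _ _ _ (lim_u_spec 0 ltac:(lra)) (ulim_const HW 0)).
  apply (uf_all HW). intros n. rewrite E. lra.
- apply lim_u_bounds. lra.
Qed.

Lemma lim_u_1 : lim_u 1 = 0.
Proof.
assert (E : forall n, u n (idx (N n) 1) = 0).
{ intros n. rewrite <- (HuN n). f_equal. assert (H1 := idx_spec (N n) 1 (HN0 n) ltac:(lra)).
  assert (H2 := idx_le_N (N n) 1 (HN0 n) ltac:(lra)).
  apply Nat.le_antisymm; [exact H2|]. apply Nat.lt_succ_r, (node_lt_inv (N n)); [apply HN0|].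
  rewrite node_S, node_N by apply HN0. lra. }
apply Rle_antisym.
- apply (ulim_le HW _ _ _ _ (lim_u_spec 1 ltac:(lra)) (ulim_const HW 0)).
  apply (uf_all HW). intros n. rewrite E. lra.
- apply lim_u_bounds. lra.
Qed.

(** The inequality [del < t] is strict because the node used for t lies up to one step to its left
    and must still be at distance [del] from 0. *)
Lemma lim_u_positive del r : 0 < del ->
  (forall n, exists s, max_node (N n) (u n) s /\ r <= u n s) ->
  forall t, del < t <= 1 - del ->
  harnack_const g cmin cmax dmin dmax del * r <= lim_u t.
Proof.
intros Hdel Hr t Ht.
apply (ulim_le HW _ _ _ _ (ulim_const HW _) (lim_u_spec t ltac:(lra))).
apply (uf_sub HW) with (2 := inv_N_small HW N HN (t - del) ltac:(lra)).
intros n Hn. destruct (Hr n) as [s [Hs Hrs]].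
assert (H1 := harnack_const_bounds HG (HS n) del Hdel).
apply Rle_trans with (harnack_const g cmin cmax dmin dmax del * u n s).
- apply Rmult_le_compat_l; lra.
- apply (harnack HG (HS n)); auto.
  + unfold shoot_u; simpl; lra.
  + change (0 <= u n (N n)). rewrite HuN. lra.
  + change (del <= node (N n) (idx (N n) t) <= 1 - del).
    assert (H2 := idx_spec (N n) t (HN0 n) ltac:(lra)). lra.
Qed.

Lemma G_mono_left a b : 0 <= a -> a <= b -> b <= 1 / 2 -> G a <= G b.
Proof.
intros Ha Hab Hb. destruct Hab as [Hab| ->]; [|lra].
assert (H1 := pb_G_left HP a b Ha Hab Hb).
assert (H2 : H b <= 0).
{ rewrite <- (pb_H_half HP). apply (pb_H_mono HP); lra. }
assert (H3 := gd_g_pos HG (- H b) ltac:(lra)). nra.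
Qed.

Lemma G_mono_right a b : 1 / 2 <= a -> a <= b -> b <= 1 -> G a <= G b.
Proof.
intros Ha Hab Hb. destruct Hab as [Hab| ->]; [|lra].
assert (H1 := pb_G_right HP a b Ha Hab Hb).
assert (H2 : 0 <= H a).
{ rewrite <- (pb_H_half HP). apply (pb_H_mono HP); lra. }
assert (H3 := gd_g_pos HG (H a) ltac:(lra)). nra.
Qed.

(** The interior Lipschitz bounds degenerate at the ends, so continuity there has to come from
    [near_start_le] and the continuity of [G] at 0 and 1. The node of 1 - t may be further from 1
    than t, by less than one step, hence [2 * t] on the right; on the left, rounding down costs
    nothing. *)
Lemma lim_u_near_ends : exists C1 C2, 0 <= C1 /\ 0 <= C2 /\
  (forall t, 0 < t <= 1 / 2 -> lim_u t <= C1 * t + C2 * (G t - G 0)) /\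
  (forall t, 0 < t <= 1 / 4 -> lim_u (1 - t) <= C1 * (2 * t) + C2 * (G 1 - G (1 - 2 * t))).
Proof.
destruct lim_F_bound as [B [HB0 HB]].
assert (Hc0 := pb_cmin HP). assert (Hd0 := pb_dmin HP).
assert (Hic : 0 < / cmin) by (apply Rinv_0_lt_compat; lra).
assert (Hid : 0 < / dmin) by (apply Rinv_0_lt_compat; lra).
set (Wb := w_bound (1 / 2)).
assert (HWb : 0 <= Wb) by (apply w_bound_nonneg; lra).
set (C1 := / cmin * Phi (2 * Wb / dmin)). set (C2 := / cmin * Phi (2 * B / dmin)).
assert (HC1 : 0 <= C1) by (apply Rmult_le_pos; [lra|apply (Phi_ge0 HG), Rmult_le_pos; lra]).
assert (HC2 : 0 <= C2) by (apply Rmult_le_pos; [lra|apply (Phi_ge0 HG), Rmult_le_pos; lra]).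
assert (Hhalf : forall n, node (N n) (M n) = 1 / 2) by (intros n; apply node_half, HM0).
assert (Hwl : forall n, Rabs (w n (M n)) <= Wb).
{ intros n. assert (HM0n := HM0 n). apply lim_w_bound; [lra|unfold N; lia| |]; rewrite Hhalf; lra. }
(* [lim_w_bound] does not reach this cell, whose right node is beyond 1/2. The one-sided bound
   needed for the reflected scheme follows from [w_le] directly. *)
assert (Hwr : forall n, - w n (S (M n)) <= Wb).
{ intros n. assert (E := w_le HG (scheme_reflect HG (HS n)) (M n) Rb).
  cbv beta in E. fold (N n) in E. assert (HM0n := HM0 n). fold (u n) (w n) in E.
  replace (S (N n) - M n)%nat with (S (M n)) in E by (unfold N; lia).
  replace (N n - 0)%nat with (N n) in E by lia.
  eapply Rle_trans; [apply E|].
  - unfold N; lia.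
  - rewrite HuN. lra.
  - apply lim_Rb_nonneg.
  - apply HRb. lia.
  - unfold Wb. replace (INR (N n) / INR (M n)) with (/ (1 / 2)); [apply w_bound_mono; lra|].
    unfold N. rewrite mult_INR. simpl. field. apply not_0_INR. lia. }
exists C1, C2. split; [exact HC1|]. split; [exact HC2|]. split.
- intros t Ht.
  apply (ulim_le HW _ _ _ _ (lim_u_spec t ltac:(lra)) (ulim_const HW _)).
  apply (uf_all HW). intros n.
  assert (I1 := idx_spec (N n) t (HN0 n) ltac:(lra)). set (k := idx (N n) t) in *.
  assert (Hk : (k <= M n)%nat).
  { apply Nat.lt_succ_r, (node_lt_inv (N n)); [apply HN0|].
    rewrite node_S, Hhalf by apply HN0.
    assert (0 < / INR (N n)) by apply Rinv_0_lt_compat, lt_0_INR, HN0. lra. }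
  assert (E := near_start_le HG (HS n) (M n) _ k Wb B (shoot_grid HP (M n) (HM0 n)) Hk
    (HM0 n) HWb ltac:(fold (w n); assert (E1 := Rle_abs (w n (M n))); specialize (Hwl n); lra)
    (HB n)).
  cbv beta in E. fold (N n) (u n) in E. fold (node (N n) k) in E. rewrite node_0 in E.
  assert (Hk0 := node_bounds (N n) k (HN0 n) ltac:(unfold N; lia)).
  assert (HGk := G_mono_left (node (N n) k) t ltac:(lra) ltac:(lra) ltac:(lra)).
  change (u n 0%nat) with 0 in E. unfold C1, C2 in *.
  assert (/ cmin * Phi (2 * Wb / dmin) * node (N n) k <= / cmin * Phi (2 * Wb / dmin) * t)
    by (apply Rmult_le_compat_l; lra).
  assert (/ cmin * Phi (2 * B / dmin) * (G (node (N n) k) - G 0) <=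
    / cmin * Phi (2 * B / dmin) * (G t - G 0)) by (apply Rmult_le_compat_l; lra).
  lra.
- intros t Ht.
  apply (ulim_le HW _ _ _ _ (lim_u_spec (1 - t) ltac:(lra)) (ulim_const HW _)).
  apply (uf_sub HW) with (2 := inv_N_small HW N HN t ltac:(lra)). intros n Hn.
  assert (I1 := idx_spec (N n) (1 - t) (HN0 n) ltac:(lra)). set (k := idx (N n) (1 - t)) in *.
  assert (HkN : (k <= N n)%nat) by (apply idx_le_N; [apply HN0|lra]).
  assert (Hk : (M n <= k)%nat).
  { apply Nat.lt_succ_r, (node_lt_inv (N n)); [apply HN0|].
    rewrite node_S, Hhalf by apply HN0. lra. }
  assert (E := near_start_le HG (scheme_reflect HG (HS n)) (M n) _ (N n - k) Wb B
    (grid_reflect _ _ _ _ _ (shoot_grid HP (M n) (HM0 n))) ltac:(unfold N; lia) (HM0 n) HWb).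
  cbv beta in E. fold (N n) in E. assert (HM0n := HM0 n). fold (u n) (w n) in E.
  replace (S (N n) - M n)%nat with (S (M n)) in E by (unfold N; lia).
  replace (N n - (N n - k))%nat with k in E by lia.
  replace (N n - 0)%nat with (N n) in E by lia.
  specialize (E (Hwr n) (fun i Hi => HB n (N n - i)%nat ltac:(lia))).
  rewrite HuN, minus_INR, (node_N (N n)) in E by (auto; lia).
  replace ((INR (N n) - INR k) / INR (N n)) with (1 - node (N n) k) in E
    by (unfold node; field; apply not_0_INR; assert (HN0n := HN0 n); lia).
  assert (Hk0 := node_bounds (N n) k ltac:(lia) HkN).
  assert (HGk := G_mono_right (1 - 2 * t) (node (N n) k) ltac:(lra) ltac:(lra) ltac:(lra)).
  unfold C1, C2 in *.
  assert (/ cmin * Phi (2 * Wb / dmin) * (1 - node (N n) k) <=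
    / cmin * Phi (2 * Wb / dmin) * (2 * t)) by (apply Rmult_le_compat_l; lra).
  assert (/ cmin * Phi (2 * B / dmin) * (- G (node (N n) k) - - G 1) <=
    / cmin * Phi (2 * B / dmin) * (G 1 - G (1 - 2 * t))) by (apply Rmult_le_compat_l; lra).
  lra.
Qed.
End LimitSolution.

(** * Existence *)

Lemma cont_pt_dist (f : R -> R) x : continuity_pt f x ->
  forall eps, eps > 0 -> exists del, del > 0 /\
    forall y, Rabs (y - x) < del -> Rabs (f y - f x) < eps.
Proof.
intros Hf eps Heps. destruct (Hf eps Heps) as [del [Hdel H]]. exists del. split; [exact Hdel|].
intros y Hy. destruct (Req_dec x y) as [<-|Hne].
- rewrite Rminus_diag, Rabs_R0. lra.
- apply H. split; [split; [exact I|exact Hne]|exact Hy].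
Qed.

Lemma cont_pt_of_dist (f : R -> R) x :
  (forall eps, eps > 0 -> exists del, del > 0 /\
    forall y, Rabs (y - x) < del -> Rabs (f y - f x) < eps) -> continuity_pt f x.
Proof.
intros H eps Heps. destruct (H eps Heps) as [del [Hdel H1]]. exists del. split; [exact Hdel|].
intros y [_ Hy]. apply H1. exact Hy.
Qed.

Lemma cont_on_open_pt (f : R -> R) x : cont_on (fun t => 0 < t < 1) f -> 0 < x < 1 ->
  continuity_pt f x.
Proof.
intros Hf Hx. apply cont_pt_of_dist. intros eps Heps.
destruct (Hf x Hx eps Heps) as [del [Hdel H]].
exists (Rmin del (Rmin x (1 - x))). split; [repeat apply Rmin_glb_lt; lra|].
intros y Hy. apply H.
- assert (H1 : Rabs (y - x) < x).
  { eapply Rlt_le_trans; [exact Hy|]. eapply Rle_trans; [apply Rmin_r|apply Rmin_l]. }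
  assert (H2 : Rabs (y - x) < 1 - x).
  { eapply Rlt_le_trans; [exact Hy|]. eapply Rle_trans; [apply Rmin_r|apply Rmin_r]. }
  apply Rabs_def2 in H1. apply Rabs_def2 in H2. lra.
- eapply Rlt_le_trans; [exact Hy|apply Rmin_l].
Qed.

Lemma cont_on_of_pt (f : R -> R) (D : R -> Prop) :
  (forall x, D x -> continuity_pt f x) -> cont_on D f.
Proof.
intros H x Dx eps Heps. destruct (cont_pt_dist f x (H x Dx) eps Heps) as [del [Hdel H1]].
exists del. split; [exact Hdel|]. intros y _ Hy. apply H1, Hy.
Qed.

Lemma norm_inf_lub u B : (forall t, 0 <= t <= 1 -> Rabs (u t) <= B) ->
  is_lub (fun y => exists t, 0 <= t <= 1 /\ y = Rabs (u t)) (norm_inf u).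
Proof.
intros HB. unfold norm_inf. apply epsilon_spec.
destruct (completeness (fun y => exists t, 0 <= t <= 1 /\ y = Rabs (u t))) as [m Hm].
- exists B. intros y [t [Ht ->]]. apply HB, Ht.
- exists (Rabs (u 0)), 0. split; [lra|reflexivity].
- exists m. exact Hm.
Qed.

Section Existence.
Context {phi Phi g psi2 f h H G c d : R -> R} {cmin cmax dmin dmax lam : R}.
(** [f] is meaningful on the half-line only; it is continued by [f 0] to negative arguments, which
    the limit does not take. *)
Let F s := lam * f (Rmax 0 s).
Hypothesis HP : problem phi Phi g psi2 F h H G c d cmin cmax dmin dmax.
Let HG := pb_growth HP.
Context {a x b x1 x2 b1 e del mu : R}.
Hypothesis Hmp : mass_points H a x b x1 x2 b1 e del mu.
Variable a0 : R.
Hypothesis Ha0 : 0 <= a0.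
Hypothesis Ha : g (a0 / dmin) * (G 1 - G 0) < cmin.
Let kap := harnack_const g cmin cmax dmin dmax del.
Let b0 := dmax * psi2 (2 * cmax / del) / mu.
(* No maximum of a discrete solution is bad. *)
Let bad m := sublevel F phi a0 m \/ suplevel F phi kap b0 m.

Section Limit.
Context {W : (nat -> Prop) -> Prop}.
Hypothesis HW : free_ultrafilter W.
Variable M : nat -> nat.
Hypothesis HM : forall n, (n < M n)%nat.
Hypothesis HMe : forall n, / INR (2 * M n) <= e.
Variable p : nat -> R.
Hypothesis Hp : forall n, 0 < p n.
Let u n := shoot_u (Phi:=Phi) (F:=F) (H:=H) (c:=c) (d:=d) (M n) (p n).
Hypothesis HuN : forall n, u n (2 * M n)%nat = 0.

Let HM0 n : (0 < M n)%nat.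
Proof. assert (H1 := HM n). lia. Qed.

Let U := lim_u (W:=W) (Phi:=Phi) (F:=F) (H:=H) (c:=c) (d:=d) M p.
Let w := lim_w (W:=W) (Phi:=Phi) (F:=F) (H:=H) (c:=c) (d:=d) M p.

Lemma max_not_bad n s : max_node (2 * M n) (u n) s -> 0 < u n s /\ ~ bad (u n s).
Proof.
intros Hs. split; [exact (shoot_max_pos HP (M n) (HM0 n) (p n) (Hp n) s Hs)|].
intros [Hb|Hb]; revert Hb.
- apply (not_sublevel HP (M n) (HM0 n) (p n) (Hp n) s Hs a0 Ha0 Ha).
  change (u n (2 * M n)%nat <= 0). rewrite HuN. lra.
- apply (not_suplevel HP Hmp (M n) (HM0 n) (p n) (Hp n) s Hs (HMe n)).
  change (0 <= u n (2 * M n)%nat). rewrite HuN. lra.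
Qed.

Lemma u_le_of_bad B : (forall m, B < m -> bad m) -> forall n i, (i <= 2 * M n)%nat -> u n i <= B.
Proof.
intros HB n i Hi. destruct (max_node_ex (2 * M n) (u n)) as [s Hs].
destruct (max_not_bad n s Hs) as [_ Hnb].
apply Rle_trans with (u n s); [apply Hs, Hi|].
apply Rnot_lt_le. intro Hlt. apply Hnb, HB, Hlt.
Qed.

Lemma max_ge_of_bad r : (forall m, 0 < m < r -> bad m) ->
  forall n, exists s, max_node (2 * M n) (u n) s /\ r <= u n s.
Proof.
intros Hr n. destruct (max_node_ex (2 * M n) (u n)) as [s Hs].
destruct (max_not_bad n s Hs) as [Hpos Hnb].
exists s. split; [exact Hs|]. apply Rnot_lt_le. intro Hlt. apply Hnb, Hr. lra.
Qed.

Variables r0 R0 : R.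
Hypothesis Hr0 : 0 < r0.
Hypothesis Hbad_small : forall m, 0 < m < r0 -> bad m.
Hypothesis Hbad_large : forall m, R0 < m -> bad m.

Let HRb := u_le_of_bad R0 Hbad_large.

Lemma U_cont : cont_on (fun t => 0 <= t <= 1) U.
Proof.
assert (U0 : U 0 = 0) by exact (lim_u_0 HP HW M HM p Hp HuN R0 HRb).
assert (U1 : U 1 = 0) by exact (lim_u_1 HP HW M HM p Hp HuN R0 HRb).
assert (UB := lim_u_bounds HP HW M HM p Hp HuN R0 HRb). fold U in UB.
destruct (lim_u_near_ends HP HW M HM p Hp HuN R0 HRb) as [C1 [C2 [HC1 [HC2 [E0 E1]]]]].
fold U in E0, E1.
assert (Sm : forall eps, 0 < eps -> exists q, 0 < q /\ C1 * (2 * q) < eps / 2 /\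
  C2 * q < eps / 2).
{ intros eps Heps. exists (eps / (4 * (C1 + C2 + 1))).
  set (q := eps / (4 * (C1 + C2 + 1))).
  assert (Hq : 0 < q) by (apply Rdiv_lt_0_compat; lra).
  assert (Hq4 : q * (4 * (C1 + C2 + 1)) = eps) by (unfold q; field; lra).
  split; [exact Hq|]. nra. }
intros t Ht eps Heps.
destruct (Req_dec t 0) as [->|Ht0]; [|destruct (Req_dec t 1) as [->|Ht1]].
- destruct (Sm eps Heps) as [q [Hq [Hq1 Hq2]]].
  destruct (pb_G_0 HP q Hq) as [d1 [Hd1 HG0]].
  exists (Rmin q (Rmin d1 (1 / 2))). split; [repeat apply Rmin_glb_lt; lra|].
  intros y Hy Hyd. rewrite U0, Rminus_0_r.
  destruct (Req_dec y 0) as [->|Hy0]; [rewrite U0, Rabs_R0; lra|].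
  rewrite Rminus_0_r, (Rabs_right y) in Hyd by lra.
  assert (y < q) by (eapply Rlt_le_trans; [exact Hyd|apply Rmin_l]).
  assert (y < d1).
  { eapply Rlt_le_trans; [exact Hyd|]. eapply Rle_trans; [apply Rmin_r|apply Rmin_l]. }
  assert (y < 1 / 2).
  { eapply Rlt_le_trans; [exact Hyd|]. eapply Rle_trans; [apply Rmin_r|apply Rmin_r]. }
  assert (L := E0 y ltac:(lra)). assert (LG := HG0 y ltac:(lra)). apply Rabs_def2 in LG.
  rewrite Rabs_right by (apply Rle_ge, UB, Hy). nra.
- destruct (Sm eps Heps) as [q [Hq [Hq1 Hq2]]].
  destruct (pb_G_1 HP q Hq) as [d1 [Hd1 HG1]].
  exists (Rmin q (Rmin (d1 / 2) (1 / 4))). split; [repeat apply Rmin_glb_lt; lra|].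
  intros y Hy Hyd. rewrite U1, Rminus_0_r.
  destruct (Req_dec y 1) as [->|Hy1]; [rewrite U1, Rabs_R0; lra|].
  rewrite Rabs_left in Hyd by lra.
  set (z := 1 - y). assert (Ez : y = 1 - z) by (unfold z; ring).
  assert (z < q) by (eapply Rlt_le_trans; [|apply Rmin_l]; unfold z; eapply Rle_lt_trans; [|exact Hyd]; lra).
  assert (z < d1 / 2).
  { eapply Rlt_le_trans; [|eapply Rle_trans; [apply Rmin_r|apply Rmin_l]].
    eapply Rle_lt_trans; [|exact Hyd]; unfold z; lra. }
  assert (z < 1 / 4).
  { eapply Rlt_le_trans; [|eapply Rle_trans; [apply Rmin_r|apply Rmin_r]].
    eapply Rle_lt_trans; [|exact Hyd]; unfold z; lra. }
  assert (0 < z) by (unfold z; lra).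
  assert (L := E1 z ltac:(lra)). assert (LG := HG1 (2 * z) ltac:(lra)). apply Rabs_def2 in LG.
  rewrite Rabs_right by (apply Rle_ge, UB, Hy). rewrite Ez. nra.
- assert (Hc : continuity_pt U t).
  { apply derivable_continuous_pt. eexists.
    apply (lim_u_der HP HW M HM p Hp HuN R0 HRb). lra. }
  destruct (cont_pt_dist U t Hc eps Heps) as [d1 [Hd1 H1]].
  exists d1. split; [exact Hd1|]. intros y _ Hy. apply H1, Hy.
Qed.

(** All discrete maxima are at least [r0], so the limit cannot be trivial, and the Harnack
    inequality at half the distance of t to the boundary carries this over to t. *)
Lemma U_pos t : 0 < t < 1 -> 0 < U t.
Proof.
intros Ht. set (q := Rmin t (1 - t) / 2).
assert (H1 : Rmin t (1 - t) <= t) by apply Rmin_l.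
assert (H2 : Rmin t (1 - t) <= 1 - t) by apply Rmin_r.
assert (H3 : 0 < Rmin t (1 - t)) by (apply Rmin_glb_lt; lra).
assert (Hq : 0 < q) by (unfold q; lra).
eapply Rlt_le_trans; [|apply (lim_u_positive HP HW M HM p Hp HuN R0 HRb q r0 Hq)].
- apply Rmult_lt_0_compat; [|exact Hr0].
  apply (harnack_const_bounds HG (shoot_scheme HP (M 0%nat) (HM0 0%nat) 0) q Hq).
- apply max_ge_of_bad, Hbad_small.
- unfold q. lra.
Qed.

Lemma U_solution : is_pos_solution phi c d h f lam U.
Proof.
assert (UB := lim_u_bounds HP HW M HM p Hp HuN R0 HRb). fold U in UB.
assert (Dw := lim_w_der HP HW M HM p Hp HuN R0 HRb). fold U w in Dw.
assert (Du := lim_u_der HP HW M HM p Hp HuN R0 HRb). fold U w in Du.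
assert (cp : forall t, 0 < t < 1 -> 0 < c t).
{ intros t Ht. assert (H1 := pb_c HP t ltac:(lra)). assert (H2 := pb_cmin HP). lra. }
assert (dp : forall t, 0 < t < 1 -> 0 < d t).
{ intros t Ht. assert (H1 := pb_d HP t ltac:(lra)). assert (H2 := pb_dmin HP). lra. }
assert (Cw : forall t, 0 < t < 1 -> continuity_pt w t).
{ intros t Ht. apply derivable_continuous_pt. eexists. apply Dw, Ht. }
assert (CU : forall t, 0 < t < 1 -> continuity_pt U t).
{ intros t Ht. apply derivable_continuous_pt. eexists. apply Du, Ht. }
split; [|intros t Ht; apply U_pos, Ht].
split; [apply U_cont|].
exists (fun t => / c t * Phi (w t / d t)). split; [exact Du|]. split.
{ intros t Ht eps Heps.
  destruct (slope_continuous Phi c d (fun t => 0 <= t <= 1) t (w t) (gd_Phi_cont HG)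
    (pb_c_cont HP) (pb_d_cont HP) ltac:(lra) (cp t Ht) (dp t Ht) eps Heps) as [d1 [Hd1 H1]].
  destruct (cont_pt_dist w t (Cw t Ht) d1 Hd1) as [d2 [Hd2 H2]].
  exists (Rmin d1 d2). split; [apply Rmin_glb_lt; lra|].
  intros y Hy Hyd. apply H1; [lra| |].
  - eapply Rlt_le_trans; [exact Hyd|apply Rmin_l].
  - apply H2. eapply Rlt_le_trans; [exact Hyd|apply Rmin_r]. }
exists (fun t => - F (U t) * h t). split; [|split; [|split]].
- intros t Ht.
  (* With u' = Phi(w / d) / c, the expression d phi(c u') is [w] itself on (0,1). *)
  apply (derivable_pt_lim_locally_ext w _ t 0 1 _ Ht); [|apply Dw, Ht].
  intros z Hz. assert (H1 := cp z Hz). assert (H2 := dp z Hz).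
  rewrite <- Rmult_assoc, Rinv_r, Rmult_1_l by lra.
  rewrite (gd_PhiK HG). field. lra.
- apply cont_on_of_pt. intros t Ht.
  apply (continuity_pt_mult (fun t => - F (U t)) h).
  + apply (continuity_pt_opp (fun t => F (U t))).
    apply (continuity_pt_comp U F); [apply CU, Ht|apply (pb_F_cont HP)].
  + apply cont_on_open_pt; [apply (pb_h_cont HP)|exact Ht].
- intros t Ht. unfold F. rewrite Rmax_right by (apply UB; lra). ring.
- split; [exact (lim_u_0 HP HW M HM p Hp HuN R0 HRb)|exact (lim_u_1 HP HW M HM p Hp HuN R0 HRb)].
Qed.

(** The limit does not depend on the bound used to construct it, so any other threshold [B] may take
    the place of [R0]. *)
Lemma U_norm_le B : (forall m, B < m -> bad m) -> norm_inf U <= B.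
Proof.
intros HB.
assert (UB := lim_u_bounds HP HW M HM p Hp HuN B (u_le_of_bad B HB)). fold U in UB.
assert (UA : forall t, 0 <= t <= 1 -> Rabs (U t) <= B).
{ intros t Ht. specialize (UB t Ht). rewrite Rabs_right; lra. }
apply (norm_inf_lub U B UA). intros y [t [Ht ->]]. apply UA, Ht.
Qed.

Lemma U_norm_ge r : (forall m, 0 < m < r -> bad m) ->
  harnack_const g cmin cmax dmin dmax (1 / 4) * r <= norm_inf U.
Proof.
intros Hr.
assert (UB := lim_u_bounds HP HW M HM p Hp HuN R0 HRb). fold U in UB.
assert (L : is_lub (fun y => exists t, 0 <= t <= 1 /\ y = Rabs (U t)) (norm_inf U)).
{ apply (norm_inf_lub U R0). intros t Ht. specialize (UB t Ht). rewrite Rabs_right; lra. }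
apply Rle_trans with (U (1 / 2)).
- apply (lim_u_positive HP HW M HM p Hp HuN R0 HRb (1 / 4) r); [lra| |lra].
  apply max_ge_of_bad, Hr.
- apply L. exists (1 / 2). split; [lra|]. rewrite Rabs_right; [reflexivity|].
  apply Rle_ge, UB. lra.
Qed.
End Limit.

(** [r0] and [R0] depend on [lam] without control and serve for existence. The two norm bounds leave
    the threshold free, because the asymptotics are obtained from thresholds fixed before [lam]. *)
Lemma exists_solution r0 R0 : 0 < r0 -> 0 <= R0 ->
  ((forall m, 0 < m < r0 -> sublevel F phi a0 m) /\
   (forall m, R0 < m -> suplevel F phi kap b0 m)) \/
  ((forall m, 0 < m < r0 -> suplevel F phi kap b0 m) /\
   (forall m, R0 < m -> sublevel F phi a0 m)) ->
  exists U, is_pos_solution phi c d h f lam U /\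
    (forall B, (forall m, B < m -> bad m) -> norm_inf U <= B) /\
    (forall r, (forall m, 0 < m < r -> bad m) ->
      harnack_const g cmin cmax dmin dmax (1 / 4) * r <= norm_inf U).
Proof.
intros Hr0 HR0 Hcase.
(* Shifting the grids by [n0] makes every step at most [e], so that the estimates hold for all n and
   not just eventually. *)
destruct (archimed_cor1 e (mp_e Hmp)) as [n0 [Hn0 Hn0p]].
set (M := fun n => (n + n0 + 1)%nat).
assert (HM : forall n, (n < M n)%nat) by (intros n; unfold M; lia).
assert (HM0 : forall n, (0 < M n)%nat) by (intros n; unfold M; lia).
assert (HMe : forall n, / INR (2 * M n) <= e).
{ intros n. apply Rle_trans with (/ INR n0); [|lra].
  apply Rinv_le_contravar; [apply lt_0_INR; exact Hn0p|]. apply le_INR. unfold M. lia. }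
assert (HS : forall n, exists p, 0 < p /\
  shoot_u (Phi:=Phi) (F:=F) (H:=H) (c:=c) (d:=d) (M n) p (2 * M n) = 0).
{ intros n. apply (shooting HP (M n) (HM0 n) r0 R0 Hr0 HR0).
  destruct Hcase as [[Hs Hl]|[Hs Hl]]; [left|right]; intros p s Hp Hmax;
    assert (Hpos := shoot_max_pos HP (M n) (HM0 n) p Hp s Hmax);
    split; intros HN; apply Rnot_lt_le; intro Hlt.
  - apply (not_sublevel HP (M n) (HM0 n) p Hp s Hmax a0 Ha0 Ha HN). apply Hs. lra.
  - apply (not_suplevel HP Hmp (M n) (HM0 n) p Hp s Hmax (HMe n) HN). apply Hl. lra.
  - apply (not_sublevel HP (M n) (HM0 n) p Hp s Hmax a0 Ha0 Ha HN). apply Hl. lra.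
  - apply (not_suplevel HP Hmp (M n) (HM0 n) p Hp s Hmax (HMe n) HN). apply Hs. lra. }
assert (Hb1 : forall m, 0 < m < r0 -> bad m).
{ intros m Hm. unfold bad. destruct Hcase as [[Hs _]|[Hs _]]; [left|right]; apply Hs, Hm. }
assert (Hb2 : forall m, R0 < m -> bad m).
{ intros m Hm. unfold bad. destruct Hcase as [[_ Hl]|[_ Hl]]; [right|left]; apply Hl, Hm. }
destruct free_ultrafilter_exists as [W HW].
set (p := fun n => proj1_sig (constructive_indefinite_description _ (HS n))).
assert (Hp : forall n, 0 < p n).
{ intros n. unfold p. destruct (constructive_indefinite_description _ (HS n)) as [q [Hq1 Hq2]].
  exact Hq1. }
assert (HuN : forall n, shoot_u (Phi:=Phi) (F:=F) (H:=H) (c:=c) (d:=d) (M n) (p n) (2 * M n) = 0).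
{ intros n. unfold p. destruct (constructive_indefinite_description _ (HS n)) as [q [Hq1 Hq2]].
  exact Hq2. }
exists (lim_u (W:=W) (Phi:=Phi) (F:=F) (H:=H) (c:=c) (d:=d) M p). split; [|split].
- apply (U_solution HW M HM HMe p Hp HuN r0 R0 Hr0 Hb1 Hb2).
- apply (U_norm_le HW M HM HMe p Hp HuN).
- apply (U_norm_ge HW M HM HMe p Hp HuN R0 Hb2).
Qed.
End Existence.

(** * The primitives of the weight *)

(** Based at 1/2 because the functions to be integrated may fail to be integrable up to 0 and 1. *)
Definition prim (q : R -> R) (t : R) : R := Coquelicot.RInt.RInt q (1 / 2) t.

Section Primitive.
Variable q : R -> R.
Hypothesis Hq : forall t, 0 < t < 1 -> continuity_pt q t.

Lemma ex_RInt_inside a b : 0 < a < 1 -> 0 < b < 1 -> Coquelicot.RInt.ex_RInt q a b.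
Proof.
intros Ha Hb. apply (Coquelicot.RInt.ex_RInt_continuous (V := R_CompleteNormedModule) q). intros z Hz.
apply continuity_pt_filterlim. apply Hq.
assert (0 < Rmin a b) by (apply Rmin_glb_lt; lra).
assert (Rmax a b < 1) by (apply Rmax_lub_lt; lra). lra.
Qed.

Lemma prim_der t : 0 < t < 1 -> derivable_pt_lim (prim q) t (q t).
Proof.
intros Ht. apply Coquelicot.Derive.is_derive_Reals.
apply (Coquelicot.RInt_analysis.is_derive_RInt (V := R_NormedModule) q (prim q) (1 / 2) t).
- assert (Hp : 0 < Rmin t (1 - t)) by (apply Rmin_glb_lt; lra).
  exists (mkposreal _ Hp). intros y Hy.
  apply (Coquelicot.RInt.RInt_correct (V := R_CompleteNormedModule) q). apply ex_RInt_inside; [lra|].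
  assert (Hy' : Rabs (y - t) < Rmin t (1 - t)) by exact Hy.
  assert (Rmin t (1 - t) <= t) by apply Rmin_l.
  assert (Rmin t (1 - t) <= 1 - t) by apply Rmin_r.
  apply Rabs_def2 in Hy'. lra.
- apply continuity_pt_filterlim, Hq, Ht.
Qed.

Lemma prim_half : prim q (1 / 2) = 0.
Proof. apply (Coquelicot.RInt.RInt_point (V := R_CompleteNormedModule) (1 / 2) q). Qed.

Lemma prim_MVT a b : 0 < a -> a < b -> b < 1 ->
  exists x, prim q b - prim q a = q x * (b - a) /\ a < x < b.
Proof.
intros Ha Hab Hb. apply MVT_cor2; [exact Hab|]. intros x Hx. apply prim_der. lra.
Qed.

Lemma prim_mono a b : (forall t, 0 < t < 1 -> 0 <= q t) -> 0 < a -> a <= b -> b < 1 ->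
  prim q a <= prim q b.
Proof.
intros Hpos Ha [Hab| ->] Hb; [|lra].
destruct (prim_MVT a b Ha Hab Hb) as [x [E Hx]]. assert (H := Hpos x ltac:(lra)). nra.
Qed.

(** The integral of the statement is a value chosen by [epsilon]; since every Riemann integral of
    [k] agrees with the Coquelicot one, the choice is harmless. Agreement of [k] and [q] is asked
    only between the bounds, where inner integrals can be rewritten. *)
Lemma Defs_RInt_eq k a b : 0 < a < 1 -> 0 < b < 1 ->
  (forall t, Rmin a b < t < Rmax a b -> q t = k t) ->
  RInt k a b = Coquelicot.RInt.RInt q a b.
Proof.
intros Ha Hb Hk. unfold RInt.
assert (Hex : Coquelicot.RInt.ex_RInt k a b).
{ apply Coquelicot.RInt.ex_RInt_ext with (f := q); [exact Hk|]. apply ex_RInt_inside; auto. }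
assert (E : exists I, is_RInt k a b I).
{ exists (RiemannInt (Coquelicot.RInt.ex_RInt_Reals_0 k a b Hex)). eexists. reflexivity. }
destruct (epsilon_spec (inhabits 0) _ E) as [pr Hpr].
transitivity (RiemannInt pr); [symmetry; exact Hpr|].
rewrite <- (Coquelicot.RInt.RInt_Reals k a b pr).
symmetry. apply Coquelicot.RInt.RInt_ext. exact Hk.
Qed.

Lemma prim_RInt a b : 0 < a < 1 -> 0 < b < 1 ->
  Coquelicot.RInt.RInt q a b = prim q b - prim q a.
Proof.
intros Ha Hb.
assert (E : prim q a + Coquelicot.RInt.RInt q a b = prim q b).
{ exact (Coquelicot.RInt.RInt_Chasles (V := R_CompleteNormedModule) q (1 / 2) a b
    (ex_RInt_inside (1 / 2) a ltac:(lra) Ha) (ex_RInt_inside a b Ha Hb)). }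
assert (K : forall r s t : R, r + s = t -> s = t - r) by (intros; lra).
exact (K _ _ _ E).
Qed.
End Primitive.

Section Integrability.
Context {h g : R -> R}.
Hypothesis Hh : cont_on (fun t => 0 < t < 1) h.
Hypothesis Hh0 : forall t, 0 < t < 1 -> 0 <= h t.
Hypothesis Hg0 : forall y, 0 <= y -> 0 <= g y.
Hypothesis Hgm : forall x y, 0 <= x -> x <= y -> g x <= g y.
Hypothesis Hgc : cont_on nonneg_set g.
Hypothesis Hint : h_integrability h g.

Let H := prim h.
(** One integrand for both halves of the condition: |H t| is the integral of [h] between t and 1/2
    on either side. *)
Let gH t := g (Rabs (H t)).

Let Hc t (Ht : 0 < t < 1) : continuity_pt h t := cont_on_open_pt h t Hh Ht.

Lemma H_mono x y : 0 < x -> x <= y -> y < 1 -> H x <= H y.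
Proof. apply prim_mono; [exact Hc|exact Hh0]. Qed.

Lemma H_left x : 0 < x <= 1 / 2 -> Rabs (H x) = - H x.
Proof.
intros Hx. apply Rabs_left1. rewrite <- (prim_half h) at 1. apply H_mono; lra.
Qed.

Lemma H_right x : 1 / 2 <= x < 1 -> Rabs (H x) = H x.
Proof.
intros Hx. apply Rabs_right, Rle_ge. rewrite <- (prim_half h) at 1. apply H_mono; lra.
Qed.

Lemma gH_cont t : 0 < t < 1 -> continuity_pt gH t.
Proof.
intros Ht. apply cont_pt_of_dist. intros eps Heps.
destruct (Hgc (Rabs (H t)) (Rabs_pos _) eps Heps) as [d1 [Hd1 H1]].
assert (HcH : continuity_pt H t).
{ apply derivable_continuous_pt. eexists. apply prim_der; [exact Hc|exact Ht]. }
destruct (cont_pt_dist H t HcH d1 Hd1) as [d2 [Hd2 H2]].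
exists d2. split; [exact Hd2|]. intros y Hy. apply H1; [apply Rabs_pos|].
eapply Rle_lt_trans; [apply Rabs_triang_inv2|]. apply H2, Hy.
Qed.

Lemma gH_step_left a b : 0 < a -> a < b -> b <= 1 / 2 ->
  (b - a) * g (- H b) <= prim gH b - prim gH a.
Proof.
intros Ha Hab Hb. destruct (prim_MVT gH gH_cont a b Ha Hab ltac:(lra)) as [x [E Hx]].
rewrite E. unfold gH. rewrite H_left by lra.
assert (H1 := H_mono x b ltac:(lra) ltac:(lra) ltac:(lra)).
assert (H2 := H_left b ltac:(lra)). assert (H3 := Rabs_pos (H b)).
assert (g (- H b) <= g (- H x)) by (apply Hgm; lra). nra.
Qed.

Lemma gH_step_right a b : 1 / 2 <= a -> a < b -> b < 1 ->
  (b - a) * g (H a) <= prim gH b - prim gH a.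
Proof.
intros Ha Hab Hb. destruct (prim_MVT gH gH_cont a b ltac:(lra) Hab ltac:(lra)) as [x [E Hx]].
rewrite E. unfold gH. rewrite H_right by lra.
assert (H1 := H_mono a x ltac:(lra) ltac:(lra) ltac:(lra)).
assert (H2 := H_right a ltac:(lra)). assert (H3 := Rabs_pos (H a)).
assert (g (H a) <= g (H x)) by (apply Hgm; lra). nra.
Qed.

Lemma G_exists : exists G : R -> R,
  (forall a b, 0 <= a -> a < b -> b <= 1 / 2 -> (b - a) * g (- H b) <= G b - G a) /\
  (forall a b, 1 / 2 <= a -> a < b -> b <= 1 -> (b - a) * g (H a) <= G b - G a) /\
  (forall eps, eps > 0 -> exists del, del > 0 /\
    forall x, 0 < x < del -> Rabs (G x - G 0) < eps) /\
  (forall eps, eps > 0 -> exists del, del > 0 /\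
    forall x, 0 < x < del -> Rabs (G (1 - x) - G 1) < eps).
Proof.
destruct Hint as [[L0 HL0] [L1 HL1]].
assert (E0 : forall x, 0 < x < 1 / 2 ->
  RInt (fun s => g (RInt h s (1 / 2))) x (1 / 2) = - prim gH x).
{ intros x Hx. rewrite (Defs_RInt_eq gH gH_cont _ x (1 / 2)); [|lra|lra|].
  - rewrite (prim_RInt gH gH_cont) by lra. rewrite prim_half. ring.
  - intros t Ht. rewrite Rmin_left, Rmax_right in Ht by lra.
    unfold gH. rewrite H_left by lra. f_equal.
    rewrite (Defs_RInt_eq h Hc h t (1 / 2)) by (auto; lra).
    rewrite (prim_RInt h Hc) by lra. rewrite prim_half. unfold H. ring. }
assert (E1 : forall x, 0 < x < 1 / 2 ->
  RInt (fun s => g (RInt h (1 / 2) s)) (1 / 2) (1 - x) = prim gH (1 - x)).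
{ intros x Hx. rewrite (Defs_RInt_eq gH gH_cont _ (1 / 2) (1 - x)); [|lra|lra|].
  - reflexivity.
  - intros t Ht. rewrite Rmin_left, Rmax_right in Ht by lra.
    unfold gH. rewrite H_right by lra. f_equal.
    rewrite (Defs_RInt_eq h Hc h (1 / 2) t) by (auto; lra). reflexivity. }
(* The end values are the two improper integrals; the left one gets a minus sign since [prim] starts
   at 1/2. *)
exists (fun t => if Rle_dec t 0 then - L0 else if Rle_dec 1 t then L1 else prim gH t).
set (G := fun t => if Rle_dec t 0 then - L0 else if Rle_dec 1 t then L1 else prim gH t).
assert (Gi : forall t, 0 < t < 1 -> G t = prim gH t).
{ intros t Ht. unfold G. destruct (Rle_dec t 0); [lra|]. destruct (Rle_dec 1 t); [lra|reflexivity]. }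
assert (G0 : G 0 = - L0) by (unfold G; destruct (Rle_dec 0 0); [reflexivity|lra]).
assert (G1 : G 1 = L1).
{ unfold G. destruct (Rle_dec 1 0); [lra|]. destruct (Rle_dec 1 1); [reflexivity|lra]. }
assert (C0 : forall eps, eps > 0 -> exists del, del > 0 /\
    forall x, 0 < x < del -> Rabs (G x - G 0) < eps).
{ intros eps Heps. destruct (HL0 eps Heps) as [del [Hdel H1]].
  exists (Rmin del (1 / 2)). split; [apply Rmin_glb_lt; lra|]. intros x Hx.
  assert (Hm1 : Rmin del (1 / 2) <= del) by apply Rmin_l.
  assert (Hm2 : Rmin del (1 / 2) <= 1 / 2) by apply Rmin_r.
  assert (H2 := H1 x ltac:(lra)). rewrite E0 in H2 by lra.
  rewrite Gi, G0 by lra. rewrite <- Rabs_Ropp.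
  replace (- (prim gH x - - L0)) with (- prim gH x - L0) by ring. exact H2. }
assert (C1 : forall eps, eps > 0 -> exists del, del > 0 /\
    forall x, 0 < x < del -> Rabs (G (1 - x) - G 1) < eps).
{ intros eps Heps. destruct (HL1 eps Heps) as [del [Hdel H1]].
  exists (Rmin del (1 / 2)). split; [apply Rmin_glb_lt; lra|]. intros x Hx.
  assert (Hm1 : Rmin del (1 / 2) <= del) by apply Rmin_l.
  assert (Hm2 : Rmin del (1 / 2) <= 1 / 2) by apply Rmin_r.
  assert (H2 := H1 x ltac:(lra)). rewrite E1 in H2 by lra.
  rewrite Gi, G1 by lra. exact H2. }
split; [|split; [|split; [exact C0|exact C1]]].
- intros a b Ha Hab Hb. change ((b - a) * g (- H b) <= G b - G a).
  destruct Ha as [Ha|<-].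
  { rewrite !Gi by lra. apply gH_step_left; lra. }
  apply Rnot_lt_le. intro Hlt.
  set (eps := (b - 0) * g (- H b) - (G b - G 0)) in *.
  assert (Heps : 0 < eps) by (unfold eps; lra).
  assert (Hgb : 0 <= g (- H b)).
  { apply Hg0. rewrite <- H_left by lra. apply Rabs_pos. }
  destruct (C0 (eps / 2) ltac:(lra)) as [del [Hdel H1]].
  (* The step inequality is known from x to b. This x is so close to 0 that omitting (0, x) loses at
     most eps / 4 on the left side, and replacing G 0 by G x less than eps / 2 on the right, which
     together do not reach the supposed deficit eps. *)
  set (x := Rmin (Rmin (del / 2) (b / 2)) (eps / (4 * (g (- H b) + 1)))).
  assert (Hq : 0 < eps / (4 * (g (- H b) + 1))) by (apply Rdiv_lt_0_compat; lra).
  assert (Hx : 0 < x) by (repeat apply Rmin_glb_lt; lra).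
  assert (Hx1 : x <= del / 2) by (eapply Rle_trans; [apply Rmin_l|apply Rmin_l]).
  assert (Hx2 : x <= b / 2) by (eapply Rle_trans; [apply Rmin_l|apply Rmin_r]).
  assert (Hx3 : (4 * (g (- H b) + 1)) * x <= eps).
  { assert (Hx3 : x <= eps / (4 * (g (- H b) + 1))) by apply Rmin_r.
    apply Rmult_le_compat_l with (r := 4 * (g (- H b) + 1)) in Hx3; [|lra].
    replace (4 * (g (- H b) + 1) * (eps / (4 * (g (- H b) + 1)))) with eps in Hx3
      by (field; lra). exact Hx3. }
  assert (H2 := H1 x ltac:(lra)). apply Rabs_def2 in H2.
  assert (H3 := gH_step_left x b Hx ltac:(lra) Hb). rewrite <- !Gi in H3 by lra.
  unfold eps in *. nra.
- intros a b Ha Hab Hb. change ((b - a) * g (H a) <= G b - G a).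
  destruct Hb as [Hb| ->].
  { rewrite !Gi by lra. apply gH_step_right; lra. }
  apply Rnot_lt_le. intro Hlt.
  set (eps := (1 - a) * g (H a) - (G 1 - G a)) in *.
  assert (Heps : 0 < eps) by (unfold eps; lra).
  assert (Hgb : 0 <= g (H a)).
  { apply Hg0. rewrite <- H_right by lra. apply Rabs_pos. }
  destruct (C1 (eps / 2) ltac:(lra)) as [del [Hdel H1]].
  set (x := Rmin (Rmin (del / 2) ((1 - a) / 2)) (eps / (4 * (g (H a) + 1)))).
  assert (Hq : 0 < eps / (4 * (g (H a) + 1))) by (apply Rdiv_lt_0_compat; lra).
  assert (Hx : 0 < x) by (repeat apply Rmin_glb_lt; lra).
  assert (Hx1 : x <= del / 2) by (eapply Rle_trans; [apply Rmin_l|apply Rmin_l]).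
  assert (Hx2 : x <= (1 - a) / 2) by (eapply Rle_trans; [apply Rmin_l|apply Rmin_r]).
  assert (Hx3 : (4 * (g (H a) + 1)) * x <= eps).
  { assert (Hx3 : x <= eps / (4 * (g (H a) + 1))) by apply Rmin_r.
    apply Rmult_le_compat_l with (r := 4 * (g (H a) + 1)) in Hx3; [|lra].
    replace (4 * (g (H a) + 1) * (eps / (4 * (g (H a) + 1)))) with eps in Hx3
      by (field; lra). exact Hx3. }
  assert (H2 := H1 x ltac:(lra)). apply Rabs_def2 in H2.
  assert (H3 := gH_step_right a (1 - x) Ha ltac:(lra) ltac:(lra)). rewrite <- !Gi in H3 by lra.
  unfold eps in *. nra.
Qed.

Lemma mass_points_exist : (exists t, 0 < t < 1 /\ h t <> 0) ->
  exists a x b x1 x2 b1 e del mu, mass_points H a x b x1 x2 b1 e del mu.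
Proof.
intros [t [Ht Hne]].
assert (Hpos : 0 < h t) by (destruct (Hh0 t Ht) as [Hp|Hz]; [exact Hp|congruence]).
destruct (cont_pt_dist h t (Hc t Ht) (h t) Hpos) as [eta [Heta H1]].
(* All points will be multiples of [e] away from t, at most [4 * e]. The divisor 8 keeps them where
   [h] is positive and leaves room for [del = e] at both ends. *)
set (e := Rmin (eta / 8) (Rmin (t / 8) ((1 - t) / 8))).
assert (He : 0 < e) by (repeat apply Rmin_glb_lt; lra).
assert (He1 : e <= eta / 8) by apply Rmin_l.
assert (He2 : e <= t / 8) by (eapply Rle_trans; [apply Rmin_r|apply Rmin_l]).
assert (He3 : e <= (1 - t) / 8) by (eapply Rle_trans; [apply Rmin_r|apply Rmin_r]).
assert (St : forall a b, t - 4 * e <= a -> a < b -> b <= t + 4 * e -> 0 < H b - H a).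
{ intros a b Ha Hab Hb.
  destruct (prim_MVT h Hc a b ltac:(lra) Hab ltac:(lra)) as [x [E Hx]].
  unfold H. rewrite E. apply Rmult_lt_0_compat; [|lra].
  assert (H2 := H1 x ltac:(apply Rabs_def1; lra)). apply Rabs_def2 in H2. lra. }
assert (S1 := St (t - 4 * e) (t - 3 * e) ltac:(lra) ltac:(lra) ltac:(lra)).
assert (S2 := St (t + e) (t + 2 * e) ltac:(lra) ltac:(lra) ltac:(lra)).
exists (t - 4 * e), t, (t + 4 * e), (t - 3 * e), (t + e), (t + 2 * e), e, e,
  (Rmin (H (t - 3 * e) - H (t - 4 * e)) (H (t + 2 * e) - H (t + e))).
split; try lra.
- apply Rmin_glb_lt; lra.
- apply Rmin_l.
- apply Rmin_r.
Qed.
End Integrability.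

Lemma positive_bounds (q : R -> R) :
  cont_on (fun t => 0 <= t <= 1) q -> (forall t, 0 <= t <= 1 -> q t > 0) ->
  exists m M, 0 < m /\ forall t, 0 <= t <= 1 -> m <= q t <= M.
Proof.
(* Composing with the projection onto [0,1] gives a function continuous on the line, as the extreme
   value theorems require at the end points. *)
intros Hq Hpos. set (cl := fun t => Rmax 0 (Rmin 1 t)).
assert (Hcl : forall t, 0 <= cl t <= 1).
{ intros t. unfold cl. split; [apply Rmax_l|]. apply Rmax_lub; [lra|apply Rmin_l]. }
assert (Hid : forall t, 0 <= t <= 1 -> cl t = t).
{ intros t Ht. unfold cl. rewrite Rmin_right, Rmax_right; lra. }
assert (Hd : forall s t, Rabs (cl s - cl t) <= Rabs (s - t)).
{ intros s t. unfold cl, Rmax, Rmin.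
  repeat destruct (Rle_dec _ _); unfold Rabs; repeat destruct (Rcase_abs _); lra. }
assert (Hc : forall t, continuity_pt (fun t => q (cl t)) t).
{ intros t. apply cont_pt_of_dist. intros eps Heps.
  destruct (Hq (cl t) (Hcl t) eps Heps) as [del [Hdel H1]].
  exists del. split; [exact Hdel|]. intros y Hy. apply H1; [apply Hcl|].
  eapply Rle_lt_trans; [apply Hd|exact Hy]. }
destruct (continuity_ab_maj (fun t => q (cl t)) 0 1 ltac:(lra) (fun t _ => Hc t)) as [M [HM _]].
destruct (continuity_ab_min (fun t => q (cl t)) 0 1 ltac:(lra) (fun t _ => Hc t)) as [m [Hm _]].
exists (q (cl m)), (q (cl M)). split; [apply Hpos, Hcl|].
intros t Ht. assert (H1 := Hm t Ht). assert (H2 := HM t Ht). simpl in H1, H2.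
rewrite (Hid t Ht) in H1, H2. lra.
Qed.

(** * Thresholds for the norm *)

Lemma cont_nonneg_extend (f : R -> R) : cont_on nonneg_set f -> continuity (fun s => f (Rmax 0 s)).
Proof.
intros Hf s. apply cont_pt_of_dist. intros eps Heps.
destruct (Hf (Rmax 0 s) (Rmax_l 0 s) eps Heps) as [del [Hdel H]].
exists del. split; [exact Hdel|]. intros y Hy. apply H; [apply Rmax_l|].
eapply Rle_lt_trans; [|exact Hy].
unfold Rmax. repeat destruct (Rle_dec _ _); unfold Rabs; repeat destruct (Rcase_abs _); lra.
Qed.

Section Thresholds.
Context {f phi : R -> R}.
Hypothesis Hf : cont_on nonneg_set f.
Hypothesis Hfpos : forall s, 0 < s -> f s > 0.
Hypothesis Hphi : forall x y, x < y -> phi x < phi y.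
Hypothesis Hphi0 : phi 0 = 0.

Lemma phi_pos s : 0 < s -> 0 < phi s.
Proof. intros Hs. rewrite <- Hphi0. apply Hphi, Hs. Qed.

Lemma phi_mono x y : x <= y -> phi x <= phi y.
Proof. intros [H| ->]; [left; apply Hphi, H|lra]. Qed.

Lemma ratio_lt s A : 0 < s -> Rabs (f s / phi s) < A -> f s <= A * phi s.
Proof.
intros Hs H. assert (Hp := phi_pos s Hs). apply Rabs_def2 in H.
assert (E : f s = f s / phi s * phi s) by (field; lra). rewrite E at 1.
apply Rmult_le_compat_r; lra.
Qed.

Lemma ratio_gt s A : 0 < s -> f s / phi s > A -> A * phi s <= f s.
Proof.
intros Hs H. assert (Hp := phi_pos s Hs).
assert (E : f s = f s / phi s * phi s) by (field; lra). rewrite E.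
apply Rmult_le_compat_r; lra.
Qed.

Lemma f_max K : exists B, 0 < B /\ forall s, 0 <= s <= K -> f s <= B.
Proof.
destruct (bounded_on_segment (fun s => f (Rmax 0 s)) 0 (Rmax 0 K) (Rmax_l 0 K)
  (cont_nonneg_extend f Hf)) as [B HB].
exists (Rmax 1 B). split; [apply Rlt_le_trans with 1; [lra|apply Rmax_l]|].
intros s Hs. apply Rle_trans with B; [|apply Rmax_r].
assert (H := HB s). rewrite (Rmax_right 0 s) in H by lra. apply H.
split; [lra|]. apply Rle_trans with K; [lra|apply Rmax_r].
Qed.

Lemma f_min k K : 0 < k -> exists b, 0 < b /\ forall s, k <= s <= K -> b <= f s.
Proof.
intros Hk. destruct (Rle_lt_dec k K) as [HkK|HkK].
- destruct (continuity_ab_min (fun s => f (Rmax 0 s)) k K HkK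
    (fun s _ => cont_nonneg_extend f Hf s)) as [m [Hm Hmk]].
  exists (f (Rmax 0 m)). split; [apply Hfpos; rewrite Rmax_right; lra|].
  intros s Hs. assert (H := Hm s Hs). simpl in H. rewrite (Rmax_right 0 s) in H by lra. exact H.
- exists 1. split; [lra|]. intros s Hs. lra.
Qed.

(** Bounds on [f / phi] concern s > 0 only; the value at 0, which is also that of the continuation
    to negative s, follows by continuity. *)
Lemma f0_le B m : 0 < m -> (forall s, 0 < s <= m -> f s <= B) -> f 0 <= B.
Proof.
intros Hm HB. apply Rnot_lt_le. intro Hlt.
destruct (Hf 0 (Rle_refl 0) (f 0 - B) ltac:(lra)) as [del [Hdel H]].
set (s := Rmin m (del / 2)).
assert (Hs : 0 < s) by (apply Rmin_glb_lt; lra).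
assert (Hs1 : s <= m) by apply Rmin_l. assert (Hs2 : s <= del / 2) by apply Rmin_r.
assert (H1 := H s ltac:(unfold nonneg_set; lra)).
rewrite Rminus_0_r, (Rabs_right s) in H1 by lra. specialize (H1 ltac:(lra)).
apply Rabs_def2 in H1. assert (H2 := HB s ltac:(lra)). lra.
Qed.

Lemma sublevel_of lam a0 m : 0 < lam -> 0 < m ->
  (forall s, 0 < s <= m -> f s <= a0 / lam * phi m) ->
  sublevel (fun s => lam * f (Rmax 0 s)) phi a0 m.
Proof.
intros Hlam Hm H s Hs.
assert (H1 : f (Rmax 0 s) <= a0 / lam * phi m).
{ destruct (Rle_lt_dec s 0) as [Hs0|Hs0].
  - rewrite Rmax_left by exact Hs0. apply (f0_le _ m Hm H).
  - rewrite Rmax_right by lra. apply H. lra. }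
apply Rmult_le_compat_l with (r := lam) in H1; [|lra].
replace (lam * (a0 / lam * phi m)) with (a0 * phi m) in H1 by (field; lra). exact H1.
Qed.

(** For s >= kap m one has phi(s) >= phi(kap m) >= phi(m) psi1(kap), so passing from phi(s) to
    phi(m) costs the factor psi1(kap). *)
Lemma suplevel_of psi1 lam kap b0 m : 0 < lam -> 0 < kap -> 0 < m ->
  (forall x y, 0 <= x -> 0 <= y -> phi x * psi1 y <= phi (x * y)) -> 0 < psi1 kap -> 0 <= b0 ->
  (forall s, kap * m <= s <= m -> b0 / (lam * psi1 kap) * phi s <= f s) ->
  suplevel (fun s => lam * f (Rmax 0 s)) phi kap b0 m.
Proof.
intros Hlam Hkap Hm HA Hpsi Hb0 H s Hs.
assert (Hkm : 0 < kap * m) by (apply Rmult_lt_0_compat; lra).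
rewrite Rmax_right by lra.
assert (H1 := H s Hs). assert (H2 := HA m kap ltac:(lra) ltac:(lra)).
rewrite (Rmult_comm m) in H2. assert (H3 := phi_mono _ _ (proj1 Hs)).
assert (H4 : 0 <= b0 / psi1 kap).
{ apply Rmult_le_pos; [exact Hb0|left; apply Rinv_0_lt_compat; exact Hpsi]. }
apply Rmult_le_compat_l with (r := lam) in H1; [|lra].
replace (lam * (b0 / (lam * psi1 kap) * phi s)) with (b0 / psi1 kap * phi s) in H1 by (field; lra).
apply Rle_trans with (2 := H1).
replace (b0 * phi m) with (b0 / psi1 kap * (phi m * psi1 kap)) by (field; lra).
apply Rmult_le_compat_l; lra.
Qed.

(** The constant does not involve [lam]: once lam C <= a0, all m up to [K] are excluded as maxima.
    The next three lemmas do the same for the other limits of the norm. *)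
Lemma f_le_phi_bounded K : ratio_0_to_0 f phi -> exists C, 0 < C /\
  forall s, 0 < s <= K -> f s <= C * phi s.
Proof.
intros H0. destruct (H0 1 ltac:(lra)) as [del [Hdel H1]].
destruct (f_max K) as [B [HB0 HB]].
assert (Hp := phi_pos (del / 2) ltac:(lra)).
assert (Hq : 0 < B / phi (del / 2)) by (apply Rdiv_lt_0_compat; lra).
exists (1 + B / phi (del / 2)). split; [lra|]. intros s Hs.
assert (Hps := phi_pos s ltac:(lra)).
destruct (Rlt_le_dec s del) as [Hsd|Hsd].
- assert (H2 := ratio_lt s 1 ltac:(lra) (H1 s ltac:(lra))). nra.
- assert (H2 := HB s ltac:(lra)). assert (H3 := phi_mono (del / 2) s ltac:(lra)).
  assert (E : B / phi (del / 2) * phi (del / 2) = B) by (field; lra). nra.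
Qed.

Lemma f_ge_phi_unbounded k : 0 < k -> ratio_inf_to_inf f phi -> exists C, 0 < C /\
  forall s, k <= s -> C * phi s <= f s.
Proof.
intros Hk Hi. destruct (Hi 1) as [K HK].
set (K' := Rmax k K + 1).
assert (HK1 : k <= Rmax k K) by apply Rmax_l. assert (HK2 : K <= Rmax k K) by apply Rmax_r.
destruct (f_min k K' Hk) as [b [Hb0 Hb]].
assert (Hp := phi_pos K' ltac:(unfold K'; lra)).
assert (Hq : 0 < b / phi K') by (apply Rdiv_lt_0_compat; lra).
assert (E : b / phi K' * phi K' = b) by (field; lra).
exists (Rmin 1 (b / phi K')). split; [apply Rmin_glb_lt; lra|]. intros s Hs.
assert (Hps := phi_pos s ltac:(lra)).
assert (Hm1 : Rmin 1 (b / phi K') <= 1) by apply Rmin_l.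
assert (Hm2 : Rmin 1 (b / phi K') <= b / phi K') by apply Rmin_r.
destruct (Rle_lt_dec s K') as [HsK|HsK].
- assert (H1 := Hb s ltac:(lra)). assert (H2 := phi_mono s K' HsK). nra.
- assert (H1 := ratio_gt s 1 ltac:(lra) (HK s ltac:(unfold K' in HsK; lra))). nra.
Qed.

(** The comparison is with phi(m) and not phi(s), since [f / phi] may be unbounded near 0 when this
    is applied; on a bounded range f <= B, and phi(m) >= phi(k). *)
Lemma f_le_phi_unbounded k : 0 < k -> ratio_inf_to_0 f phi -> exists C, 0 < C /\
  forall m s, k <= m -> 0 < s <= m -> f s <= C * phi m.
Proof.
intros Hk Hi. destruct (Hi 1 ltac:(lra)) as [K HK].
destruct (f_max K) as [B [HB0 HB]].
assert (Hp := phi_pos k Hk).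
assert (Hq : 0 < B / phi k) by (apply Rdiv_lt_0_compat; lra).
assert (E : B / phi k * phi k = B) by (field; lra).
exists (1 + B / phi k). split; [lra|]. intros m s Hm Hs.
assert (H1 := phi_mono k m Hm). assert (H2 := phi_mono s m ltac:(lra)).
destruct (Rle_lt_dec s K) as [HsK|HsK].
- assert (H3 := HB s ltac:(lra)). nra.
- assert (H3 := ratio_lt s 1 ltac:(lra) (HK s HsK)). nra.
Qed.

Lemma f_ge_phi_bounded K : ratio_0_to_inf f phi -> exists C, 0 < C /\
  forall s, 0 < s <= K -> C * phi s <= f s.
Proof.
intros H0. destruct (H0 1) as [del [Hdel H1]].
destruct (f_min del K Hdel) as [b [Hb0 Hb]].
set (K' := Rmax 1 K).
assert (HK1 : 1 <= K') by apply Rmax_l. assert (HK2 : K <= K') by apply Rmax_r.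
assert (Hp := phi_pos K' ltac:(lra)).
assert (Hq : 0 < b / phi K') by (apply Rdiv_lt_0_compat; lra).
assert (E : b / phi K' * phi K' = b) by (field; lra).
exists (Rmin 1 (b / phi K')). split; [apply Rmin_glb_lt; lra|]. intros s Hs.
assert (Hps := phi_pos s ltac:(lra)).
assert (Hm1 : Rmin 1 (b / phi K') <= 1) by apply Rmin_l.
assert (Hm2 : Rmin 1 (b / phi K') <= b / phi K') by apply Rmin_r.
destruct (Rlt_le_dec s del) as [Hsd|Hsd].
- assert (H2 := ratio_gt s 1 ltac:(lra) (H1 s ltac:(lra))). nra.
- assert (H2 := Hb s ltac:(lra)). assert (H3 := phi_mono s K' ltac:(lra)). nra.
Qed.

(** Where s is bounded the ratio gives nothing, but there [f] is bounded and phi(m) eventually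
    exceeds any bound. *)
Lemma f_le_phi_infinity A : 0 < A ->
  (forall B, exists m, 0 < m /\ B <= phi m) -> ratio_inf_to_0 f phi ->
  exists K, 0 <= K /\ forall m s, K < m -> 0 < s <= m -> f s <= A * phi m.
Proof.
intros HA Hunb Hi. destruct (Hi A HA) as [K HK].
destruct (f_max K) as [B [HB0 HB]].
destruct (Hunb (B / A)) as [m0 [Hm0 Hphim0]].
exists m0. split; [lra|]. intros m s Hm Hs.
assert (H1 := phi_mono m0 m ltac:(lra)).
assert (H2 := phi_mono s m ltac:(lra)).
destruct (Rle_lt_dec s K) as [HsK|HsK].
- assert (H3 := HB s ltac:(lra)).
  assert (E : A * (B / A) = B) by (field; lra).
  apply Rmult_le_compat_l with (r := A) in Hphim0; [|lra].
  assert (A * phi m0 <= A * phi m) by (apply Rmult_le_compat_l; lra). lra.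
- assert (H3 := ratio_lt s A ltac:(lra) (HK s HsK)).
  assert (A * phi s <= A * phi m) by (apply Rmult_le_compat_l; lra). lra.
Qed.
End Thresholds.

(** One solution per [lam] is chosen with all its norm bounds attached, so a limit of the norm
    reduces to excluding a range of maxima uniformly in [lam]. Each part of the theorem uses two of
    the four implications. *)
Lemma family_of_solutions (P : R -> (R -> R) -> Prop) (bad : R -> R -> Prop) (kap : R) :
  0 < kap ->
  (forall lam, lam > 0 -> exists u, P lam u /\
     (forall B, (forall m, B < m -> bad lam m) -> norm_inf u <= B) /\
     (forall r, (forall m, 0 < m < r -> bad lam m) -> kap * r <= norm_inf u)) ->
  exists U : R -> R -> R, (forall lam, lam > 0 -> P lam (U lam)) /\
    ((forall M, 0 < M -> exists del, del > 0 /\ forall lam m, 0 < lam < del -> 0 < m < M -> bad lam m) ->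
      tends_inf_at_0plus (fun lam => norm_inf (U lam))) /\
    ((forall M, 0 < M -> exists L, 0 <= L /\ forall lam m, L < lam -> 0 < m < M -> bad lam m) ->
      tends_inf_at_inf (fun lam => norm_inf (U lam))) /\
    ((forall eps, 0 < eps -> exists del, del > 0 /\ forall lam m, 0 < lam < del -> eps < m -> bad lam m) ->
      tends_0_at_0plus (fun lam => norm_inf (U lam))) /\
    ((forall eps, 0 < eps -> exists L, 0 <= L /\ forall lam m, L < lam -> eps < m -> bad lam m) ->
      tends_0_at_inf (fun lam => norm_inf (U lam))).
Proof.
intros Hkap Hex.
set (Q := fun lam u => P lam u /\
     (forall B, (forall m, B < m -> bad lam m) -> norm_inf u <= B) /\
     (forall r, (forall m, 0 < m < r -> bad lam m) -> kap * r <= norm_inf u)).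
set (U := fun lam => epsilon (inhabits (fun _ : R => 0)) (Q lam)).
assert (HU : forall lam, lam > 0 -> Q lam (U lam)).
{ intros lam Hlam. apply epsilon_spec, Hex, Hlam. }
(* The lower bound with r = 0, where the condition on m is vacuous. *)
assert (Hnn : forall lam, lam > 0 -> 0 <= norm_inf (U lam)).
{ intros lam Hlam. rewrite <- (Rmult_0_r kap). apply (HU lam Hlam). intros m Hm. lra. }
assert (Hbig : forall M lam, lam > 0 -> (forall m, 0 < m < (Rabs M + 1) / kap -> bad lam m) ->
  norm_inf (U lam) > M).
{ intros M lam Hlam Hb.
  assert (H1 := proj2 (proj2 (HU lam Hlam)) ((Rabs M + 1) / kap) Hb).
  replace (kap * ((Rabs M + 1) / kap)) with (Rabs M + 1) in H1 by (field; lra).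
  assert (H2 := Rle_abs M). lra. }
assert (Hsmall : forall eps lam, eps > 0 -> lam > 0 -> (forall m, eps / 2 < m -> bad lam m) ->
  Rabs (norm_inf (U lam)) < eps).
{ intros eps lam Heps Hlam Hb. assert (H1 := proj1 (proj2 (HU lam Hlam)) (eps / 2) Hb).
  rewrite Rabs_right by (apply Rle_ge, Hnn, Hlam). lra. }
assert (HM : forall M, 0 < (Rabs M + 1) / kap).
{ intros M. apply Rdiv_lt_0_compat; [|exact Hkap]. assert (H := Rabs_pos M). lra. }
exists U. split; [intros lam Hlam; apply (HU lam Hlam)|].
split; [|split; [|split]]; intros Hb.
- intros M. destruct (Hb _ (HM M)) as [del [Hdel H]]. exists del. split; [exact Hdel|].
  intros lam Hlam. apply Hbig; [lra|]. intros m Hm. apply H; auto.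
- intros M. destruct (Hb _ (HM M)) as [L [HL H]]. exists L.
  intros lam Hlam. apply Hbig; [lra|]. intros m Hm. apply H; auto.
- intros eps Heps. destruct (Hb (eps / 2) ltac:(lra)) as [del [Hdel H]].
  exists del. split; [exact Hdel|]. intros lam Hlam. apply Hsmall; [exact Heps|lra|].
  intros m Hm. apply H; auto.
- intros eps Heps. destruct (Hb (eps / 2) ltac:(lra)) as [L [HL H]].
  exists L. intros lam Hlam. apply Hsmall; [exact Heps|lra|].
  intros m Hm. apply H; auto.
Qed.

Theorem theorem3p7
  (phi psi1 psi2 c d f h : R -> R)
  (Hphi_odd : forall x, phi (- x) = - phi x)
  (Hphi : incr_homeo_R phi)
  (HA : condA phi psi1 psi2)
  (Hc : cont_on (fun t => 0 <= t <= 1) c /\ (forall t, 0 <= t <= 1 -> c t > 0))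
  (Hd : cont_on (fun t => 0 <= t <= 1) d /\ (forall t, 0 <= t <= 1 -> d t > 0))
  (Hf : cont_on nonneg_set f /\ (forall s, 0 <= s -> 0 <= f s) /\ (forall s, 0 < s -> f s > 0))
  (Hh : cont_on (fun t => 0 < t < 1) h /\ (forall t, 0 < t < 1 -> 0 <= h t) /\
        (exists t, 0 < t < 1 /\ h t <> 0))
  (Hhint : exists g : R -> R,
       (forall y, 0 <= y -> 0 <= g y) /\
       (forall x, 0 <= x -> g (psi1 x) = x) /\ (forall y, 0 <= y -> psi1 (g y) = y) /\
       h_integrability h g)
  (Hgamma : exists a abar b bbar,
       is_alpha_h h a /\ is_alphabar_h h a abar /\
       is_beta_h h b /\ is_betabar_h h b bbar /\
       0 <= a /\ a < (3 * a + abar) / 4 /\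
       (3 * a + abar) / 4 < (bbar + 3 * b) / 4 /\
       (bbar + 3 * b) / 4 < b /\ b <= 1) :
  (ratio_0_to_0 f phi -> ratio_inf_to_inf f phi ->
     exists U : R -> R -> R,
       (forall lam, lam > 0 -> is_pos_solution phi c d h f lam (U lam)) /\
       tends_inf_at_0plus (fun lam => norm_inf (U lam)) /\
       tends_0_at_inf (fun lam => norm_inf (U lam)))
  /\
  (ratio_0_to_inf f phi -> ratio_inf_to_0 f phi ->
     exists U : R -> R -> R,
       (forall lam, lam > 0 -> is_pos_solution phi c d h f lam (U lam)) /\
       tends_0_at_0plus (fun lam => norm_inf (U lam)) /\
       tends_inf_at_inf (fun lam => norm_inf (U lam))).
Proof.
destruct Hphi as [_ [Hphi_lt [Phi [HPhi_cont [HphiK HPhiK]]]]].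
destruct HA as [[Hpsi1_pos [Hpsi1_cont [Hpsi1_lt [g' [Hg'_pos [Hg'_cont [Hg'K HKg']]]]]]]
  [[Hpsi2_pos [Hpsi2_cont [Hpsi2_lt _]]] HA]].
destruct Hhint as [g [Hg_pos [HgK [HKg Hint]]]].
destruct Hc as [Hc_cont Hc_pos]. destruct Hd as [Hd_cont Hd_pos].
destruct Hf as [Hf_cont [Hf_nn Hf_pos]]. destruct Hh as [Hh_cont [Hh_nn Hh_ne]].
assert (Hphi0 : phi 0 = 0).
{ assert (E := Hphi_odd 0). rewrite Ropp_0 in E. lra. }
assert (HPhi_le : forall x y, phi x <= y -> x <= Phi y).
{ intros x y Hxy. apply Rnot_lt_le. intro Hlt. apply Hphi_lt in Hlt. rewrite HPhiK in Hlt. lra. }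
assert (HPhi_ge : forall x y, y <= phi x -> Phi y <= x).
{ intros x y Hxy. apply Rnot_lt_le. intro Hlt. apply Hphi_lt in Hlt. rewrite HPhiK in Hlt. lra. }
(* The inverse [g] from the integrability condition comes without continuity; it agrees on the
   half-line with the continuous inverse contained in condition (A). *)
assert (Hg_eq : forall y, 0 <= y -> g y = g' y).
{ intros y Hy. rewrite <- (HKg' y Hy) at 1. apply HgK, Hg'_pos, Hy. }
assert (Hg_cont : cont_on nonneg_set g).
{ intros x Hx eps Heps. destruct (Hg'_cont x Hx eps Heps) as [del [Hdel H]].
  exists del. split; [exact Hdel|]. intros y Hy Hyx. rewrite !Hg_eq by assumption. auto. }
assert (Hg_mono : forall x y, 0 <= x -> x <= y -> g x <= g y).
{ intros x y Hx Hxy. apply Rnot_lt_le. intro Hlt.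
  apply Hpsi1_lt in Hlt; [|apply Hg_pos; lra]. rewrite !HKg in Hlt by lra. lra. }
assert (HG : growth_data phi Phi g psi2).
{ split; auto.
  - intros y. apply Rle_antisym.
    + apply HPhi_ge. rewrite Hphi_odd, HPhiK. lra.
    + apply HPhi_le. rewrite Hphi_odd, HPhiK. lra.
  - intros y z Hy Hz. apply HPhi_ge.
    assert (HPy : 0 <= Phi y) by (apply HPhi_le; lra).
    assert (E := proj1 (HA (Phi y) (g z) HPy (Hg_pos z Hz))).
    rewrite HPhiK, HKg in E by exact Hz. exact E.
  - intros m z Hm Hz. apply HPhi_le, HA; assumption. }
destruct (positive_bounds c Hc_cont Hc_pos) as [cmin [cmax [Hcmin Hcb]]].
destruct (positive_bounds d Hd_cont Hd_pos) as [dmin [dmax [Hdmin Hdb]]].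
destruct (G_exists Hh_cont Hh_nn Hg_pos Hg_mono Hg_cont Hint) as [G [HG1 [HG2 [HG3 HG4]]]].
destruct (mass_points_exist Hh_cont Hh_nn Hh_ne)
  as [a [x [b [x1 [x2 [b1 [e [del [mu Hmp]]]]]]]]].
assert (Hch : forall t, 0 < t < 1 -> continuity_pt h t).
{ intros t Ht. apply cont_on_open_pt; assumption. }
assert (HP : forall lam, lam > 0 ->
  problem phi Phi g psi2 (fun s => lam * f (Rmax 0 s)) h (prim h) G c d cmin cmax dmin dmax).
{ intros lam Hlam. split; auto.
  - intros s. apply Rmult_le_pos; [lra|]. apply Hf_nn, Rmax_l.
  - intros s. apply (continuity_pt_scal (fun s => f (Rmax 0 s)) lam).
    apply cont_nonneg_extend, Hf_cont.
  - intros y z Hy Hyz Hz. apply prim_mono; assumption.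
  - apply prim_half.
  - intros t Ht. apply prim_der; assumption. }
(* Any value of [lam] would do: only facts free of [lam] are drawn from it, namely the signs of
   constants and the monotonicity of [G]. *)
assert (HP1 := HP 1 ltac:(lra)).
assert (HS := shoot_scheme HP1 1 ltac:(lia) 0).
assert (Hcmax := cmax_pos HS). assert (Hdmax := dmax_pos HS).
assert (HGt : 0 <= G 1 - G 0).
{ assert (E1 := G_mono_left HP1 0 (1 / 2) ltac:(lra) ltac:(lra) ltac:(lra)).
  assert (E2 := G_mono_right HP1 (1 / 2) 1 ltac:(lra) ltac:(lra) ltac:(lra)). lra. }
assert (Hpsi1_gt : forall y, 0 < y -> 0 < psi1 y).
{ intros y Hy. apply Rle_lt_trans with (psi1 0); [apply Hpsi1_pos; lra|apply Hpsi1_lt; lra]. }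
(* Since g(a0 / dmin) will be [q], the condition on [a0] becomes q (G 1 - G 0) < cmin; the added 1
   makes it strict and the denominator nonzero. *)
set (q := cmin / (G 1 - G 0 + 1)).
assert (Hq : 0 < q) by (apply Rdiv_lt_0_compat; lra).
set (a0 := dmin * psi1 q).
assert (Ha0 : 0 < a0) by (apply Rmult_lt_0_compat; [lra|apply Hpsi1_gt, Hq]).
assert (Ha : g (a0 / dmin) * (G 1 - G 0) < cmin).
{ replace (a0 / dmin) with (psi1 q) by (unfold a0; field; lra).
  rewrite HgK by lra. assert (E : q * (G 1 - G 0 + 1) = cmin) by (unfold q; field; lra). nra. }
set (kap := harnack_const g cmin cmax dmin dmax del).
assert (Hdel := mp_del Hmp). assert (Hmu := mp_mu Hmp).
assert (Hkap : 0 < kap) by apply (harnack_const_bounds HG HS del Hdel).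
assert (Hkap4 : 0 < harnack_const g cmin cmax dmin dmax (1 / 4))
  by apply (harnack_const_bounds HG HS (1 / 4) ltac:(lra)).
set (b0 := dmax * psi2 (2 * cmax / del) / mu).
assert (Hb0 : 0 <= b0).
{ repeat apply Rmult_le_pos; try lra; [|left; apply Rinv_0_lt_compat; lra].
  apply Hpsi2_pos. apply Rmult_le_pos; [lra|left; apply Rinv_0_lt_compat; lra]. }
assert (Hpk := Hpsi1_gt kap Hkap).
assert (HA1 : forall x y, 0 <= x -> 0 <= y -> phi x * psi1 y <= phi (x * y)).
{ intros s t Hs Ht. apply HA; assumption. }
set (F := fun lam s => lam * f (Rmax 0 s)).
set (bad := fun lam m => sublevel (F lam) phi a0 m \/ suplevel (F lam) phi kap b0 m).
pose proof (fun lam r0 R0 Hlam =>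
  exists_solution (HP lam Hlam) Hmp a0 (Rlt_le _ _ Ha0) Ha r0 R0) as Hex.
fold kap b0 in Hex.
assert (Hsup : forall lam C m, 0 < lam -> 0 < m -> b0 <= lam * (C * psi1 kap) ->
  (forall s, kap * m <= s <= m -> C * phi s <= f s) -> suplevel (F lam) phi kap b0 m).
{ intros lam C m Hlam Hm HC H. apply (suplevel_of Hphi_lt psi1); auto.
  intros s Hs. eapply Rle_trans; [|apply H, Hs].
  assert (0 < kap * m) by (apply Rmult_lt_0_compat; lra).
  apply Rmult_le_compat_r; [left; apply (phi_pos Hphi_lt Hphi0); lra|].
  assert (Hlk : 0 < lam * psi1 kap) by (apply Rmult_lt_0_compat; lra).
  apply Rmult_le_reg_r with (lam * psi1 kap); [exact Hlk|].
  unfold Rdiv. rewrite Rmult_assoc, Rinv_l; lra. }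
assert (Hsub : forall lam C m, 0 < lam -> 0 < m -> lam * C <= a0 ->
  (forall s, 0 < s <= m -> f s <= C * phi m) -> sublevel (F lam) phi a0 m).
{ intros lam C m Hlam Hm HC H. apply (sublevel_of Hf_cont); auto.
  intros s Hs. eapply Rle_trans; [apply H, Hs|].
  apply Rmult_le_compat_r; [left; apply (phi_pos Hphi_lt Hphi0); lra|].
  apply Rmult_le_reg_l with lam; [exact Hlam|].
  replace (lam * (a0 / lam)) with a0 by (field; lra). exact HC. }
assert (HC0 : forall lam, 0 < lam -> lam * (a0 / lam) <= a0).
{ intros lam Hlam. right. field. lra. }
assert (HC1 : forall lam, 0 < lam -> b0 <= lam * (b0 / (lam * psi1 kap) * psi1 kap)).
{ intros lam Hlam. right. field. lra. }
split; intros Hr0 Hri.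
- destruct (family_of_solutions (is_pos_solution phi c d h f) bad _ Hkap4)
    as [U [HU [T1 [_ [_ T2]]]]].
  { intros lam Hlam.
    destruct (Hr0 (a0 / lam) ltac:(apply Rdiv_lt_0_compat; lra)) as [r0 [Hr0p Hr0']].
    destruct (Hri (b0 / (lam * psi1 kap))) as [K HK].
    (* For m beyond this value the whole interval from kap m to m lies above [K], where [f / phi] is
       large. *)
    apply (Hex lam r0 (Rmax 0 K / kap)); auto.
    - apply Rmult_le_pos; [apply Rmax_l|left; apply Rinv_0_lt_compat; lra].
    - left. split; intros m Hm.
      + apply (Hsub lam (a0 / lam)); auto; [lra|]. intros s Hs.
        apply Rle_trans with (a0 / lam * phi s).
        * apply (ratio_lt Hphi_lt Hphi0); [lra|apply Hr0'; lra].
        * apply Rmult_le_compat_l; [left; apply Rdiv_lt_0_compat; lra|].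
          apply (phi_mono Hphi_lt). lra.
      + assert (E : Rmax 0 K < kap * m).
        { apply Rmult_lt_compat_l with (r := kap) in Hm; [|exact Hkap].
          replace (kap * (Rmax 0 K / kap)) with (Rmax 0 K) in Hm by (field; lra). exact Hm. }
        assert (E0 := Rmax_l 0 K). assert (E1 := Rmax_r 0 K).
        apply (Hsup lam (b0 / (lam * psi1 kap))); auto; [nra|]. intros s Hs.
        apply (ratio_gt Hphi_lt Hphi0); [lra|apply HK; lra]. }
  exists U. split; [exact HU|]. split; [apply T1|apply T2].
  + intros M HM. destruct (f_le_phi_bounded Hf_cont Hphi_lt Hphi0 M Hr0) as [C [HC H]].
    exists (a0 / C). split; [apply Rdiv_lt_0_compat; lra|]. intros lam m Hlam Hm. left.
    apply (Hsub lam C); try lra.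
    * assert (E : a0 / C * C = a0) by (field; lra). nra.
    * intros s Hs. eapply Rle_trans; [apply H; lra|].
      apply Rmult_le_compat_l; [lra|]. apply (phi_mono Hphi_lt). lra.
  + intros eps Heps.
    destruct (f_ge_phi_unbounded Hf_cont Hf_pos Hphi_lt Hphi0 (kap * eps)
      ltac:(apply Rmult_lt_0_compat; lra) Hri) as [C [HC H]].
    assert (HCk : 0 < C * psi1 kap) by (apply Rmult_lt_0_compat; lra).
    exists (b0 / (C * psi1 kap)).
    assert (HL : 0 <= b0 / (C * psi1 kap)).
    { apply Rmult_le_pos; [exact Hb0|left; apply Rinv_0_lt_compat; lra]. }
    split; [exact HL|]. intros lam m Hlam Hm. right.
    apply (Hsup lam C); try lra.
    * assert (E : b0 / (C * psi1 kap) * (C * psi1 kap) = b0) by (field; lra). nra.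
    * intros s Hs. apply H. nra.
- destruct (family_of_solutions (is_pos_solution phi c d h f) bad _ Hkap4)
    as [U [HU [_ [T2 [T1 _]]]]].
  { intros lam Hlam.
    destruct (Hr0 (b0 / (lam * psi1 kap))) as [r0 [Hr0p Hr0']].
    (* Unboundedness of [phi] comes from its being onto: [Phi B] is sent to [B]. *)
    assert (Hunb : forall B, exists m, 0 < m /\ B <= phi m).
    { intros B. exists (Rmax 1 (Phi B)). split.
      - apply Rlt_le_trans with 1; [lra|apply Rmax_l].
      - rewrite <- (HPhiK B) at 1. apply (phi_mono Hphi_lt), Rmax_r. }
    destruct (f_le_phi_infinity Hf_cont Hphi_lt Hphi0 (a0 / lam)
      ltac:(apply Rdiv_lt_0_compat; lra) Hunb Hri) as [K [HK0 HK]].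
    apply (Hex lam r0 K); auto.
    right. split; intros m Hm.
    - apply (Hsup lam (b0 / (lam * psi1 kap))); auto; [lra|]. intros s Hs.
      assert (0 < kap * m) by (apply Rmult_lt_0_compat; lra).
      apply (ratio_gt Hphi_lt Hphi0); [lra|apply Hr0'; lra].
    - apply (Hsub lam (a0 / lam)); auto; lra. }
  exists U. split; [exact HU|]. split; [apply T1|apply T2].
  + intros eps Heps.
    destruct (f_le_phi_unbounded Hf_cont Hphi_lt Hphi0 eps Heps Hri) as [C [HC H]].
    exists (a0 / C). split; [apply Rdiv_lt_0_compat; lra|]. intros lam m Hlam Hm. left.
    apply (Hsub lam C); try lra.
    * assert (E : a0 / C * C = a0) by (field; lra). nra.
    * intros s Hs. apply H; lra.
  + intros M HM. destruct (f_ge_phi_bounded Hf_cont Hf_pos Hphi_lt Hphi0 M Hr0) as [C [HC H]].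
    assert (HCk : 0 < C * psi1 kap) by (apply Rmult_lt_0_compat; lra).
    exists (b0 / (C * psi1 kap)).
    assert (HL : 0 <= b0 / (C * psi1 kap)).
    { apply Rmult_le_pos; [exact Hb0|left; apply Rinv_0_lt_compat; lra]. }
    split; [exact HL|]. intros lam m Hlam Hm. right.
    apply (Hsup lam C); try lra.
    * assert (E : b0 / (C * psi1 kap) * (C * psi1 kap) = b0) by (field; lra). nra.
    * intros s Hs. assert (0 < kap * m) by (apply Rmult_lt_0_compat; lra). apply H. lra.
Qed.
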